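(* Let $p\ge 1$ be a real number. Let $z>y\ge 1$ be integers and $0\le\alpha<1$ be such that the $(\alpha,z,y)$-Johnson Coverage problem is NP-hard. Then for every constant $\varepsilon>0$ there is a constant $\rho>0$ such that, given as input a point-set $\mathcal{P}\subset\mathbb{R}^d$ of size $n$ (with $d=O(\log n)$), a collection $\mathcal{C}\subset\mathbb{R}^d$ of $m$ candidate centers (with $m=\mathrm{poly}(n)$), and a parameter $k$, it is NP-hard to distinguish between the following two cases: - Completeness: there exist $\mathcal{C}'=\{c_1,\dots,c_k\}\subseteq\mathcal{C}$ and $\sigma:\mathcal{P}\to\mathcal{C}'$ such that $\sum_{a\in\mathcal{P}}\|a-\sigma(a)\|_p\le\rho\, n(\log n)^{1/p}$. - Soundness: for every $\mathcal{C}'=\{c_1,\dots,c_k\}\subseteq\mathcal{C}$ and every $\sigma:\mathcal{P}\to\mathcal{C}'$, $\sum_{a\in\mathcal{P}}\|a-\sigma(a)\|_p\ge(\zeta_1(p,z-y,\alpha)-\varepsilon)\cdot\rho\, n(\log n)^{1/p}$.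
   Context: $(\alpha,z,y)$-Johnson Coverage problem ($z>y\ge1$): given a universe $U=[n]=\{1,\dots,n\}$, a collection $E\subseteq\binom{[n]}{z}$ of $z$-element subsets, and a parameter $k$, distinguish between: (Completeness) there are $S_1,\dots,S_k\in\binom{[n]}{y}$ such that every $T\in E$ contains some $S_i$; (Soundness) for all $S_1,\dots,S_k\in\binom{[n]}{y}$, the number of $T\in E$ containing at least one $S_i$ is at most $\alpha|E|$. For integers $q\ge t\ge r\geq 1$, $J(q,t,r)$ is the bipartite graph with parts $\binom{[q]}{t}$ and $\binom{[q]}{r}$ in which $S\in\binom{[q]}{t}$ and $S'\in\binom{[q]}{r}$ are adjacent iff $S'\subseteq S$. For a bipartite graph $G=(A\dot\cup B,E)$ and $\lambda\ge1$, a map $\tau:A\cup B\to\mathbb{R}^d$ $\lambda$-gap-realizes $G$ in the $\ell_p$-metric if for some $\beta>0$: $\|\tau(u)-\tau(v)\|_p=\beta$ for all $(u,v)\in E$, and $\|\tau(u)-\tau(v)\|_p\ge\lambda\beta$ for all $(u,v)\in(A\times B)\setminus E$; moreover $\tau$ is required to be computable in time polynomial in the size of $G$. The gap number $g_p(G)$ is the largest $\lambda$ for which some map $\lambda$-gap-realizes $G$ in a $d$-dimensional $\ell_p$-metric space with $d\le\mathrm{poly}(|A|+|B|)$. For $\Delta\ge1$, $\gamma_{p,\Delta}:=\inf_{q\ge t\ge\Delta+1}g_p(J(q,t,t-\Delta))$, and $\zeta_1(p,\Delta,\alpha):=1+(1-\alpha)(\gamma_{p,\Delta}-1)$. *)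

(* Defs.v *)
From HB Require Import structures.
From mathcomp Require Import all_boot all_order all_algebra.
From mathcomp Require Import all_classical all_reals all_analysis.

Set Implicit Arguments.
Unset Strict Implicit.
Unset Printing Implicit Defensive.

Import Order.TTheory GRing.Theory Num.Theory.
Local Open Scope ring_scope.

(** * Polynomial time and NP-hardness

    The machine model is a structured program acting on registers that hold
    bit strings and are accessed as stacks, each elementary step costing one
    unit of time.  A program mentions finitely many registers, and two stacks
    make a tape, so these programs and multitape Turing machines simulate each
    other with at most polynomial overhead. *)

Definition word := seq bool.
Definition store := nat -> word.

Inductive prog :=
| Push of nat & bool
| Pop of nat
| Seq of prog & prog
| Case of nat & prog & prog & prog
| While of nat & prog.

(** [run c s t s']: from [s], the program [c] halts in [s'] after [t] steps.
    [Case r c0 c1 c2] branches on whether register [r] is empty, has [true]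
    on top, or has [false] on top; [While r c] iterates [c] as long as
    register [r] is nonempty. *)
Inductive run : prog -> store -> nat -> store -> Prop :=
| RunPush r b s : run (Push r b) s 1 [eta s with r |-> b :: s r]
| RunPop r s : run (Pop r) s 1 [eta s with r |-> behead (s r)]
| RunSeq c1 c2 s1 s2 s3 t1 t2 :
    run c1 s1 t1 s2 -> run c2 s2 t2 s3 -> run (Seq c1 c2) s1 (t1 + t2) s3
| RunCase r c0 c1 c2 s s' t :
    run (match s r with [::] => c0 | b :: _ => if b then c1 else c2 end) s t s' ->
    run (Case r c0 c1 c2) s t.+1 s'
| RunWhileStop r c s : s r = [::] -> run (While r c) s 1 s
| RunWhileStep r c s1 s2 s3 t1 t2 :
    s1 r <> [::] -> run c s1 t1 s2 -> run (While r c) s2 t2 s3 ->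
    run (While r c) s1 (t1 + t2).+1 s3.

(** Every polynomial in [N] is at most [poly_bound a N] for some [a]. *)
Definition poly_bound (a N : nat) : nat := (a * N ^ a + a)%N.

(** The [l] arguments are initially in registers [0, ..., l - 1], the other
    registers being empty; the result is read from register [0]. *)
Definition poly_time (l : nat) (f : l.-tuple word -> word) : Prop :=
  exists (c : prog) (a : nat), forall xs : l.-tuple word,
    exists (t : nat) (s : store),
      [/\ run c (fun r => nth [::] xs r) t s,
          (t <= poly_bound a (\sum_(x <- xs) size x))%N
        & s 0%N = f xs].

Definition inNP (L : word -> Prop) : Prop :=
  exists (V : 2.-tuple word -> word) (a : nat), poly_time V /\
    forall x, L x <->
      exists w, (size w <= poly_bound a (size x))%N /\ V [tuple x; w] = [:: true].

(** NP-hardness of distinguishing [Yes] from [No] (a promise problem), under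
    polynomial-time many-one reductions. *)
Definition NP_hard (Yes No : word -> Prop) : Prop :=
  forall L, inNP L ->
    exists f : 1.-tuple word -> word, poly_time f /\
      forall x, (L x -> Yes (f [tuple x])) /\ (~ L x -> No (f [tuple x])).

(** * Encodings

    All the encodings are self-delimiting.  Cardinalities (the size of the
    universe, the dimension, [k], lengths of lists) are written in unary,
    coordinates in binary. *)

Definition enc_nat (n : nat) : word := rcons (nseq n true) false.

Definition enc_seq (T : Type) (enc : T -> word) (s : seq T) : word :=
  enc_nat (size s) ++ flatten (map enc s).

(** Binary digits, least significant first; [up_log 2 n.+1] is their number. *)
Definition bits (n : nat) : seq bool :=
  mkseq (fun i => odd (n %/ 2 ^ i)) (up_log 2 n.+1).

Definition enc_bin (n : nat) : word := enc_seq (fun b => [:: b]) (bits n).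

Definition enc_rat (x : rat) : word :=
  (numq x < 0) :: enc_bin `|numq x|%N ++ enc_bin `|denq x|%N.

Definition enc_point (d : nat) (v : 'rV[rat]_d) : word :=
  flatten [seq enc_rat (v ord0 i) | i <- enum 'I_d].

(** * Johnson Coverage *)

Record jc_instance := JCInstance {
  jc_n : nat;
  jc_E : seq {set 'I_jc_n};
  jc_k : nat }.

(** [jc_E] lists the collection without repetition.  It is required to be
    nonempty: an empty collection would satisfy both the completeness and the
    soundness conditions. *)
Definition jc_valid (z : nat) (I : jc_instance) : Prop :=
  [/\ uniq (jc_E I), all (fun T : {set 'I_(jc_n I)} => #|T| == z) (jc_E I) & jc_E I != [::]].

Definition enc_jc (I : jc_instance) : word :=
  enc_nat (jc_n I) ++ enc_nat (jc_k I) ++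
  enc_seq (fun T : {set 'I_(jc_n I)} => [seq i \in T | i <- enum 'I_(jc_n I)])
          (jc_E I).

Definition covered (n : nat) (S : seq {set 'I_n}) (T : {set 'I_n}) : bool :=
  has (fun S' : {set 'I_n} => S' \subset T) S.

Definition jc_completeness (y : nat) (I : jc_instance) : Prop :=
  exists S : (jc_k I).-tuple {set 'I_(jc_n I)},
    all (fun S' : {set 'I_(jc_n I)} => #|S'| == y) S /\ all (covered S) (jc_E I).

Definition jc_soundness (R : realType) (alpha : R) (y : nat)
    (I : jc_instance) : Prop :=
  forall S : (jc_k I).-tuple {set 'I_(jc_n I)},
    all (fun S' : {set 'I_(jc_n I)} => #|S'| == y) S ->
    (count (covered S) (jc_E I))%:R <= alpha * (size (jc_E I))%:R.

Definition jc_yes (z y : nat) (w : word) : Prop :=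
  exists I, [/\ w = enc_jc I, jc_valid z I & jc_completeness y I].

Definition jc_no (R : realType) (alpha : R) (z y : nat) (w : word) : Prop :=
  exists I, [/\ w = enc_jc I, jc_valid z I & jc_soundness alpha y I].

Definition johnson_coverage_NP_hard (R : realType) (alpha : R) (z y : nat) :
    Prop :=
  NP_hard (jc_yes z y) (jc_no alpha z y).

(** * Gap numbers of bipartite graphs *)

Definition lp_norm (R : realType) (p : R) (d : nat) (x : 'rV[R]_d) : R :=
  (\sum_(i < d) `|x ord0 i| `^ p) `^ p^-1.

Section Gap.
Variables (R : realType) (p : R) (A B : finType) (adj : A -> B -> bool).

Definition gap_realizes (lambda : R) (d : nat) (tau : A + B -> 'rV[R]_d) :
    Prop :=
  exists beta : R, 0 < beta /\
    forall (u : A) (v : B),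
      if adj u v then lp_norm p (tau (inl u) - tau (inr v)) = beta
      else lambda * beta <= lp_norm p (tau (inl u) - tau (inr v)).

Definition enc_graph : word :=
  enc_nat #|A| ++ enc_nat #|B| ++
  flatten [seq [seq adj u v | v <- enum B] | u <- enum A].

(** Real coordinates are computed to any requested precision [2 ^- m], in
    time polynomial in the size of the graph and [m]. *)
Definition poly_computable (d : nat) (tau : A + B -> 'rV[R]_d) : Prop :=
  exists f : 2.-tuple word -> word, poly_time f /\
    forall m : nat, exists tau' : A + B -> 'rV[rat]_d,
      f [tuple enc_graph; nseq m true] =
        enc_nat d ++ flatten [seq enc_point (tau' v) | v <- enum {: A + B}] /\
      forall v i, `|tau v ord0 i - ratr (tau' v ord0 i)| <= 2 ^- m.

(** For one given graph the bound on [d] is no restriction, its polynomial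
    being unspecified. *)
Definition gap_realizable (lambda : R) : Prop :=
  1 <= lambda /\
  exists (d : nat) (tau : A + B -> 'rV[R]_d),
    [/\ exists a, (d <= poly_bound a (#|A| + #|B|))%N,
        poly_computable tau & gap_realizes lambda tau].

(** A supremum in the extended reals: it is [+oo] on complete bipartite
    graphs. *)
Definition gap_number : \bar R :=
  ereal_sup [set lambda%:E | lambda in gap_realizable]%classic.

End Gap.

Definition ksubset (q t : nat) : finType := {S : {set 'I_q} | #|S| == t}.

Definition johnson (q t r : nat) (S : ksubset q t) (S' : ksubset q r) : bool :=
  sval S' \subset sval S.

Definition gamma_gap (R : realType) (p : R) (Delta : nat) : \bar R :=
  ereal_inf [set g | exists q t : nat,
    [/\ (t <= q)%N, (Delta.+1 <= t)%N
      & g = gap_number p (@johnson q t (t - Delta))]]%classic.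

(** [gamma_gap] is finite: constant maps on both sides give [1 <= gap_number],
    and for [t < q] the graph is connected and not complete, so that the
    triangle inequality bounds [gap_number]. *)
Definition zeta1 (R : realType) (p : R) (Delta : nat) (alpha : R) : R :=
  1 + (1 - alpha) * (fine (gamma_gap p Delta) - 1).

(** * Discrete k-median in l_p *)

Record kmed_instance := KMedInstance {
  km_d : nat;
  km_P : seq 'rV[rat]_km_d;
  km_C : seq 'rV[rat]_km_d;
  km_k : nat }.

(** [D] and [M] are the constants hidden in [d = O(log n)] and [m = poly(n)].
    For [n <= 1] the bound [n (log n)^(1/p)] vanishes and the two cases could
    hold together, whence [2 <= n]. *)
Definition kmed_valid (R : realType) (D M : nat) (I : kmed_instance) : Prop :=
  let n := size (km_P I) in
  [/\ uniq (km_P I), uniq (km_C I), (2 <= n)%N,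
      (km_d I)%:R <= D%:R * ln n%:R :> R
    & (size (km_C I) <= poly_bound M n)%N].

Definition enc_kmed (I : kmed_instance) : word :=
  enc_nat (km_d I) ++ enc_nat (km_k I) ++
  enc_seq (@enc_point (km_d I)) (km_P I) ++
  enc_seq (@enc_point (km_d I)) (km_C I).

(** [kmed_solution C' sigma]: [C'] is a choice of [k] candidate centers and
    [sigma] maps the point-set to [C']; the values of [sigma] elsewhere are
    irrelevant. *)
Definition kmed_solution (I : kmed_instance)
    (C' : (km_k I).-tuple 'rV[rat]_(km_d I))
    (sigma : 'rV[rat]_(km_d I) -> 'rV[rat]_(km_d I)) : Prop :=
  {subset C' <= km_C I} /\ {in km_P I, forall a, sigma a \in C'}.

Definition kmed_cost (R : realType) (p : R) (I : kmed_instance)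
    (sigma : 'rV[rat]_(km_d I) -> 'rV[rat]_(km_d I)) : R :=
  \sum_(a <- km_P I) lp_norm p (map_mx ratr (a - sigma a)).

Definition kmed_scale (R : realType) (p : R) (I : kmed_instance) : R :=
  let n := size (km_P I) in n%:R * (ln n%:R) `^ p^-1.

Definition kmed_yes (R : realType) (p rho : R) (D M : nat) (w : word) : Prop :=
  exists I, [/\ w = enc_kmed I, kmed_valid R D M I
    & exists (C' : (km_k I).-tuple 'rV[rat]_(km_d I)) sigma,
        kmed_solution C' sigma /\
        kmed_cost p sigma <= rho * kmed_scale p I].

Definition kmed_no (R : realType) (p factor rho : R) (D M : nat) (w : word) :
    Prop :=
  exists I, [/\ w = enc_kmed I, kmed_valid R D M I
    & forall (C' : (km_k I).-tuple 'rV[rat]_(km_d I)) sigma,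
        kmed_solution C' sigma ->
        factor * (rho * kmed_scale p I) <= kmed_cost p sigma].

(* Main.v *)
(** A gap realization of the Johnson graph J(Q, z, y), for one large constant Q,
    is extended to a universe [n] of any size by means of a code: each element
    of [n] receives a codeword over the alphabet [Q], and a z-subset, or a
    y-subset, is sent to the concatenation over the coordinates i of the images
    of the sets formed by the i-th letters of its elements.  When two codewords
    agree on a small fraction of the coordinates only, almost every coordinate
    is injective on the union of a z-subset T and a y-subset S, so that the p-th
    power of the distance from T to S is nearly the block length times the
    value in J(Q, z, y).  A greedy code has logarithmic block length and is
    found in polynomial time by exhaustive search.

    The letters on which T or S collapses contribute at most the diameter of
    the gap realization, which the connectedness of the Johnson graph bounds
    independently of Q.  This matters because Q is chosen after the admissible
    fraction of bad coordinates.

    The points are the sets of the collection, the centers all the y-subsets.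
    Each point is repeated 2^(K b) times, b being about the logarithm of the
    size of the instance: this makes the logarithm of the number of points
    known up to a factor 1 + 1/K.  Tags with entries in {0, kappa}, for a small
    constant kappa, keep the points (and the centers) pairwise distinct.

    The value gamma enters only through the real gap realizations that it
    provides: being finite tables, they are replaced by rational approximations
    that are constants of the reduction, and how they are computed is
    irrelevant. *)
Require Import Defs.
From mathcomp Require Import all_boot all_order all_algebra.
From mathcomp Require Import all_classical all_reals all_analysis.
From mathcomp Require Import zify ring lra.

Set Implicit Arguments.
Unset Strict Implicit.
Unset Printing Implicit Defensive.

(** * Polynomial bounds *)

(** The constants are fixed in the order [lam], [theta], [B], [K], [Q]. The code has length [K * b]
    and two of its words agree in fewer than [b] places, so at most a fraction (z + y)^2 / K of the
    columns is bad. Each costs at most the diameter bound [B], whence a [K] of order (z + y)^2 (1 +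
    B) / theta. The alphabet then takes 2^(2K) letters: with l = K b, at most 2^l Q^(l - b) words
    agree with a given one in [b] places or more, which leaves Q^b / 2^l = 2^(K b) codewords, enough
    for the universe.

    Distances are handled through their p-th powers, which add up over the columns. Roots are taken
    point by point, before averaging, so that the cost averages the norms 1 and [lam] themselves.
    This gives alpha + (1 - alpha) lam, the value of [zeta1] at gamma = lam. The supremum in the gap
    number need not be attained: half of epsilon pays for this, the other half for all errors of
    relative size [theta]. *)

Lemma leq_expr k a b : a <= b -> a ^ k <= b ^ k.
Proof. by case: k => // k ab; rewrite leq_exp2r. Qed.

(** The base is at least 2, so constants and sums are absorbed by the exponent and a single [m]
    describes the bound. *)
Definition polyb (X : Type) (S T : X -> nat) : Prop :=
  exists m, forall x, T x <= (S x).+2 ^ m.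

Section PolyBounds.
Variable X : Type.
Implicit Types S T U : X -> nat.

Lemma polyb_le S T U : (forall x, T x <= U x) -> polyb S U -> polyb S T.
Proof. by move=> le [m hm]; exists m => x; apply: leq_trans (le x) (hm x). Qed.

Lemma polyb_id S : polyb S S.
Proof. by exists 1 => x; lia. Qed.

Lemma polyb_cst S k : polyb S (fun=> k).
Proof.
exists k => x; apply: leq_trans (ltnW (ltn_expl k (ltnSn 1))) _.
exact: leq_expr.
Qed.

Lemma polyb_mul S T U : polyb S T -> polyb S U -> polyb S (fun x => T x * U x).
Proof. by move=> [m hm] [k hk]; exists (m + k) => x; rewrite expnD leq_mul. Qed.

Lemma polyb_add S T U : polyb S T -> polyb S U -> polyb S (fun x => T x + U x).
Proof.
move=> [m hm] [k hk]; exists (m + k).+1 => x; rewrite expnS expnD.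
have := hm x; have := hk x.
have : 0 < (S x).+2 ^ m by rewrite expn_gt0.
have : 0 < (S x).+2 ^ k by rewrite expn_gt0.
by set a := _ ^ m; set b := _ ^ k; nia.
Qed.

Lemma polyb_exp S T k : polyb S T -> polyb S (fun x => T x ^ k).
Proof.
move=> [m hm]; exists (m * k) => x; rewrite expnM; exact: leq_expr.
Qed.

Lemma polyb_S S T : polyb S T -> polyb S (fun x => (T x).+1).
Proof.
move=> hT; apply: (polyb_le (U := fun x => 1 + T x)) => // .
by apply: polyb_add => //; apply: polyb_cst.
Qed.

Lemma polyb_trans S T U : polyb S T -> polyb T U -> polyb S U.
Proof.
move=> hT [k hk]; apply: polyb_le hk _.
by apply: polyb_exp; do 2 apply: polyb_S.
Qed.

Lemma polyb_bound a S : polyb S (fun x => poly_bound a (S x)).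
Proof.
apply: polyb_add (polyb_cst _ _); apply: polyb_mul (polyb_cst _ _) _.
exact: polyb_exp (polyb_id _).
Qed.

Lemma polyb_poly_bound S T : polyb S T ->
  exists a, forall x, T x <= poly_bound a (S x).
Proof.
(* [3 ^ m] has three uses: an exponent above [m], the factor coming from N + 2 <= 3 N for N > 0, and
   the additive term that settles N = 0. *)
move=> [m hm]; exists (3 ^ m) => x; apply: leq_trans (hm x) _.
rewrite /poly_bound; case: (S x) => [|N].
  apply: leq_trans (leq_addl _ _); exact: leq_expr.
apply: leq_trans (leq_addr _ _).
apply: (@leq_trans ((3 * N.+1) ^ m)); first by apply: leq_expr; lia.
by rewrite expnMn leq_mul2l leq_pexp2l ?orbT // ltnW // ltn_expl.
Qed.

End PolyBounds.

Lemma polyb_reindex (X Y : Type) (g : Y -> X) (S T : X -> nat) :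
  polyb S T -> polyb (S \o g) (T \o g).
Proof. by move=> [m hm]; exists m => y /=. Qed.

(** * Executions *)

Definition st (l : seq word) : store := fun r => nth [::] l r.

(** Time is kept as an upper bound, so that executions compose without exact step counts. *)
Definition exec (c : prog) (s : store) (T : nat) (s' : store) : Prop :=
  exists2 t, t <= T & run c s t s'.

Lemma exec_le c s T T' s' : exec c s T s' -> T <= T' -> exec c s T' s'.
Proof. by move=> [t ht hr] hT; exists t => //; apply: leq_trans hT. Qed.

Lemma exec_eq c s1 s2 T s1' s2' :
  exec c s1 T s1' -> s1 =1 s2 -> s1' =1 s2' -> exec c s2 T s2'.
Proof. by move=> h /funext <- /funext <-. Qed.

Lemma exec_seq c1 c2 s1 s2 s3 T1 T2 :
  exec c1 s1 T1 s2 -> exec c2 s2 T2 s3 -> exec (Seq c1 c2) s1 (T1 + T2) s3.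
Proof.
move=> [t1 h1 r1] [t2 h2 r2]; exists (t1 + t2); first exact: leq_add.
exact: RunSeq r1 r2.
Qed.

Lemma exec_stop r c (s : store) : s r = [::] -> exec (While r c) s 1 s.
Proof. by move=> h; exists 1 => //; apply: RunWhileStop. Qed.

Lemma exec_step r c (s1 s2 s3 : store) T1 T2 : s1 r <> [::] ->
  exec c s1 T1 s2 -> exec (While r c) s2 T2 s3 ->
  exec (While r c) s1 (T1 + T2).+1 s3.
Proof.
move=> h [t1 h1 r1] [t2 h2 r2]; exists (t1 + t2).+1.
  by rewrite ltnS leq_add.
exact: RunWhileStep r1 r2.
Qed.

Lemma exec_case r c0 c1 c2 (s s' : store) T :
  exec (match s r with [::] => c0 | b :: _ => if b then c1 else c2 end) s T s' ->
  exec (Case r c0 c1 c2) s T.+1 s'.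
Proof. by move=> [t h hr]; exists t.+1 => //; apply: RunCase. Qed.

(** A step pushes at most one bit. Hence a time bound is also a bound on the size of the output, and
    sizes under composition come for free. *)
Lemma run_size c s t s' : run c s t s' ->
  forall r, size (s' r) <= size (s r) + t.
Proof.
elim=> {c s t s'} //.
- by move=> r b s r' /=; case: eqP => [->|_] /=; lia.
- by move=> r s r' /=; case: eqP => [->|_]; rewrite ?size_behead; lia.
- by move=> c1 c2 s1 s2 s3 t1 t2 _ h1 _ h2 r; have := h1 r; have := h2 r; lia.
- by move=> r c0 c1 c2 s s' t _ h r'; have := h r'; lia.
- by move=> r c s _ r'; lia.
- move=> r c s1 s2 s3 t1 t2 _ _ h1 _ h2 r'.
  by have := h1 r'; have := h2 r'; lia.
Qed.

Lemma exec_size c s T s' r : exec c s T s' -> size (s' r) <= size (s r) + T.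
Proof. by move=> [t ht /run_size /(_ r)]; lia. Qed.

(** Relocates a subroutine above the registers whose contents must survive it. *)
Fixpoint shift (k : nat) (c : prog) : prog :=
  match c with
  | Push r b => Push (k + r) b
  | Pop r => Pop (k + r)
  | Seq c1 c2 => Seq (shift k c1) (shift k c2)
  | Case r c0 c1 c2 => Case (k + r) (shift k c0) (shift k c1) (shift k c2)
  | While r c => While (k + r) (shift k c)
  end.

Definition glue (k : nat) (s0 s : store) : store :=
  fun r => if r < k then s0 r else s (r - k).

Lemma glue_upd k s0 s r w :
  [eta glue k s0 s with k + r |-> w] = glue k s0 [eta s with r |-> w] :> store.
Proof.
apply/funext => x /=; rewrite /glue /=.
case: ltnP => hx; first by case: eqP => // e; lia.
by have -> : (x == k + r) = (x - k == r) by lia.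
Qed.

Lemma glueE k s0 s r : glue k s0 s (k + r) = s r.
Proof. by rewrite /glue ltnNge leq_addr addKn. Qed.

Lemma run_shift k s0 c s t s' :
  run c s t s' -> run (shift k c) (glue k s0 s) t (glue k s0 s').
Proof.
elim=> {c s t s'} /=.
- by move=> r b s; rewrite -glue_upd -(glueE k s0 s r); constructor.
- by move=> r s; rewrite -glue_upd -(glueE k s0 s r); constructor.
- by move=> c1 c2 s1 s2 s3 t1 t2 _ h1 _ h2; apply: RunSeq h1 h2.
- move=> r c0 c1 c2 s s' t _ h; constructor; rewrite glueE.
  by case: (s r) h => // -[].
- by move=> r c s h; constructor; rewrite glueE.
- move=> r c s1 s2 s3 t1 t2 h _ h1 _ h2.
  by apply: RunWhileStep h1 h2; rewrite glueE.
Qed.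

Lemma exec_shift pre c l l' T : exec c (st l) T (st l') ->
  exec (shift (size pre) c) (st (pre ++ l)) T (st (pre ++ l')).
Proof.
move=> [t ht /(run_shift (size pre) (st pre)) hr]; exists t => //.
have E l0 : st (pre ++ l0) = glue (size pre) (st pre) (st l0).
  by apply/funext => r; rewrite /st /glue nth_cat.
by rewrite !E.
Qed.

(** Loop-free programs are executed by computation. The value on [While] is a placeholder, excluded
    by [loopfree]. *)
Fixpoint eval (c : prog) (s : store) : store :=
  match c with
  | Push r b => [eta s with r |-> b :: s r]
  | Pop r => [eta s with r |-> behead (s r)]
  | Seq c1 c2 => eval c2 (eval c1 s)
  | Case r c0 c1 c2 =>
      match s r with
      | [::] => eval c0 s
      | b :: _ => if b then eval c1 s else eval c2 s
      end
  | While _ _ => s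
  end.

Fixpoint loopfree (c : prog) : bool :=
  match c with
  | Push _ _ | Pop _ => true
  | Seq c1 c2 => loopfree c1 && loopfree c2
  | Case _ c0 c1 c2 => [&& loopfree c0, loopfree c1 & loopfree c2]
  | While _ _ => false
  end.

Fixpoint length (c : prog) : nat :=
  match c with
  | Push _ _ | Pop _ => 1
  | Seq c1 c2 => length c1 + length c2
  | Case _ c0 c1 c2 => (length c0 + length c1 + length c2).+1
  | While _ _ => 0
  end.

Lemma exec_eval c s : loopfree c -> exec c s (length c) (eval c s).
Proof.
elim: c s => //=.
- by move=> r b s _; exists 1 => //; constructor.
- by move=> r s _; exists 1 => //; constructor.
- by move=> c1 h1 c2 h2 s /andP[l1 l2]; apply: exec_seq (h1 _ l1) (h2 _ l2).
- move=> r c0 h0 c1 h1 c2 h2 s /and3P[l0 l1 l2]; apply: exec_case.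
  case: (s r) => [|[] _].
  + by apply: exec_le (h0 _ l0) _; lia.
  + by apply: exec_le (h1 _ l1) _; lia.
  + by apply: exec_le (h2 _ l2) _; lia.
Qed.

(** * Clearing, moving and copying registers *)

Definition clear i := While i (Pop i).

Lemma exec_clear i s :
  exec (clear i) s (2 * size (s i)).+1 [eta s with i |-> [::]].
Proof.
move E : (s i) => w; elim: w s E => [|b w IH] s E.
  apply: (@exec_eq _ s s _ s) => //; first exact: exec_stop.
  by move=> r /=; case: eqP => // ->.
have := @exec_step i (Pop i) s _ _ 1 _ _ _ (IH _ _).
move=> /(_ [eta s with i |-> behead (s i)]) H.
apply: exec_eq (exec_le (H _ _ _) _) _ _ => //=.
- by rewrite E.
- by exists 1 => //; constructor.
- by rewrite eqxx E.
- by lia.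
- by move=> r /=; case: eqP.
Qed.

(** The bits arrive in reverse order. *)
Definition move i j := While i
  (Case i (Pop i) (Seq (Push j true) (Pop i)) (Seq (Push j false) (Pop i))).

Definition move2 i j k := While i
  (Case i (Pop i) (Seq (Seq (Push j true) (Push k true)) (Pop i))
                  (Seq (Seq (Push j false) (Push k false)) (Pop i))).

Lemma exec_move i j s : i != j ->
  exec (move i j) s (7 * size (s i)).+1
    [eta s with i |-> [::], j |-> catrev (s i) (s j)].
Proof.
move=> ij; move E : (s i) => w; elim: w s E => [|b w IH] s E.
  apply: (@exec_eq _ s s _ s) => //; first exact: exec_stop.
  by move=> r /=; case: eqP => [->|_] //; case: eqP => // ->.
pose c := Case i (Pop i) (Seq (Push j true) (Pop i)) (Seq (Push j false) (Pop i)).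
have hc : eval c s = [eta s with i |-> w, j |-> b :: s j].
  by apply/funext => r; rewrite /c /= E; case: {+}b; rewrite /= (negPf ij) ?E /=.
have := exec_eval s (isT : loopfree c); rewrite hc => hrun.
have := IH [eta s with i |-> w, j |-> b :: s j].
rewrite /= eqxx eq_sym (negPf ij) => /(_ erefl) H.
have hne : s i <> [::] by rewrite E.
apply: exec_eq (exec_le (exec_step hne hrun H) _) _ _ => //=; first by lia.
by move=> r /=; rewrite eqxx; do 2 case: eqP => //.
Qed.

Lemma exec_move2 i j k s : i != j -> i != k -> j != k ->
  exec (move2 i j k) s (9 * size (s i)).+1
    [eta s with i |-> [::], j |-> catrev (s i) (s j), k |-> catrev (s i) (s k)].
Proof.
move=> ij ik jk; move E : (s i) => w; elim: w s E => [|b w IH] s E.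
  apply: (@exec_eq _ s s _ s) => //; first exact: exec_stop.
  by move=> r /=; case: eqP => [->|_] //; case: eqP => [->|_] //; case: eqP => // ->.
pose c := Case i (Pop i) (Seq (Seq (Push j true) (Push k true)) (Pop i))
                      (Seq (Seq (Push j false) (Push k false)) (Pop i)).
have kj : k != j by rewrite eq_sym.
have ji : j != i by rewrite eq_sym.
have ki : k != i by rewrite eq_sym.
have hc : eval c s = [eta s with i |-> w, j |-> b :: s j, k |-> b :: s k].
  apply/funext => r; rewrite /c /= E; case: {+}b;
  rewrite /= ?(negPf ij) ?(negPf ik) ?(negPf jk) ?(negPf kj) ?E /=;
  by case: (r =P i) => // _; case: (r =P k) => // ->; rewrite (negPf kj).
have := exec_eval s (isT : loopfree c); rewrite hc => hrun.
have := IH [eta s with i |-> w, j |-> b :: s j, k |-> b :: s k].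
rewrite /= !eqxx (negPf ji) (negPf ki) (negPf kj) => /(_ erefl) H.
have hne : s i <> [::] by rewrite E.
apply: exec_eq (exec_le (exec_step hne hrun H) _) _ _ => //=; first by lia.
by move=> r /=; rewrite ?eqxx; do 3 case: eqP => //.
Qed.

Lemma exec_moveL i j l : i != j ->
  exec (move i j) (st l) (7 * size (nth [::] l i)).+1
    (st (set_nth [::] (set_nth [::] l i [::]) j
           (catrev (nth [::] l i) (nth [::] l j)))).
Proof.
move=> ij; apply: exec_eq (exec_move (st l) ij) _ _ => // r.
rewrite /st nth_set_nth /= nth_set_nth /=.
by case: (r =P i) => // ->; rewrite (negPf ij).
Qed.

Lemma exec_move2L i j k l : i != j -> i != k -> j != k ->
  exec (move2 i j k) (st l) (9 * size (nth [::] l i)).+1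
    (st (set_nth [::] (set_nth [::] (set_nth [::] l i [::]) j
           (catrev (nth [::] l i) (nth [::] l j)))
         k (catrev (nth [::] l i) (nth [::] l k)))).
Proof.
move=> ij ik jk; apply: exec_eq (exec_move2 (st l) ij ik jk) _ _ => // r.
rewrite /st nth_set_nth /= nth_set_nth /= nth_set_nth /=.
case: (r =P i) => [->|_]; first by rewrite (negPf ij) (negPf ik).
by case: (r =P j) => // ->; rewrite (negPf jk).
Qed.

Lemma exec_clearL i l : exec (clear i) (st l) (2 * size (nth [::] l i)).+1
  (st (set_nth [::] l i [::])).
Proof.
apply: exec_eq (exec_clear i (st l)) _ _ => // r.
by rewrite /st nth_set_nth.
Qed.

Lemma exec_pushL i b l :
  exec (Push i b) (st l) 1 (st (set_nth [::] l i (b :: nth [::] l i))).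
Proof.
apply: exec_eq (exec_eval (st l) (isT : loopfree (Push i b))) _ _ => // r.
by rewrite /st nth_set_nth.
Qed.

Lemma exec_popL i l :
  exec (Pop i) (st l) 1 (st (set_nth [::] l i (behead (nth [::] l i)))).
Proof.
apply: exec_eq (exec_eval (st l) (isT : loopfree (Pop i))) _ _ => // r.
by rewrite /st nth_set_nth.
Qed.

Lemma exec_stL c s T l l' : exec c s T (st l) -> st l =1 st l' ->
  exec c s T (st l').
Proof. by move=> h e; apply: exec_eq h _ e. Qed.

Lemma catrev_catrev (T : Type) (s t : seq T) : catrev (catrev s [::]) t = s ++ t.
Proof. by rewrite !catrevE cats0 revK. Qed.

(** [wcpt e e']: a polynomial-time program turns [e x] into [e' x], for all
    [x]; it starts and ends with all the other registers empty. *)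
Definition wcpt (X : Type) (e e' : X -> word) : Prop :=
  exists (c : prog) (T : X -> nat), polyb (fun x => size (e x)) T /\
    forall x, exec c (st [:: e x]) (T x) (st [:: e' x]).

Ltac pb := repeat first [assumption | apply: polyb_id | apply: polyb_cst
  | apply: polyb_add | apply: polyb_mul | apply: polyb_exp | apply: polyb_S].

Ltac st_solve := let r := fresh "r" in
  move=> r; rewrite /st ?catrev_catrev /=; do 6 (try (case: r => [|r] //=));
  rewrite ?nth_nil ?cats0 //.

Section Wcpt.
Variable X : Type.
Implicit Types e f g : X -> word.

Lemma wcpt_size e f : wcpt e f -> polyb (fun x => size (e x)) (fun x => size (f x)).
Proof.
move=> [c [T [hT hc]]].
apply: (polyb_le (U := fun x => size (e x) + T x)); last by pb.
by move=> x; have := exec_size 0 (hc x).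
Qed.

Lemma wcpt_id e : wcpt e e.
Proof.
exists (clear 1), (fun=> 1); split; first by pb.
move=> x; apply: exec_stL; first exact: exec_clearL.
by st_solve.
Qed.

Lemma wcpt_comp e f g : wcpt e f -> wcpt f g -> wcpt e g.
Proof.
move=> hf [c2 [T2 [hT2 h2]]]; have hs := wcpt_size hf.
case: hf => [c1 [T1 [hT1 h1]]].
exists (Seq c1 c2), (fun x => T1 x + T2 x); split.
  by apply: polyb_add => //; apply: polyb_trans hs hT2.
by move=> x; apply: exec_seq (h1 x) (h2 x).
Qed.

Lemma wcpt_eq e e' f f' : e =1 e' -> f =1 f' -> wcpt e f -> wcpt e' f'.
Proof. by move=> /funext <- /funext <-. Qed.

Lemma wcpt_cst e w : wcpt e (fun=> w).
Proof.
elim: w => [|b w [c [T [hT h]]]].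
  exists (clear 0); eexists; split; last first.
    move=> x; apply: exec_stL; first exact: exec_clearL.
    by st_solve.
  by rewrite /=; pb.
exists (Seq c (Push 0 b)), (fun x => T x + 1); split; first by pb.
by move=> x; apply: exec_seq (h x) _; apply: exec_pushL.
Qed.

(** Each [move] reverses, so every word travels twice: the one in register 2 passes through register
    0 onto register 1, and the result through register 2 to register 0. *)
Definition combine : prog :=
  Seq (move 2 0) (Seq (move 0 1) (Seq (Push 1 true) (Seq (move 1 2) (move 2 0)))).

Lemma exec_combine w1 w2 :
  exec combine (st [:: [::]; w2; w1]) (30 * (size w1 + size w2) + 50)
    (st [:: true :: w1 ++ w2]).
Proof.
apply: exec_le.
  apply: exec_seq; first exact: exec_moveL.
  apply: exec_seq; first exact: exec_moveL.
  apply: exec_seq; first exact: exec_pushL.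
  apply: exec_seq; first exact: exec_moveL.
  apply: exec_stL; first exact: exec_moveL.
  by st_solve.
by rewrite /= !(catrevE, size_cat, size_rev) /= ?(size_cat, size_rev) /=; lia.
Qed.

Lemma exec_dup pre w :
  exec (shift (size pre) (Seq (move 0 2) (move2 2 0 1))) (st (pre ++ [:: w]))
    (16 * size w + 2) (st (pre ++ [:: w; w])).
Proof.
apply: exec_shift; apply: exec_le.
  apply: exec_seq; first exact: exec_moveL.
  apply: exec_stL; first exact: exec_move2L.
  by st_solve.
by rewrite /= catrevE cats0 size_rev; lia.
Qed.

Definition dup := Seq (move 0 2) (move2 2 0 1).

Lemma exec_dupL w : exec dup (st [:: w]) (16 * size w + 2) (st [:: w; w]).
Proof. exact: (exec_dup [::]). Qed.

(** [g] is run on a copy of the input in register 1, then [f] above it in register 2, which is the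
    layout that [combine] expects. *)
Lemma wcpt_pair e f g : wcpt e f -> wcpt e g ->
  wcpt e (fun x => true :: f x ++ g x).
Proof.
move=> hf hg; have sf := wcpt_size hf; have sg := wcpt_size hg.
case: hf => [c1 [T1 [hT1 h1]]]; case: hg => [c2 [T2 [hT2 h2]]].
exists (Seq dup (Seq (shift 1 c2) (Seq (Seq (move 0 3) (move 3 2))
         (Seq (shift 2 c1) combine)))).
eexists; split; last first.
  move=> x.
  apply: exec_seq; first exact: exec_dupL.
  apply: exec_seq; first exact: (exec_shift [:: e x] (h2 x)).
  apply: exec_seq.
    apply: exec_seq; first exact: exec_moveL.
    apply: exec_moveL => //.
  rewrite /= catrev_catrev cats0.
  apply: exec_seq; last exact: exec_combine.
  apply: exec_eq (exec_shift [:: [::]; g x] (h1 x)) _ _ => //.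
  by st_solve.
rewrite /=.
have E : (fun x => size (catrev (e x) [::])) = (fun x => size (e x)).
  by apply/funext => x; rewrite catrevE cats0 size_rev.
by pb; rewrite ?E; pb.
Qed.
End Wcpt.

(** * Trees, tests and loops *)

Lemma wcptE (X : Type) (e f : X -> word) : wcpt e f ->
  exists c m, forall x, exec c (st [:: e x]) ((size (e x)).+2 ^ m) (st [:: f x]).
Proof.
by move=> [c [T [[m hm] h]]]; exists c, m => x; apply: exec_le (h x) (hm x).
Qed.

Inductive tree := Leaf | Node of tree & tree.

(** Preorder traversal, which makes the code of a tree self-delimiting. *)
Fixpoint wt (a : tree) : word :=
  if a is Node a1 a2 then true :: wt a1 ++ wt a2 else [:: false].

Lemma wt_gt0 a : 0 < size (wt a).
Proof. by case: a. Qed.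

Definition split_body := Case 0 (Pop 2)
  (Seq (Push 1 true) (Seq (Pop 0) (Push 2 true)))
  (Seq (Push 1 false) (Seq (Pop 0) (Pop 2))).

(* Register 2 counts, in unary, the subtrees still to be read. *)
Lemma exec_split_loop a rest acc ks T s' :
  exec (While 2 split_body) (st [:: rest; catrev (wt a) acc; ks]) T s' ->
  exec (While 2 split_body) (st [:: wt a ++ rest; acc; true :: ks])
    (T + 10 * size (wt a)) s'.
Proof.
have hb s := exec_eval s (isT : loopfree split_body).
elim: a rest acc ks T => [|a1 IH1 a2 IH2] rest acc ks T h.
  apply: exec_le; first apply: (exec_step _ (hb _)) => //.
    by apply: exec_eq h _ _ => //; st_solve.
  by rewrite /=; lia.
apply: exec_le; first apply: (exec_step _ (hb _)) => //.
  have h2 := IH2 rest (catrev (wt a1) (true :: acc)) ks T.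
  have := IH1 (wt a2 ++ rest) (true :: acc) (true :: ks) _ (h2 _).
  move=> h1; apply: exec_eq (h1 _) _ _ => //; last by st_solve; rewrite catA.
  by move: h => /=; rewrite !catrevE rev_cat -catA.
by rewrite /= size_cat; lia.
Qed.

Definition split_prog := Seq (Seq (Pop 0) (Push 2 true)) (While 2 split_body).

Lemma exec_split a w :
  exec split_prog (st [:: true :: wt a ++ w]) (10 * size (wt a) + 3)
    (st [:: w; catrev (wt a) [::]]).
Proof.
apply: exec_le.
  apply: exec_seq; first exact: exec_eval.
  have h : exec (While 2 split_body) (st [:: w; catrev (wt a) [::]; [::]]) 1
      (st [:: w; catrev (wt a) [::]]).
    by apply: exec_stL; [exact: exec_stop | st_solve].
  by apply: exec_eq (exec_split_loop h) _ _ => //; st_solve.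
by rewrite /=; lia.
Qed.

Section Wcpt.
Variable X : Type.
Implicit Types (e f g : X -> word) (a b : X -> tree).

Lemma wcpt_fst a g : wcpt (fun x => true :: wt (a x) ++ g x) (fun x => wt (a x)).
Proof.
exists (Seq split_prog (Seq (clear 0) (move 1 0))); eexists; split; last first.
  move=> x; apply: exec_seq; first exact: exec_split.
  apply: exec_seq; first exact: exec_clearL.
  apply: exec_stL; first exact: exec_moveL.
  by st_solve.
apply: (polyb_le (U := fun x => 20 * (size (true :: wt (a x) ++ g x)) + 20)).
  by move=> x /=; rewrite catrevE cats0 size_rev size_cat; lia.
by pb.
Qed.

Lemma wcpt_snd a g : wcpt (fun x => true :: wt (a x) ++ g x) g.
Proof.
exists (Seq split_prog (clear 1)); eexists; split; last first.
  move=> x; apply: exec_seq; first exact: exec_split.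
  apply: exec_stL; first exact: exec_clearL.
  by st_solve.
apply: (polyb_le (U := fun x => 20 * (size (true :: wt (a x) ++ g x)) + 20)).
  by move=> x /=; rewrite catrevE cats0 size_rev size_cat; lia.
by pb.
Qed.

(** Each branch has to be correct only on its own part of [X], hence the sigma types. The [Node]
    branch also receives the tree, in the format of a pair, so that it can be taken apart there. *)
Lemma wcpt_case e a f :
  wcpt e (fun x => wt (a x)) ->
  @wcpt {x | a x = Leaf} (fun x => e (sval x)) (fun x => f (sval x)) ->
  @wcpt {x | a x <> Leaf} (fun x => true :: e (sval x) ++ wt (a (sval x)))
    (fun x => f (sval x)) ->
  wcpt e f.
Proof.
move=> ha /wcptE[c1 [m1 h1]] /wcptE[c2 [m2 h2]].
have sa := wcpt_size ha; case: ha => [c [T [hT h]]].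
exists (Seq dup (Seq (shift 1 c) (Case 1 c1
   (Seq (Seq (move 0 3) (move 3 2)) (Seq combine c2)) (Seq (clear 1) c1)))).
exists (fun x => 16 * size (e x) + 2 + (T x +
  (14 * size (e x) + 2 + (30 * (size (e x) + size (wt (a x))) + 50
     + (size (true :: e x ++ wt (a x))).+2 ^ m2)
   + (3 + (size (e x)).+2 ^ m1)).+1)); split.
  have s2 : polyb (fun x => size (e x)) (fun x => size (true :: e x ++ wt (a x))).
    apply: (polyb_le (U := fun x => 1 + size (e x) + size (wt (a x)))); last by pb.
    by move=> x; rewrite /= size_cat.
  by pb.
move=> x; apply: exec_seq; first exact: exec_dupL.
apply: exec_seq; first exact: (exec_shift [:: e x] (h x)).
apply: exec_case; case E: (a x) => [|t1 t2].
  rewrite /=; apply: exec_le.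
    apply: exec_seq; first exact: exec_clearL.
    apply: exec_eq (h1 (exist _ x E)) _ _ => //; by st_solve.
  by rewrite /=; lia.
have N : a x <> Leaf by rewrite E.
rewrite /=; apply: exec_le.
  apply: exec_seq.
    by apply: exec_seq; first exact: exec_moveL; apply: exec_moveL.
  rewrite /= catrev_catrev cats0.
  have hcomb : exec combine (st [:: [::]; wt (Node t1 t2); e x; [::]])
      (30 * (size (e x) + size (wt (Node t1 t2))) + 50)
      (st [:: true :: e x ++ wt (Node t1 t2)]).
    by apply: exec_eq (exec_combine (e x) (wt (Node t1 t2))) _ _ => //; st_solve.
  apply: exec_seq; first exact: hcomb.
  by have := h2 (exist _ x N); rewrite /= E; apply.
by rewrite /= !catrevE cats0 !(size_rev, size_cat) /= !size_cat; lia.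
Qed.

End Wcpt.

Definition tbool (b : bool) : tree := if b then Node Leaf Leaf else Leaf.

(** [While] tests for emptiness, but no tree has an empty code. The code of the condition is
    therefore popped to nothing when false, and gets one more bit when true. *)
Definition while_flag (b : bool) : word :=
  if b then [:: true; true; false; false] else [::].

(** A polynomial number of polynomial-time steps can still produce exponentially long data. This is
    why a polynomial bound [B] on all the intermediate states is required besides the bound on their
    number. *)
Lemma wcpt_while (S : Type) (es : S -> word) (f : S -> S) (cond : S -> bool)
    (X : Type) (init : X -> S) (N B : X -> nat) :
  wcpt es (fun s => es (f s)) -> wcpt es (fun s => wt (tbool (cond s))) ->
  polyb (fun x => size (es (init x))) N ->
  (forall x i, i < N x -> cond (iter i f (init x))) ->
  (forall x, ~~ cond (iter (N x) f (init x))) ->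
  polyb (fun x => size (es (init x))) B ->
  (forall x i, i <= N x -> size (es (iter i f (init x))) <= B x) ->
  wcpt (fun x => es (init x)) (fun x => es (iter (N x) f (init x))).
Proof.
move=> /wcptE[cf [mf hf]] /wcptE[cc [mc hc]] hN hcond hstop hB hBi.
pose branch := Case 1 (Push 1 true) (Push 1 true) (Pop 1).
have hbranch s := exec_eval s (isT : loopfree branch).
pose test := Seq dup (Seq (shift 1 cc) branch).
pose body := Seq (clear 1) (Seq cf test).
pose TT k := 16 * k + k.+2 ^ mc + 6.
have htest s : exec test (st [:: es s]) (TT (size (es s)))
    (st [:: es s; while_flag (cond s)]).
  apply: exec_le.
    apply: exec_seq; first exact: exec_dupL.
    apply: exec_seq; first exact: (exec_shift [:: es s] (hc s)).
    apply: exec_eq (hbranch _) _ _ => //; case: (cond s); by st_solve.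
  by rewrite /= /TT; lia.
have TT_le k k' : k <= k' -> TT k <= TT k'.
  by move=> le; rewrite /TT !leq_add // ?leq_mul //; apply: leq_expr; lia.
pose C k := 10 + (k.+2 ^ mf + TT k).
have loop n s k : (forall i, i < n -> cond (iter i f s)) ->
    ~~ cond (iter n f s) -> (forall i, i <= n -> size (es (iter i f s)) <= k) ->
    exec (While 1 body) (st [:: es s; while_flag (cond s)]) (n * C k + 1)
      (st [:: es (iter n f s)]).
  elim: n s => [|n IH] s h1 h2 h3.
    rewrite /= in h2; rewrite (negPf h2).
    by apply: exec_stL; first exact: exec_stop; st_solve.
  have hs : cond s := h1 0 isT.
  have IHs : exec (While 1 body) (st [:: es (f s); while_flag (cond (f s))])
      (n * C k + 1) (st [:: es (iter n.+1 f s)]).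
    rewrite iterSr; apply: IH => [i hi||i hi]; rewrite -?iterSr //.
    - exact: h1.
    - exact: h3.
  apply: exec_le.
    apply: (@exec_step _ _ _ _ _ _ _ _ _ IHs); first by rewrite hs.
    apply: exec_seq; first exact: exec_clearL.
    apply: exec_seq; last exact: htest.
    by apply: exec_eq (hf s) _ _ => //; st_solve.
  have hB0 := h3 0 isT; have hB1 := h3 1 isT; rewrite /= in hB0 hB1.
  have e1 := leq_expr mf (_ : (size (es s)).+2 <= k.+2).
  have e2 := TT_le _ _ hB1.
  by rewrite /= hs /=; have := e1 hB0; rewrite mulSn /C; lia.
exists (Seq test (While 1 body)).
exists (fun x => TT (size (es (init x))) +
  (N x * C (B x) + 1)); split.
  by rewrite /C /TT; pb.
move=> x; apply: exec_seq; first exact: htest.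
by apply: loop => // i hi; [apply: hcond | apply: hBi].
Qed.

(** A decision tree on the first [m] bits with all outputs hardwired: [F] may be any function,
    computable or not. The gap realizations enter the reduction in this way. *)
Fixpoint table (m : nat) (F : word -> word) (w0 : word) : prog :=
  let out w := Seq (clear 0) (foldr (fun b c => Seq c (Push 0 b)) (clear 0) w) in
  match m with
  | 0 => Case 0 (out (F [::])) (out w0) (out w0)
  | m'.+1 => Case 0 (out (F [::]))
      (Seq (Pop 0) (table m' (fun w => F (true :: w)) w0))
      (Seq (Pop 0) (table m' (fun w => F (false :: w)) w0))
  end.

Lemma exec_out w (l0 : word) :
  exec (Seq (clear 0) (foldr (fun b c => Seq c (Push 0 b)) (clear 0) w))
    (st [:: l0]) (2 * size l0 + size w + 2) (st [:: w]).
Proof.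
apply: exec_le.
  apply: exec_seq; first exact: exec_clearL.
  have : exec (foldr (fun b c => Seq c (Push 0 b)) (clear 0) w) (st [:: [::]])
      (size w + 1) (st [:: w]).
    elim: w => [|b w IH] /=.
      by apply: exec_stL; first exact: exec_clearL; st_solve.
    apply: exec_le; first by apply: exec_seq; first exact: IH; apply: exec_pushL.
    by lia.
  by apply.
by rewrite /=; lia.
Qed.

Lemma wcpt_table (X : Type) (e : X -> word) (m : nat) (F : word -> word) (w0 : word) :
  wcpt e (fun x => if size (e x) <= m then F (e x) else w0).
Proof.
have [K hK] : exists K, forall w, exec (table m F w0) (st [:: w]) (2 * size w + K)
    (st [:: if size w <= m then F w else w0]).
  elim: m F => [|m IH] F.
    exists (size (F [::]) + size w0 + 3) => -[|b w] /=.
      by apply: exec_le; first (apply: exec_case; exact: exec_out); rewrite /=; lia.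
    by case: b; (apply: exec_le; first (apply: exec_case; exact: exec_out)); rewrite /=; lia.
  have [K1 h1] := IH (fun w => F (true :: w)).
  have [K2 h2] := IH (fun w => F (false :: w)).
  exists (size (F [::]) + K1 + K2 + 3) => -[|b w] /=.
    by apply: exec_le; first (apply: exec_case; exact: exec_out); rewrite /=; lia.
  rewrite ltnS; case: b; apply: exec_le.
  - by apply: exec_case; apply: exec_seq; first exact: exec_popL; exact: h1.
  - by rewrite /=; lia.
  - by apply: exec_case; apply: exec_seq; first exact: exec_popL; exact: h2.
  - by rewrite /=; lia.
exists (table m F w0), (fun x => 2 * size (e x) + K); split; first by pb.
by move=> x; apply: hK.
Qed.

(** * Polynomial-time functions on data *)

Lemma wcpt_reindex (X Y : Type) (h : Y -> X) (e f : X -> word) :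
  wcpt e f -> wcpt (fun y => e (h y)) (fun y => f (h y)).
Proof.
move=> [c [T [hT hc]]]; exists c, (T \o h); split; last by move=> y; apply: hc.
exact: (polyb_reindex h hT).
Qed.

Class Data (A : Type) := tr : A -> tree.

#[global] Instance data_bool : Data bool := tbool.
#[global] Instance data_prod (A B : Type) `{Data A} `{Data B} : Data (A * B) :=
  fun p => Node (tr p.1) (tr p.2).
#[global] Instance data_seq (A : Type) `{Data A} : Data (seq A) :=
  fix t s := if s is x :: s' then Node (tr x) (t s') else Leaf.
(** Unary, so that polynomial in the size of a number means polynomial in its value. *)
#[global] Instance data_nat : Data nat :=
  fix t n := if n is n'.+1 then Node Leaf (t n') else Leaf.
#[global] Instance data_ord (n : nat) : Data 'I_n := fun i => tr (val i).

Definition sz (A : Type) `{Data A} (a : A) : nat := size (wt (tr a)).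

Lemma sz_gt0 (A : Type) `{Data A} (a : A) : 0 < sz a.
Proof. exact: wt_gt0. Qed.

Section Sizes.
Context (A B : Type) `{Data A} `{Data B}.

Lemma sz_pair (a : A) (b : B) : sz (a, b) = (sz a + sz b).+1.
Proof. by rewrite /sz /= size_cat. Qed.

Lemma sz_nil : sz ([::] : seq A) = 1. Proof. by []. Qed.

Lemma sz_cons (a : A) s : sz (a :: s) = (sz a + sz s).+1.
Proof. by rewrite /sz /= size_cat. Qed.

Lemma sz_cat (s1 s2 : seq A) : sz (s1 ++ s2) + 1 = sz s1 + sz s2.
Proof. by elim: s1 => [|a s1 IH]; rewrite /= ?sz_cons; rewrite ?sz_nil; lia. Qed.

Lemma size_lt_sz (s : seq A) : size s < sz s.
Proof. by elim: s => [|a s IH]; rewrite ?sz_nil //= sz_cons; lia. Qed.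

Lemma sz_drop n (s : seq A) : sz (drop n s) <= sz s.
Proof.
have := sz_cat (take n s) (drop n s); rewrite cat_take_drop.
by pose proof (sz_gt0 (take n s)); lia.
Qed.

Lemma sz_take n (s : seq A) : sz (take n s) <= sz s.
Proof.
have := sz_cat (take n s) (drop n s); rewrite cat_take_drop.
by pose proof (sz_gt0 (drop n s)); lia.
Qed.

Lemma sz_le n (s : seq A) : (forall i, i < size s -> forall a0, sz (nth a0 s i) <= n) ->
  sz s <= (size s * n.+1).+1.
Proof.
elim: s => [|a s IH] h //=; rewrite sz_cons mulSn.
have := h 0 isT a; rewrite /= => h0.
by have := IH (fun i hi => h i.+1 hi); lia.
Qed.

End Sizes.

Lemma sz_nat (n : nat) : sz n = (2 * n).+1.
Proof. by elim: n => // n IH; have -> : sz n.+1 = (sz n).+2 by []; lia. Qed.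

Lemma sz_bool (b : bool) : sz b <= 3.
Proof. by case: b. Qed.

Definition PT (A B : Type) `{Data A} `{Data B} (f : A -> B) : Prop :=
  wcpt (fun a => wt (tr a)) (fun a => wt (tr (f a))).

Lemma PT_size (A B : Type) `{Data A} `{Data B} (f : A -> B) : PT f ->
  polyb (fun a => sz a) (fun a => sz (f a)).
Proof. exact: wcpt_size. Qed.

Section PTBasic.
Context (C A B : Type) `{Data C} `{Data A} `{Data B}.

Lemma PT_id : PT (fun a : A => a). Proof. exact: wcpt_id. Qed.

Lemma PT_cst (b : B) : PT (fun _ : A => b). Proof. exact: wcpt_cst. Qed.

Lemma PT_comp (g : A -> B) (f : C -> A) : PT g -> PT f -> PT (fun c => g (f c)).
Proof. by move=> hg hf; apply: wcpt_comp hf _; apply: (wcpt_reindex f) hg. Qed.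

Lemma PT_pair (f : C -> A) (g : C -> B) : PT f -> PT g -> PT (fun c => (f c, g c)).
Proof. exact: wcpt_pair. Qed.

Lemma PT_fst : PT (fun p : A * B => p.1).
Proof. exact: (wcpt_fst (fun p : A * B => tr p.1) (fun p => wt (tr p.2))). Qed.

Lemma PT_snd : PT (fun p : A * B => p.2).
Proof. exact: (wcpt_snd (fun p : A * B => tr p.1) (fun p => wt (tr p.2))). Qed.

Lemma PT_cons (f : C -> A) (g : C -> seq A) :
  PT f -> PT g -> PT (fun c => f c :: g c).
Proof. exact: wcpt_pair. Qed.

Lemma PT_S (f : C -> nat) : PT f -> PT (fun c => (f c).+1).
Proof. by move=> hf; apply: (wcpt_pair (wcpt_cst _ (wt Leaf)) hf). Qed.

(** Only finitely many words have length at most [m], so nothing is asked of [f]; injectivity of the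
    code lets [f] be transported to words. *)
Lemma PT_table (f : A -> B) (m : nat) (b0 : B) : injective (fun a : A => wt (tr a)) ->
  PT (fun a => if sz a <= m then f a else b0).
Proof.
move=> inj.
have [F hF] : exists F : word -> word, forall a, F (wt (tr a)) = wt (tr (f a)).
  have ex : forall w : word, exists w' : word, forall a, wt (tr a) = w -> w' = wt (tr (f a)).
    move=> w; case: (pselect (exists a : A, wt (tr a) = w)) => [[a ha]|hn].
      by exists (wt (tr (f a))) => a' ha'; rewrite (inj a a') // ha.
    by exists [::] => a ha; case: hn; exists a.
  have [F hF] := choice ex.
  by exists F => a; apply: hF.
apply: wcpt_eq (wcpt_table (fun a : A => wt (tr a)) m F (wt (tr b0))) => // a.
by rewrite /sz; case: ifP.
Qed.

Lemma PT_if (c : C -> bool) (f g : C -> B) : PT c -> PT f -> PT g ->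
  PT (fun x => if c x then f x else g x).
Proof.
move=> hc hf hg; apply: (wcpt_case (a := fun x => tr (c x))) => //.
  apply: wcpt_eq (wcpt_reindex sval hg) => // -[x /=].
  by case: (c x).
have h : wcpt (fun x => true :: wt (tr x) ++ wt (tr (c x))) (fun x => wt (tr (f x))).
  exact: wcpt_comp (wcpt_fst _ _) hf.
apply: wcpt_eq (wcpt_reindex sval h) => // -[x /=].
by case: (c x).
Qed.

(** The code of a nonempty list is literally that of the pair of its head and tail, so the cons
    branch reads the argument of [wcpt_case] as a triple. *)
Lemma PT_match (l : C -> seq A) (fn : C -> B) (fc : C -> A -> seq A -> B) :
  PT l -> PT fn -> PT (fun p : C * (A * seq A) => fc p.1 p.2.1 p.2.2) ->
  PT (fun x => if l x is a :: s then fc x a s else fn x).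
Proof.
move=> hl hn hc; apply: (wcpt_case (a := fun x => tr (l x))) => //.
  apply: wcpt_eq (wcpt_reindex sval hn) => // -[x /=].
  by case: (l x).
have ex : forall x : {x | tr (l x) <> Leaf}, exists q : C * (A * seq A),
    q.1 = sval x /\ l (sval x) = q.2.1 :: q.2.2.
  move=> -[x /=]; case E : (l x) => [|a s] // _.
  by exists (x, (a, s)).
have [h hh] := choice ex.
apply: wcpt_eq (wcpt_reindex h hc) => x /=; have [-> ->] := hh x; done.
Qed.

End PTBasic.

Arguments PT_id {A H0}.
Arguments PT_fst {A B H0 H1}.
Arguments PT_snd {A B H0 H1}.
Arguments PT_comp {C A B H H0 H1 g f}.
Arguments PT_pair {C A B H H0 H1 f g}.

(** * Folds whose accumulator stays polynomially bounded *)

Section FoldlBounded.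
Context (C A B : Type) `{Data C} `{Data A} `{Data B}.
Variables (f : C -> B -> A -> B) (l : C -> seq A) (z : C -> B).
Variable U : C -> nat.
Hypothesis hf : PT (fun p : C * (B * A) => f p.1 p.2.1 p.2.2).
Hypotheses (hl : PT l) (hz : PT z).

Lemma PT_foldl_bounded : polyb (fun c => sz c) U ->
  (forall c i, sz (foldl (f c) (z c) (take i (l c))) <= U c) ->
  PT (fun c => foldl (f c) (z c) (l c)).
Proof.
move=> hU hB.
pose step (s : C * (seq A * B)) :=
  if s.2.1 is a :: l' then (s.1, (l', f s.1 s.2.2 a)) else s.
pose cond (s : (C * (seq A * B))) := if s.2.1 is _ :: _ then true else false.
pose init c := (c, (l c, z c)).
have fst_ : PT (fun s : (C * (seq A * B)) => s.1) by exact: PT_fst.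
have fst2 : PT (fun s : (C * (seq A * B)) => s.2.1) by exact: PT_comp PT_fst PT_snd.
have snd2 : PT (fun s : (C * (seq A * B)) => s.2.2) by exact: PT_comp PT_snd PT_snd.
have hstep : PT step.
  apply: (PT_match (fc := fun s a l' => (s.1, (l', f s.1 s.2.2 a)))) => //.
    exact: PT_id.
  have e1 : PT (fun p : (C * (seq A * B)) * (A * seq A) => p.1.1) by exact: PT_comp fst_ PT_fst.
  apply: PT_pair => //; apply: PT_pair; first exact: PT_comp PT_snd PT_snd.
  apply: (PT_comp (g := fun p : C * (B * A) => f p.1 p.2.1 p.2.2)
    (f := fun p : (C * (seq A * B)) * (A * seq A) => (p.1.1, (p.1.2.2, p.2.1)))) => //.
  apply: PT_pair => //; apply: PT_pair; first exact: PT_comp snd2 PT_fst.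
  exact: PT_comp PT_fst PT_snd.
have hcond : PT cond.
  by apply: (PT_match (fc := fun _ _ _ => true)) => //; apply: PT_cst.
have hinit : PT init.
  by apply: PT_pair; [exact: PT_id | exact: PT_pair].
have hi c i : iter i step (init c) =
    (c, (drop i (l c), foldl (f c) (z c) (take i (l c)))).
  elim: i => [|i IH]; first by rewrite drop0 take0.
  rewrite iterS IH /step /=; case: (ltnP i (size (l c))) => h.
    case E : (l c) => [|a0 s]; [by rewrite E in h | rewrite -E].
    by rewrite (drop_nth a0) // (take_nth a0) // foldl_rcons.
  by rewrite !drop_oversize ?take_oversize //; apply: leqW.
have w : wcpt (fun c => wt (tr (init c)))
    (fun c => wt (tr (iter (size (l c)) step (init c)))).
  apply: (@wcpt_while _ (fun s => wt (tr s)) step cond C init _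
    (fun c => sz c + sz (l c) + U c + 2)) => //.
  - apply: (polyb_le (U := fun c => sz (init c))); last exact: polyb_id.
    by move=> c; rewrite /init !sz_pair; pose proof (size_lt_sz (l c)); lia.
  - move=> c i hlt; rewrite hi /cond /=.
    by case E : (l c) hlt => [|a s] // hlt; rewrite -E (drop_nth a) // E.
  - by move=> c; rewrite hi /cond /= drop_size.
  - apply: (@polyb_trans _ _ (fun c => sz c)).
      apply: (polyb_le (U := fun c => sz (init c))); last exact: polyb_id.
      by move=> c; rewrite /init sz_pair; lia.
    by pose proof (PT_size hl); pb.
  - move=> c i _; rewrite hi; have := hB c i; pose proof (sz_drop i (l c)).
    by rewrite -/(sz _) !sz_pair; lia.
have hs : PT (fun c => iter (size (l c)) step (init c)) by exact: wcpt_comp hinit w.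
apply: wcpt_eq (PT_comp snd2 hs) => // c.
by rewrite hi take_size.
Qed.

End FoldlBounded.

Section Foldl.
Context (C A B : Type) `{Data C} `{Data A} `{Data B}.
Variables (f : C -> B -> A -> B) (l : C -> seq A) (z : C -> B).
Variable G : C -> A -> nat.
Hypothesis hf : PT (fun p : C * (B * A) => f p.1 p.2.1 p.2.2).
Hypotheses (hl : PT l) (hz : PT z).

(** Growth that does not depend on the accumulator adds up along the list instead of compounding, so
    no bound on the intermediate values has to be supplied. *)
Lemma PT_foldl : polyb (fun p : C * A => sz p) (fun p => G p.1 p.2) ->
  (forall c b a, sz (f c b a) <= sz b + G c a) ->
  PT (fun c => foldl (f c) (z c) (l c)).
Proof.
move=> [m hm] hG.
apply: (PT_foldl_bounded (U := fun c => sz (z c) + sz (l c) * (sz c + sz (l c) + 3) ^ m)) => //.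
  by pose proof (PT_size hz); pose proof (PT_size hl); pb.
move=> c i.
have key : sz (foldl (f c) (z c) (take i (l c))) <=
    sz (z c) + size (take i (l c)) * (sz c + sz (take i (l c)) + 3) ^ m.
  elim/last_ind: (take i (l c)) => [|s a IH]; first by rewrite mul0n addn0.
  rewrite foldl_rcons size_rcons mulSn.
  apply: leq_trans (hG _ _ _) _.
  have hs : sz (rcons s a) + 1 = sz s + sz [:: a] by rewrite -cats1 sz_cat.
  rewrite sz_cons sz_nil in hs.
  have h1 : G c a <= (sz c + sz (rcons s a) + 3) ^ m.
    apply: leq_trans (hm (c, a)) _; apply: leq_expr; rewrite sz_pair.
    by pose proof (sz_gt0 s); lia.
  have h2 : (sz c + sz s + 3) ^ m <= (sz c + sz (rcons s a) + 3) ^ m.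
    by apply: leq_expr; lia.
  have h3 := leq_mul (leqnn (size s)) h2; lia.
apply: leq_trans key _; rewrite leq_add2l.
pose proof (sz_take i (l c)) as ht; apply: leq_mul; last by apply: leq_expr; lia.
by pose proof (size_lt_sz (take i (l c))); lia.
Qed.

End Foldl.

#[global] Instance data_unit : Data unit := fun=> Leaf.

(** Numbers and lists of [tt] have the same codes. Counting loops thus become folds, at no cost of
    conversion. *)
Lemma tr_nseq n : tr (nseq n tt) = tr n.
Proof. by elim: n => //= n IH; rewrite /tr /= -/(tr _); congr Node. Qed.

Lemma foldl_cons (A : Type) (s t : seq A) : foldl (fun u a => a :: u) t s = catrev s t.
Proof. by elim: s t => //= a s IH t; rewrite IH. Qed.

Lemma foldl_nseq (A : Type) (f : A -> A) x n :
  foldl (fun y (_ : unit) => f y) x (nseq n tt) = iter n f x.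
Proof. by elim: n x => // n IH x; rewrite iterSr -IH. Qed.

(** * Polynomial-time operations on lists *)

Section ListRev.
Context (C A B : Type) `{Data C} `{Data A} `{Data B}.

Lemma PT_nseq (n : C -> nat) : PT n -> PT (fun c => nseq (n c) tt).
Proof. by apply: wcpt_eq => // c; rewrite tr_nseq. Qed.

Lemma PT_catrev (s t : C -> seq A) : PT s -> PT t -> PT (fun c => catrev (s c) (t c)).
Proof.
move=> hs ht.
have h : PT (fun c => foldl (fun u a => a :: u) (t c) (s c)).
  apply: (PT_foldl (f := fun _ u a => a :: u) (G := fun _ a => (sz a).+1)) => //.
  - by apply: PT_cons; [apply: PT_comp PT_snd PT_snd | apply: PT_comp PT_fst PT_snd].
  - apply: (polyb_le (U := fun p : C * A => sz p)); last exact: polyb_id.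
    by case=> c a; rewrite sz_pair /=; pose proof (sz_gt0 c); lia.
  - by move=> c b a; rewrite sz_cons; lia.
by apply: wcpt_eq h => // c; rewrite foldl_cons.
Qed.

Lemma PT_rev (s : C -> seq A) : PT s -> PT (fun c => rev (s c)).
Proof. by move=> hs; apply: PT_catrev => //; apply: PT_cst. Qed.

Lemma PT_cat (s t : C -> seq A) : PT s -> PT t -> PT (fun c => s c ++ t c).
Proof.
move=> hs ht; apply: wcpt_eq (PT_catrev (PT_rev hs) ht) => // c.
by rewrite catrevE revK.
Qed.

End ListRev.

Section ListMap.
Context (C A B : Type) `{Data C} `{Data A} `{Data B}.

Lemma PT_map (f : C -> A -> B) (s : C -> seq A) :
  PT (fun p : C * A => f p.1 p.2) -> PT s -> PT (fun c => [seq f c a | a <- s c]).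
Proof.
move=> hf hs.
have h : PT (fun c => foldl (fun u a => f c a :: u) [::] (s c)).
  apply: (PT_foldl (f := fun c u a => f c a :: u) (G := fun c a => (sz (f c a)).+1)) => //.
  - apply: PT_cons; last exact: PT_comp PT_fst PT_snd.
    apply: (PT_comp (f := fun p : C * (seq B * A) => (p.1, p.2.2))) hf _.
    by apply: PT_pair; [exact: PT_fst | exact: PT_comp PT_snd PT_snd].
  - exact: PT_cst.
  - by pose proof (PT_size hf); pb.
  - by move=> c b a; rewrite sz_cons; lia.
apply: wcpt_eq (PT_rev h) => // c; congr (wt (tr _)).
rewrite -[RHS]revK; congr rev.
elim/last_ind: (s c) => // u a IH.
by rewrite foldl_rcons map_rcons rev_rcons IH.
Qed.

Lemma PT_filter (f : C -> A -> bool) (s : C -> seq A) :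
  PT (fun p : C * A => f p.1 p.2) -> PT s -> PT (fun c => [seq a <- s c | f c a]).
Proof.
move=> hf hs.
have h : PT (fun c => foldl (fun u a => if f c a then a :: u else u) [::] (s c)).
  apply: (PT_foldl (f := fun c u a => if f c a then a :: u else u)
    (G := fun c a => (sz a).+1)) => //.
  - apply: PT_if; last exact: PT_comp PT_fst PT_snd.
      apply: (PT_comp (f := fun p : C * (seq A * A) => (p.1, p.2.2))) hf _.
      by apply: PT_pair; [exact: PT_fst | exact: PT_comp PT_snd PT_snd].
    by apply: PT_cons; [exact: PT_comp PT_snd PT_snd | exact: PT_comp PT_fst PT_snd].
  - exact: PT_cst.
  - apply: (polyb_le (U := fun p : C * A => sz p)); last exact: polyb_id.
    by case=> c a; rewrite sz_pair /=; pose proof (sz_gt0 c); lia.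
  - by move=> c b a; case: ifP => _; rewrite ?sz_cons; lia.
apply: wcpt_eq (PT_rev h) => // c; congr (wt (tr _)).
rewrite -[RHS]revK; congr rev.
elim/last_ind: (s c) => // u a IH.
by rewrite foldl_rcons filter_rcons IH; case: ifP => _; rewrite ?rev_rcons.
Qed.

Lemma PT_all (f : C -> A -> bool) (s : C -> seq A) :
  PT (fun p : C * A => f p.1 p.2) -> PT s -> PT (fun c => all (f c) (s c)).
Proof.
move=> hf hs.
have h : PT (fun c => foldl (fun b a => if f c a then b else false) true (s c)).
  apply: (PT_foldl (f := fun c b a => if f c a then b else false)
    (G := fun _ _ => 3)) => //.
  - apply: PT_if; [|exact: PT_comp PT_fst PT_snd|exact: PT_cst].
    apply: (PT_comp (f := fun p : C * (bool * A) => (p.1, p.2.2))) hf _.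
    by apply: PT_pair; [exact: PT_fst | exact: PT_comp PT_snd PT_snd].
  - exact: PT_cst.
  - exact: polyb_cst.
  - move=> c b a; pose proof (sz_bool (if f c a then b else false)); lia.
apply: wcpt_eq h => // c; congr (wt (tr _)).
elim/last_ind: (s c) => // u a IH.
by rewrite foldl_rcons all_rcons IH; case: ifP.
Qed.

Lemma PT_zip (s : C -> seq A) (t : C -> seq B) :
  PT s -> PT t -> PT (fun c => zip (s c) (t c)).
Proof.
move=> hs ht.
pose f (_ : C) (q : seq B * seq (A * B)) (a : A) :=
  if q.1 is b :: r then (r, (a, b) :: q.2) else q.
have h : PT (fun c => foldl (f c) (t c, [::]) (s c)).
  apply: (PT_foldl (G := fun c a => (sz a) + 2)) => //.
  - apply: (PT_match (fc := fun (p : C * ((seq B * seq (A * B)) * A)) b r =>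
       (r, (p.2.2, b) :: p.2.1.2))).
    + exact: PT_comp PT_fst (PT_comp PT_fst PT_snd).
    + exact: PT_comp PT_fst PT_snd.
    + apply: PT_pair; first exact: PT_comp PT_snd PT_snd.
      apply: PT_cons; last by apply: PT_comp (PT_comp PT_snd (PT_comp PT_fst PT_snd)) PT_fst.
      apply: PT_pair; last exact: PT_comp PT_fst PT_snd.
      exact: PT_comp (PT_comp PT_snd PT_snd) PT_fst.
  - by apply: PT_pair => //; apply: PT_cst.
  - apply: (polyb_le (U := fun p : C * A => sz p + 2)); last by pb.
    by case=> c a; rewrite sz_pair /=; lia.
  - by move=> c [[|b r] u] a; rewrite /f /= ?sz_pair ?sz_cons ?sz_pair; lia.
apply: wcpt_eq (PT_rev (PT_comp PT_snd h)) => // c; congr (wt (tr _)).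
have E u r v : (foldl (f c) (r, v) u).2 = catrev (zip u r) v.
  elim: u r v => [|a u IH] [|b r] v //=; rewrite IH //.
  by case: u {IH}.
by rewrite E catrevE cats0 revK.
Qed.

Lemma PT_size_seq (s : C -> seq A) : PT s -> PT (fun c => size (s c)).
Proof.
move=> hs; have h : PT (fun c => foldl (fun n _ => n.+1) 0 (s c)).
  apply: (PT_foldl (f := fun c n _ => n.+1) (G := fun _ _ => 2)) => //.
  - by apply: PT_S; exact: PT_comp PT_fst PT_snd.
  - exact: PT_cst.
  - exact: polyb_cst.
  - by move=> c n a; rewrite !sz_nat; lia.
apply: wcpt_eq h => // c; congr (wt (tr _)).
by elim/last_ind: (s c) => // u a IH; rewrite foldl_rcons size_rcons IH.
Qed.

Lemma PT_iter_bounded (n : C -> nat) (f : C -> A -> A) (x : C -> A) (U : C -> nat) :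
  PT n -> PT (fun p : C * A => f p.1 p.2) -> PT x ->
  polyb (fun c => sz c) U -> (forall c i, i <= n c -> sz (iter i (f c) (x c)) <= U c) ->
  PT (fun c => iter (n c) (f c) (x c)).
Proof.
move=> hn hf hx hU hB.
have h : PT (fun c => foldl (fun y (_ : unit) => f c y) (x c) (nseq (n c) tt)).
  apply: (PT_foldl_bounded (f := fun c y (_ : unit) => f c y) (U := U)) => //.
  - apply: (PT_comp (f := fun p : C * (A * unit) => (p.1, p.2.1))) hf _.
    by apply: PT_pair; [exact: PT_fst | exact: PT_comp PT_fst PT_snd].
  - exact: PT_nseq.
  - move=> c i; case: (leqP i (n c)) => hi.
      by rewrite take_nseq // foldl_nseq; apply: hB.
    by rewrite take_oversize ?size_nseq ?(ltnW hi) // foldl_nseq; apply: hB.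
by apply: wcpt_eq h => // c; rewrite foldl_nseq.
Qed.

Lemma PT_iter (n : C -> nat) (f : C -> A -> A) (x : C -> A) (G : C -> nat) :
  PT n -> PT (fun p : C * A => f p.1 p.2) -> PT x ->
  polyb (fun c => sz c) G -> (forall c a, sz (f c a) <= sz a + G c) ->
  PT (fun c => iter (n c) (f c) (x c)).
Proof.
move=> hn hf hx hG hB.
apply: (PT_iter_bounded (U := fun c => sz (x c) + sz (n c) * G c)) => //.
  by pose proof (PT_size hx); pose proof (PT_size hn); pb.
move=> c i hi; apply: (@leq_trans (sz (x c) + i * G c)).
  elim: i {hi} => [|i IH]; first by rewrite addn0.
  by rewrite iterS mulSn; have := hB c (iter i (f c) (x c)); lia.
by rewrite leq_add2l leq_mul2r sz_nat; apply/orP; right; lia.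
Qed.

End ListMap.

Section ListProj.
Context (C A B : Type) `{Data C} `{Data A} `{Data B}.

Lemma PT_behead (s : C -> seq A) : PT s -> PT (fun c => behead (s c)).
Proof.
move=> hs.
by apply: (PT_match (fc := fun _ _ t => t) hs (PT_cst _)); exact: PT_comp PT_snd PT_snd.
Qed.

Lemma PT_head x0 (s : C -> seq A) : PT s -> PT (fun c => head x0 (s c)).
Proof.
move=> hs.
by apply: (PT_match (fc := fun _ a _ => a) hs (PT_cst _)); exact: PT_comp PT_fst PT_snd.
Qed.

Lemma PT_map_fst (s : C -> seq (A * B)) : PT s -> PT (fun c => unzip1 (s c)).
Proof.
by move=> hs; apply: (PT_map (f := fun _ p => p.1)) => //; exact: PT_comp PT_fst PT_snd.
Qed.

Lemma PT_map_snd (s : C -> seq (A * B)) : PT s -> PT (fun c => unzip2 (s c)).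
Proof.
by move=> hs; apply: (PT_map (f := fun _ p => p.2)) => //; exact: PT_comp PT_snd PT_snd.
Qed.

End ListProj.

(** * Arithmetic and order on unary numbers *)

Section Arith.
Context (C A : Type) `{Data C} `{Data A}.

Lemma PT_addn (m n : C -> nat) : PT m -> PT n -> PT (fun c => m c + n c).
Proof.
move=> hm hn; have h : PT (fun c => iter (m c) succn (n c)).
  apply: (PT_iter (f := fun _ => succn) (G := fun=> 2)) => //.
  - by apply: PT_S; exact: PT_snd.
  - exact: polyb_cst.
  - by move=> c a; rewrite !sz_nat; lia.
by apply: wcpt_eq h => // c; rewrite iter_succn addnC.
Qed.

Lemma PT_muln (m n : C -> nat) : PT m -> PT n -> PT (fun c => m c * n c).
Proof.
move=> hm hn; have h : PT (fun c => iter (m c) (addn (n c)) 0).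
  apply: (PT_iter (f := fun c => addn (n c)) (G := fun c => sz (n c))) => //.
  - have h : PT (fun p : C * nat => n p.1) by exact: PT_comp hn PT_fst.
    have h' : PT (fun p : C * nat => p.2) by exact: PT_snd.
    have hS : PT (fun q : (C * nat) * nat => q.2.+1) by apply: PT_S; exact: PT_snd.
    have h2 : PT (fun p : C * nat => iter (n p.1) succn p.2).
      apply: (PT_iter (f := fun _ => succn) (G := fun=> 2)) => //.
      + exact: polyb_cst.
      + by move=> c a; rewrite !sz_nat; lia.
    by apply: wcpt_eq h2 => // c; rewrite iter_succn addnC.
  - exact: PT_cst.
  - by pose proof (PT_size hn); pb.
  - by move=> c a; rewrite !sz_nat; lia.
by apply: wcpt_eq h => // c; rewrite iter_addn_0 mulnC.
Qed.

Lemma PT_if0 (n : C -> nat) (f g : C -> A) : PT n -> PT f -> PT g ->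
  PT (fun c => if n c == 0 then f c else g c).
Proof.
move=> hn hf hg; have h : PT (fun c => if nseq (n c) tt is a :: s then g c else f c).
  apply: (PT_match (fc := fun c _ _ => g c)) => //; first exact: PT_nseq.
  exact: PT_comp hg PT_fst.
by apply: wcpt_eq h => // c; case: (n c).
Qed.
End Arith.

Section Order.
Context (C : Type) `{Data C}.

Lemma PT_subn (m n : C -> nat) : PT m -> PT n -> PT (fun c => m c - n c).
Proof.
move=> hm hn; have h : PT (fun c => iter (n c) predn (m c)).
  apply: (PT_iter (f := fun _ => predn) (G := fun=> 0)) => //.
  - have h : PT (fun p : C * nat => size (behead (nseq p.2 tt))).
      by apply: PT_size_seq; apply: PT_behead; apply: PT_nseq; exact: PT_snd.
    by apply: wcpt_eq h => // c; rewrite size_behead size_nseq.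
  - exact: polyb_cst.
  - by move=> c a; rewrite !sz_nat; lia.
by apply: wcpt_eq h => // c; rewrite iter_predn.
Qed.

Lemma PT_leq (m n : C -> nat) : PT m -> PT n -> PT (fun c => m c <= n c).
Proof.
move=> hm hn; pose proof (PT_if0 (PT_subn hm hn) (PT_cst true) (PT_cst false)) as h.
by apply: wcpt_eq h => // c; rewrite /leq; case: eqP.
Qed.

Lemma PT_andb (a b : C -> bool) : PT a -> PT b -> PT (fun c => a c && b c).
Proof. by move=> ha hb; apply: PT_if => //; apply: PT_cst. Qed.

Lemma PT_eqn (m n : C -> nat) : PT m -> PT n -> PT (fun c => m c == n c).
Proof.
move=> hm hn; pose proof (PT_andb (PT_leq hm hn) (PT_leq hn hm)) as h.
by apply: wcpt_eq h => // c; rewrite eqn_leq.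
Qed.

Lemma PT_iota (n : C -> nat) : PT n -> PT (fun c => iota 0 (n c)).
Proof.
move=> hn.
pose f (s : nat * seq nat) := (s.1.+1, s.1 :: s.2).
have hi i : iter i f (0, [::]) = (i, rev (iota 0 i)).
  elim: i => // i IH; rewrite iterS IH.
  have -> : iota 0 i.+1 = rcons (iota 0 i) i by rewrite -[i.+1]addn1 iotaD cats1.
  by rewrite rev_rcons.
have h : PT (fun c => iter (n c) f (0, [::])).
  (* A step adds a copy of the counter, which is part of the state, so the growth is not bounded in
     terms of [c] alone as [PT_iter] asks. The explicit form of the iterates gives a bound. *)
  apply: (PT_iter_bounded (f := fun _ => f)
    (U := fun c => 2 * n c + 3 + n c * (2 * n c + 2))) => //.
  - apply: PT_pair; first by apply: PT_S; exact: PT_comp PT_fst PT_snd.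
    by apply: PT_cons; [exact: PT_comp PT_fst PT_snd | exact: PT_comp PT_snd PT_snd].
  - exact: PT_cst.
  - have hp : polyb (fun c => sz c) (fun c => n c).
      apply: (polyb_le (U := fun c => sz (n c))); last exact: PT_size.
      by move=> c; rewrite sz_nat; lia.
    by pb.
  - move=> c i le_i; rewrite hi sz_pair.
    have : sz (rev (iota 0 i)) <= (size (rev (iota 0 i)) * (2 * i + 1).+1).+1.
      apply: sz_le => j hj a0.
      rewrite (set_nth_default 0) // sz_nat.
      by have := mem_nth 0 hj; rewrite mem_rev mem_iota; set a := nth _ _ _; lia.
    have h2 : i * (2 * i + 2) <= n c * (2 * n c + 2) by apply: leq_mul; lia.
    by rewrite size_rev size_iota sz_nat; lia.
apply: wcpt_eq (PT_rev (PT_comp PT_snd h)) => // c.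
by rewrite hi revK.
Qed.

End Order.

Section Seq.
Context (C A : Type) `{Data C} `{Data A}.

Lemma PT_drop (n : C -> nat) (s : C -> seq A) : PT n -> PT s -> PT (fun c => drop (n c) (s c)).
Proof.
move=> hn hs; have h : PT (fun c => iter (n c) behead (s c)).
  apply: (PT_iter (f := fun _ => behead) (G := fun=> 0)) => //.
  - by apply: PT_behead; exact: PT_snd.
  - exact: polyb_cst.
  - by move=> c [|a t]; rewrite /= ?sz_cons; lia.
apply: wcpt_eq h => // c; congr (wt (tr _)).
elim: (n c) (s c) => [|i IH] t; first by rewrite drop0.
by rewrite iterSr IH; case: t.
Qed.

Lemma PT_take (n : C -> nat) (s : C -> seq A) : PT n -> PT s -> PT (fun c => take (n c) (s c)).
Proof.
move=> hn hs; pose proof (PT_map_fst (PT_zip hs (PT_nseq hn))) as h.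
apply: wcpt_eq h => // c; congr (wt (tr _)).
by elim: (s c) (n c) => [|a t IH] [|i] //=; rewrite IH.
Qed.

Lemma PT_nth a0 (n : C -> nat) (s : C -> seq A) :
  PT n -> PT s -> PT (fun c => nth a0 (s c) (n c)).
Proof.
move=> hn hs; apply: wcpt_eq (PT_head a0 (PT_drop hn hs)) => // c.
by rewrite -nth0 nth_drop addn0.
Qed.

Lemma PT_flatten (s : C -> seq (seq A)) : PT s -> PT (fun c => flatten (s c)).
Proof.
move=> hs; have h : PT (fun c => foldl (fun u t => t ++ u) [::] (rev (s c))).
  apply: (PT_foldl (f := fun _ u t => t ++ u) (G := fun _ t => sz t)) => //.
  - by apply: PT_cat; [exact: PT_comp PT_snd PT_snd | exact: PT_comp PT_fst PT_snd].
  - exact: PT_rev.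
  - exact: PT_cst.
  - apply: (polyb_le (U := fun p : C * seq A => sz p)); last exact: polyb_id.
    by case=> c a; rewrite sz_pair /=; lia.
  - by move=> c b a; pose proof (sz_cat a b); lia.
by apply: wcpt_eq h => // c; rewrite foldl_rev.
Qed.

Lemma PT_mask (m : C -> bitseq) (s : C -> seq A) :
  PT m -> PT s -> PT (fun c => mask (m c) (s c)).
Proof.
move=> hm hs.
have h : PT (fun c => unzip2 [seq p <- zip (m c) (s c) | p.1]).
  apply: PT_map_snd; apply: (PT_filter (f := fun _ p => p.1)); last exact: PT_zip.
  exact: PT_comp PT_fst PT_snd.
apply: wcpt_eq h => // c; congr (wt (tr _)).
by elim: (m c) (s c) => [|[] t IH] [|a u] //=; rewrite IH.
Qed.

End Seq.

Lemma PT_flatmap (C A B : Type) `{Data C} `{Data A} `{Data B}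
    (f : C -> A -> seq B) (s : C -> seq A) :
  PT (fun p : C * A => f p.1 p.2) -> PT s ->
  PT (fun c => flatten [seq f c a | a <- s c]).
Proof. by move=> hf hs; apply: PT_flatten; apply: PT_map. Qed.

Lemma wt_inj a b r r' : wt a ++ r = wt b ++ r' -> a = b /\ r = r'.
Proof.
elim: a b r r' => [|a1 IH1 a2 IH2] [|b1 b2] r r' //=; first by case.
by case; rewrite -!catA => /IH1[-> /IH2[-> ->]].
Qed.

Lemma tr_nat_inj : injective (fun n : nat => tr n).
Proof. by elim=> [|m IH] [|n] //= [/IH ->]. Qed.

Lemma tr_seqnat_inj : injective (fun s : seq nat => tr s).
Proof. by elim=> [|a s IH] [|b t] //= [/tr_nat_inj -> /IH ->]. Qed.

Lemma wt_seqnat_inj : injective (fun s : seq nat => wt (tr s)).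
Proof.
move=> s t e; apply: tr_seqnat_inj.
by have [] := @wt_inj (tr s) (tr t) [::] [::]; rewrite ?e.
Qed.

(** * Passing between raw bit strings and tree codes *)

Definition raw_in := Seq (Seq (move 0 1) (Push 0 false)) (While 1
  (Seq (Case 1 (Pop 1)
     (Seq (Seq (Push 0 false) (Push 0 false)) (Seq (Push 0 true) (Push 0 true)))
     (Seq (Push 0 false) (Push 0 true))) (Pop 1))).

(** The code is built from its end, the empty list: the reversed word yields its last bit first, and
    each bit is prepended as 1100 for [true] or 10 for [false]. *)
Lemma wcpt_raw_in : wcpt (fun w : word => w) (fun w => wt (tr w)).
Proof.
exists raw_in; exists (fun w => 30 * size w + 20); split; first by pb.
move=> w; apply: exec_le.
  apply: exec_seq.
    by apply: exec_seq; first exact: exec_moveL; exact: exec_pushL.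
  rewrite /= catrevE cats0.
  set body := Seq (Case _ _ _ _) _.
  have hb s := exec_eval s (isT : loopfree body).
  have : exec (While 1 body) (st [:: wt (tr ([::] : word)); rev w]) (20 * size (rev w) + 1)
      (st [:: wt (tr (catrev (rev w) [::]))]).
    elim: (rev w) [::] => [|b u IH] v.
      by apply: exec_stL; first exact: exec_stop; st_solve.
    apply: exec_le; first apply: (exec_step _ (hb _)) => //.
      apply: exec_eq (IH (b :: v)) _ _ => //.
      by case: b; st_solve.
    by rewrite /=; lia.
  by rewrite catrevE revK cats0; apply.
by rewrite /= size_rev; lia.
Qed.

Definition raw_out := Seq (While 0 (Case 0 (Pop 0)
  (Seq (Pop 0) (Case 0 (Pop 0)
    (Seq (Seq (Pop 0) (Seq (Pop 0) (Pop 0))) (Push 1 true))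
    (Seq (Pop 0) (Push 1 false))))
  (Pop 0))) (move 1 0).

Lemma wcpt_raw_out : wcpt (fun w : word => wt (tr w)) (fun w => w).
Proof.
exists raw_out; exists (fun w => 40 * size (wt (tr w)) + 40); split; first by pb.
move=> w; rewrite /raw_out; set body := Case 0 _ _ _.
have hb s := exec_eval s (isT : loopfree body).
have h u v : exec (While 0 body) (st [:: wt (tr (u : word)); v]) (20 * size u + 20)
    (st [:: [::]; catrev u v]).
  elim: u v => [|b u IH] v.
    have hs := @exec_stop 0 body (st [:: [::]; v]) erefl.
    apply: exec_le; first apply: (exec_step _ (hb _)) => //.
      by apply: exec_eq hs _ _ => //; st_solve.
    by rewrite /=; lia.
  apply: exec_le; first apply: (exec_step _ (hb _)) => //.
    apply: exec_eq (IH (b :: v)) _ _ => //.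
    by case: b; st_solve.
  by rewrite /=; lia.
apply: exec_le.
  apply: exec_seq.
    by apply: exec_eq (h w [::]) _ (frefl _); st_solve.
  by apply: exec_stL; first exact: exec_moveL; st_solve.
have : size w <= size (wt (tr w)) by exact: (ltnW (size_lt_sz w)).
by rewrite /= catrevE cats0 size_rev; lia.
Qed.

Fixpoint bound_reg (c : prog) : nat :=
  match c with
  | Push r _ | Pop r => r.+1
  | Seq c1 c2 => maxn (bound_reg c1) (bound_reg c2)
  | Case r c0 c1 c2 => maxn r.+1 (maxn (bound_reg c0) (maxn (bound_reg c1) (bound_reg c2)))
  | While r c => maxn r.+1 (bound_reg c)
  end.

Lemma run_frame c s t s' : run c s t s' -> forall r, bound_reg c <= r -> s' r = s r.
Proof.
elim=> {c s t s'} /=.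
- by move=> r b s r' h; case: eqP => // e; lia.
- by move=> r s r' h; case: eqP => // e; lia.
- by move=> c1 c2 s1 s2 s3 t1 t2 _ h1 _ h2 r h; rewrite h2 ?h1 //; lia.
- move=> r c0 c1 c2 s s' t _ h r' h'; apply: h.
  by case: (s r) => [|[] _]; lia.
- by [].
- by move=> r c s1 s2 s3 t1 t2 _ _ h1 _ h2 r' h; rewrite h2 ?h1 //; lia.
Qed.

Fixpoint clear_all (n : nat) : prog :=
  if n is n'.+1 then Seq (clear n) (clear_all n') else Seq (Push 0 true) (Pop 0).

Lemma exec_clear_all n s k : (forall r, size (s r) <= k) ->
  exec (clear_all n) s (n * (2 * k).+1 + 2) (fun r => if 0 < r <= n then [::] else s r).
Proof.
elim: n s => [|n IH] s hs.
  apply: exec_eq (exec_eval s (isT : loopfree (clear_all 0))) _ _ => //.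
  by case=> [|r].
have hs' r : size ([eta s with n.+1 |-> [::]] r) <= k by rewrite /=; case: eqP.
apply: exec_eq (exec_le (exec_seq (exec_clear n.+1 s) (IH _ hs')) _) _ _ => //.
  by have := hs n.+1; lia.
move=> r /=; case: (r =P n.+1) => [->|ne]; first by rewrite leqnn; case: ifP.
by have -> : (r <= n.+1) = (r <= n) by lia.
Qed.

(** A program for [poly_time] may leave anything outside register 0, whereas [wcpt] programs start
    from empty registers. Only the registers it mentions and those of its arguments can be nonempty,
    and their contents are no longer than input plus time, so clearing them is affordable. *)
Lemma poly_time_comp (l : nat) (f : l.-tuple word -> word) (g : word -> word) :
  poly_time f -> wcpt (fun w : word => w) g -> poly_time (fun xs => g (f xs)).
Proof.
move=> [c [a hc]] /wcptE[c' [m hc']].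
pose N (xs : l.-tuple word) := \sum_(x <- xs) size x.
pose k xs := N xs + poly_bound a (N xs).
pose T xs := poly_bound a (N xs) + (((bound_reg c) + l) * (2 * k xs).+1 + 2 + (k xs).+2 ^ m).
have [b hb] : exists b, forall xs, T xs <= poly_bound b (N xs).
  apply: polyb_poly_bound; rewrite /T /k.
  by pose proof (polyb_bound a N); pb.
exists (Seq c (Seq (clear_all (bound_reg c + l)) c')), b => xs.
have [t [s [hr ht hs]]] := hc xs.
have size_in r : size (nth [::] xs r) <= N xs.
  rewrite /N; case: (ltnP r (size xs)) => hr'; last by rewrite nth_default.
  by rewrite (big_nth [::]) big_mkord (bigD1 (Ordinal hr')) //= leq_addr.
have size_s r : size (s r) <= k xs.
  have := run_size hr r; have := size_in r.
  by move: ht; rewrite /k -/(N xs); lia.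
have e2 := exec_clear_all (bound_reg c + l) size_s.
have e3 : exec c' (fun r => if 0 < r <= bound_reg c + l then [::] else s r)
    ((k xs).+2 ^ m) (st [:: g (f xs)]).
  apply: exec_eq (exec_le (hc' (f xs)) _) _ _ => //.
    by apply: leq_expr; rewrite -hs; have := size_s 0; lia.
  case=> [|r] /=; first by rewrite /st hs.
  rewrite /st /= nth_nil; case: ifP => // h.
  rewrite (run_frame hr); last by lia.
  by rewrite nth_default // size_tuple; lia.
have e1 : exec c (fun r => nth [::] xs r) (poly_bound a (N xs)) s by exists t.
have [t' ht' hr'] := exec_seq e1 (exec_seq e2 e3).
exists t', (st [:: g (f xs)]); split => //.
exact: leq_trans ht' (hb xs).
Qed.

Lemma poly_time_PT (l : nat) (f : l.-tuple word -> word) (g : word -> word) :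
  poly_time f -> PT g -> poly_time (fun xs => g (f xs)).
Proof.
move=> hf hg; apply: poly_time_comp hf _.
exact: wcpt_comp wcpt_raw_in (wcpt_comp hg (wcpt_reindex g wcpt_raw_out)).
Qed.

(** * The reduction *)

Definition lead (w : word) : nat :=
  (foldl (fun s (b : bool) => if s.1 then (if b then (true, s.2.+1) else (false, s.2)) else s)
     (true, 0) w).2.

Lemma lead_enc_nat n w : lead (enc_nat n ++ w) = n.
Proof.
rewrite /lead /enc_nat cat_rcons foldl_cat.
set f := fun _ _ => _.
have -> : foldl f (true, 0) (nseq n true) = (true, n).
  rewrite -[n in RHS]add0n; elim: n 0 => [|n IH] m; first by rewrite addn0.
  by rewrite /= IH addSnnS.
have -> : foldl f (true, n) (false :: w) = foldl f (false, n) w by [].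
by elim: w.
Qed.

Lemma size_enc_nat n : size (enc_nat n) = n.+1.
Proof. by rewrite size_rcons size_nseq. Qed.

Lemma drop_enc_nat n w : drop n.+1 (enc_nat n ++ w) = w.
Proof. by rewrite -{1}(size_enc_nat n) drop_size_cat. Qed.

(** Doubling stops as soon as [N] is exceeded, so the power of two, a unary number, stays linear in
    [N]. *)
Definition lg_step N (s : nat * nat) : nat * nat :=
  if s.1 <= N then (s.1 + s.1, s.2.+1) else s.

Definition lg N : nat := (iter N (lg_step N) (1, 0)).2.

Lemma lg_iter N i : exists k, [/\ iter i (lg_step N) (1, 0) = (2 ^ k, k),
  2 ^ k <= 2 * N + 1, k <= i & N < 2 ^ k \/ k = i].
Proof.
elim: i => [|i [k [hk h1 h2 h3]]]; first by exists 0; split=> //; [lia | right].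
rewrite iterS hk /lg_step /=; case: leqP => h.
  exists k.+1; rewrite !expnS; split; [by rewrite mul2n addnn|lia|lia|].
  by case: h3 => h3; [lia | right; rewrite h3].
by exists k; split=> //; [lia | left].
Qed.

Lemma lgP N : N < 2 ^ lg N /\ 2 ^ lg N <= 2 * N + 1.
Proof.
have [k [hk h1 _ h3]] := lg_iter N N; rewrite /lg hk /=; split=> //.
by case: h3 => // ->; apply: ltn_expl.
Qed.

Definition words (Q l : nat) : seq (seq nat) :=
  iter l (fun ws => [seq x :: t | x <- iota 0 Q, t <- ws]) [:: [::]].

Lemma size_words Q l : size (words Q l) = Q ^ l.
Proof.
elim: l => // l IH.
by rewrite [words _ _]/= size_allpairs size_iota IH expnS.
Qed.

Lemma mem_words Q l t : (t \in words Q l) = (size t == l) && all (ltn^~ Q) t.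
Proof.
elim: l t => [|l IH] t; first by case: t.
rewrite [words _ _]/=; apply/allpairsP/idP.
  by move=> [[x u] /= [hx hu ->]]; move: hu hx; rewrite IH /= mem_iota eqSS => /andP[-> ->]; lia.
case: t => [|x u] //; rewrite eqSS /= => /and3P[h1 h2 h3].
by exists (x, u); rewrite /= IH mem_iota h1 h3; split => //; lia.
Qed.

Lemma words_uniq Q l : uniq (words Q l).
Proof.
elim: l => // l IH; rewrite [words _ _]/=; apply: allpairs_uniq => //.
  exact: iota_uniq.
by move=> [x u] [x' u'] _ _ /= [-> ->].
Qed.

Definition agree (v w : seq nat) : nat := count (fun p => p.1 == p.2) (zip v w).

Definition far (b : nat) (s : seq (seq nat)) (w : seq nat) : bool :=
  all (fun v => agree v w < b) s.

(** The Gilbert-Varshamov code. *)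
Definition greedy (b : nat) (ws : seq (seq nat)) : seq (seq nat) :=
  foldl (fun acc w => if far b acc w then w :: acc else acc) [::] ws.

(** On a code whose distinct words agree in fewer than [b] places, and whose length is at least [b],
    the test [far] excludes exactly the repetitions: a word agrees with itself everywhere. No
    equality test on words is needed. *)
Fixpoint tuples (b : nat) (cw : seq (seq nat)) (y : nat) : seq (seq (seq nat)) :=
  if y is y'.+1 then
    flatten [seq [seq x :: t | t <- tuples b cw y' & far b t x] | x <- cw]
  else [:: [::]].

Definition column (ws : seq (seq nat)) (i : nat) : seq nat := [seq nth 0 w i | w <- ws].

Section Reduction.
Variables (K q y d0 : nat) (tT tS : seq nat -> word) (k0 k1 : word).
Implicit Type w : word.

(* [w] is read as an instance of Johnson Coverage: universe, [k], and collection. *)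
Definition rd_n w := lead w.
Definition rd_w1 w := drop (rd_n w).+1 w.
Definition rd_k w := lead (rd_w1 w).
Definition rd_w2 w := drop (rd_k w).+1 (rd_w1 w).
Definition rd_m w := lead (rd_w2 w).
Definition rd_w3 w := drop (rd_m w).+1 (rd_w2 w).
Definition rd_E w : seq word :=
  [seq take (rd_n w) (drop (j * rd_n w) (rd_w3 w)) | j <- iota 0 (rd_m w)].
(* [2 ^ rd_b w] exceeds the size of the instance and is linear in it. *)
Definition rd_b w := lg (size w).
Definition rd_l w := K * rd_b w.
Definition rd_L w := rd_b w + K * rd_b w.
Definition rd_code w : seq (seq nat) :=
  take (rd_n w) (greedy (rd_b w) (words (2 ^ q) (rd_l w))).
Definition rd_T w : seq (seq (seq nat)) := [seq mask T (rd_code w) | T <- rd_E w].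
(* The words zipped with the points and the centers are tags that make them
   distinct; [words 2 (K * b)] only serves to repeat the points. *)
Definition rd_P w : seq (seq (seq nat) * seq nat) :=
  zip (flatten [seq [seq T | _ <- words 2 (K * rd_b w)] | T <- rd_T w]) (words 2 (rd_L w)).
Definition rd_C w : seq (seq (seq nat) * seq nat) :=
  zip (tuples (rd_b w) (rd_code w) y) (words 2 (rd_L w)).

Definition enc_vec (t : seq nat -> word) (l : nat) (u : seq (seq nat) * seq nat) : word :=
  flatten [seq t (column u.1 i) | i <- iota 0 l] ++
  flatten [seq if b == 0 then k0 else k1 | b <- u.2].

Definition rd w : word :=
  enc_nat (rd_l w * d0 + rd_L w) ++ enc_nat (rd_k w) ++
  enc_seq (enc_vec tT (rd_l w)) (rd_P w) ++ enc_seq (enc_vec tS (rd_l w)) (rd_C w).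

End Reduction.

(** * The reduction runs in polynomial time *)

Section PTWords.
Context (C : Type) `{Data C}.

Lemma PT_lead (w : C -> word) : PT w -> PT (fun c => lead (w c)).
Proof.
move=> hw; apply: (PT_comp PT_snd).
apply: (PT_foldl (f := fun _ s (b : bool) =>
   if s.1 then (if b then (true, s.2.+1) else (false, s.2)) else s) (G := fun _ _ => 5)) => //.
- have h1 : PT (fun p : C * ((bool * nat) * bool) => p.2.1).
    exact: PT_comp PT_fst PT_snd.
  have h2 : PT (fun p : C * ((bool * nat) * bool) => p.2.1.2) by exact: PT_comp PT_snd h1.
  apply: PT_if => //; first exact: PT_comp PT_fst h1.
  apply: PT_if; first exact: PT_comp PT_snd PT_snd.
    by apply: PT_pair; [exact: PT_cst | exact: PT_S].
  by apply: PT_pair; [exact: PT_cst | ].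
- exact: PT_cst.
- exact: polyb_cst.
- move=> c [b n] a; rewrite !sz_pair !sz_nat /=.
  pose proof (sz_gt0 b); pose proof (sz_bool true); pose proof (sz_bool false).
  by case: b {H0} => /=; case: a; rewrite ?sz_pair ?sz_nat; lia.
Qed.

Lemma PT_lg (n : C -> nat) : PT n -> PT (fun c => lg (n c)).
Proof.
move=> hn; have hN : polyb (fun c => sz c) n.
  apply: (polyb_le (U := fun c => sz (n c))); last exact: PT_size.
  by move=> c; rewrite sz_nat; lia.
apply: (PT_comp PT_snd).
apply: (PT_iter_bounded (f := fun c => lg_step (n c)) (U := fun c => 10 * n c + 10)) => //.
- have h1 : PT (fun p : C * (nat * nat) => p.2.1) by exact: PT_comp PT_fst PT_snd.
  have h2 : PT (fun p : C * (nat * nat) => p.2.2) by exact: PT_comp PT_snd PT_snd.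
  apply: PT_if; last exact: PT_snd.
    by apply: PT_leq => //; exact: PT_comp hn PT_fst.
  by apply: PT_pair; [exact: PT_addn | exact: PT_S].
- exact: PT_cst.
- by pb.
- move=> c i hi; have [k [-> h1 h2 _]] := lg_iter (n c) i.
  by rewrite sz_pair !sz_nat; lia.
Qed.

Lemma PT_words Q (n : C -> nat) : PT n -> polyb (fun c => sz c) (fun c => Q ^ n c) ->
  0 < Q -> PT (fun c => words Q (n c)).
Proof.
move=> hn hQ Q_gt0; have hN : polyb (fun c => sz c) n.
  apply: (polyb_le (U := fun c => sz (n c))); last exact: PT_size.
  by move=> c; rewrite sz_nat; lia.
apply: (PT_iter_bounded (f := fun _ ws => [seq x :: t | x <- iota 0 Q, t <- ws])
  (U := fun c => (Q ^ n c * (n c * (2 * Q + 2) + 1).+1).+1)) => //.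
- apply: PT_flatmap; last exact: PT_cst.
  apply: PT_map; last exact: PT_comp PT_snd PT_fst.
  apply: PT_cons; last exact: PT_snd.
  exact: PT_comp PT_snd PT_fst.
- exact: PT_cst.
- by pb.
- move=> c i hi; rewrite -/(words Q i).
  have h : sz (words Q i) <= (size (words Q i) * (i * (2 * Q + 2) + 1).+1).+1.
    apply: sz_le => j hj a0.
    have := mem_nth a0 hj; rewrite mem_words; set t := nth _ _ _ => /andP[/eqP <- ht].
    elim: t ht => //= x u IH /andP[hx hu]; rewrite sz_cons sz_nat mulSn.
    by have := IH hu; lia.
  apply: leq_trans h _; rewrite ltnS size_words; apply: leq_mul.
    by rewrite leq_pexp2l.
  by rewrite ltnS leq_add2r leq_mul2r hi orbT.
Qed.

Lemma PT_agree (v w : C -> seq nat) : PT v -> PT w -> PT (fun c => agree (v c) (w c)).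
Proof.
move=> hv hw.
have h : PT (fun c => size [seq p <- zip (v c) (w c) | p.1 == p.2]).
  apply: PT_size_seq; apply: (PT_filter (f := fun _ p => p.1 == p.2)); last exact: PT_zip.
  by apply: PT_eqn; [exact: PT_comp PT_fst PT_snd | exact: PT_comp PT_snd PT_snd].
by apply: wcpt_eq h => // c; rewrite size_filter.
Qed.

End PTWords.

Section PTFar.
Context (C : Type) `{Data C}.

Lemma PT_far (b : C -> nat) (s : C -> seq (seq nat)) (w : C -> seq nat) :
  PT b -> PT s -> PT w -> PT (fun c => far (b c) (s c) (w c)).
Proof.
move=> hb hs hw; apply: (PT_all (f := fun c v => agree v (w c) < b c)) => //.
apply: (PT_leq (m := fun p : C * seq nat => (agree p.2 (w p.1)).+1)).
  by apply: PT_S; apply: PT_agree; [exact: PT_snd | exact: PT_comp hw PT_fst].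
exact: PT_comp hb PT_fst.
Qed.
End PTFar.

Section PTCode.
Context (C : Type) `{Data C}.

Lemma PT_greedy (b : C -> nat) (ws : C -> seq (seq nat)) :
  PT b -> PT ws -> PT (fun c => greedy (b c) (ws c)).
Proof.
move=> hb hws.
apply: (PT_foldl (f := fun c acc w => if far (b c) acc w then w :: acc else acc)
  (G := fun _ w => (sz w).+1)) => //.
- have h1 : PT (fun p : C * (seq (seq nat) * seq nat) => p.2.1) by exact: PT_comp PT_fst PT_snd.
  have h2 : PT (fun p : C * (seq (seq nat) * seq nat) => p.2.2) by exact: PT_comp PT_snd PT_snd.
  apply: PT_if => //; last exact: PT_cons.
  by apply: PT_far => //; exact: PT_comp hb PT_fst.
- exact: PT_cst.
- apply: (polyb_le (U := fun p : C * seq nat => sz p)); last exact: polyb_id.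
  by case=> c a; rewrite sz_pair /=; pose proof (sz_gt0 c); lia.
- by move=> c acc w; case: ifP => _; rewrite ?sz_cons; lia.
Qed.

Lemma PT_tuples (b : C -> nat) (cw : C -> seq (seq nat)) y :
  PT b -> PT cw -> PT (fun c => tuples (b c) (cw c) y).
Proof.
move=> hb hcw; elim: y => [|y IH]; first exact: PT_cst.
apply: (PT_flatmap (f := fun c x =>
  [seq x :: t | t <- [seq t <- tuples (b c) (cw c) y | far (b c) t x]])) => //.
apply: PT_map; first by apply: PT_cons; [exact: PT_comp PT_snd PT_fst | exact: PT_snd].
apply: (PT_filter (f := fun (p : C * seq nat) t => far (b p.1) t p.2)); last first.
  exact: PT_comp IH PT_fst.
apply: PT_far; [|exact: PT_snd|exact: PT_comp PT_snd PT_fst].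
exact: PT_comp hb (PT_comp PT_fst PT_fst).
Qed.

Lemma PT_enc_nat (n : C -> nat) : PT n -> PT (fun c => enc_nat (n c)).
Proof.
move=> hn; have h : PT (fun c => [seq true | _ <- nseq (n c) tt] ++ [:: false]).
  apply: PT_cat; last exact: PT_cst.
  by apply: PT_map; [exact: PT_cst | exact: PT_nseq].
by apply: wcpt_eq h => // c; rewrite /enc_nat -cats1 map_nseq.
Qed.

Lemma PT_enc_seq (A : Type) `{Data A} (f : C -> A -> word) (s : C -> seq A) :
  PT (fun p : C * A => f p.1 p.2) -> PT s -> PT (fun c => enc_seq (f c) (s c)).
Proof.
move=> hf hs; apply: PT_cat; last exact: PT_flatmap.
by apply: PT_enc_nat; exact: PT_size_seq.
Qed.

Lemma PT_column (ws : C -> seq (seq nat)) (i : C -> nat) :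
  PT ws -> PT i -> PT (fun c => column (ws c) (i c)).
Proof.
move=> hws hi; apply: PT_map => //.
by apply: PT_nth; [exact: PT_comp hi PT_fst | exact: PT_snd].
Qed.

End PTCode.

Section PTVec.
Context (C : Type) `{Data C}.

Lemma PT_enc_vec k0 k1 (t : seq nat -> word) (l : C -> nat) (u : C -> seq (seq nat) * seq nat) :
  PT t -> PT l -> PT u -> PT (fun c => enc_vec k0 k1 t (l c) (u c)).
Proof.
move=> ht hl hu; apply: PT_cat.
  apply: PT_flatmap; last exact: PT_iota.
  apply: (PT_comp ht); apply: PT_column; last exact: PT_snd.
  exact: PT_comp PT_fst (PT_comp hu PT_fst).
apply: PT_flatmap; last exact: PT_comp PT_snd hu.
by apply: PT_if0; [exact: PT_snd | exact: PT_cst | exact: PT_cst].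
Qed.

End PTVec.

Section PTRd.
Variables (K q y d0 : nat) (tT tS : seq nat -> word) (k0 k1 : word).
Hypotheses (hT : PT tT) (hS : PT tS).

Let PT_n : PT rd_n. Proof. by apply: PT_lead; exact: PT_id. Qed.
Let PT_w1 : PT rd_w1. Proof. by apply: PT_drop; [exact: PT_S | exact: PT_id]. Qed.
Let PT_k : PT rd_k. Proof. exact: PT_lead. Qed.
Let PT_w2 : PT rd_w2. Proof. by apply: PT_drop => //; exact: PT_S. Qed.
Let PT_m : PT rd_m. Proof. exact: PT_lead. Qed.
Let PT_w3 : PT rd_w3. Proof. by apply: PT_drop => //; exact: PT_S. Qed.

Let PT_E : PT rd_E.
Proof.
apply: PT_map; last exact: PT_iota.
apply: PT_take; first exact: PT_comp PT_n PT_fst.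
apply: PT_drop; last exact: PT_comp PT_w3 PT_fst.
by apply: PT_muln; [exact: PT_snd | exact: PT_comp PT_n PT_fst].
Qed.

Let PT_b : PT rd_b. Proof. by apply: PT_lg; apply: PT_size_seq; exact: PT_id. Qed.
Let PT_Kb : PT (fun w => K * rd_b w).
Proof. by apply: PT_muln => //; exact: PT_cst. Qed.
Let PT_L : PT (rd_L K). Proof. exact: PT_addn. Qed.

(** This is what makes exhaustive search affordable: all lists of words have 2^(k b) elements with
    [k] a constant, a fixed power of a quantity linear in the input. *)
Let polyb_2b : polyb (fun w : word => sz w) (fun w => 2 ^ rd_b w).
Proof.
apply: (polyb_le (U := fun w => 2 * sz w + 1)); last by pb.
move=> w; apply: leq_trans (lgP _).2 _.
have h : size w < sz w by exact: size_lt_sz.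
by lia.
Qed.

Let PT_words2 : PT (fun w => words 2 (rd_L K w)).
Proof.
apply: PT_words => //; apply: (polyb_le (U := fun w => 2 ^ rd_b w * (2 ^ rd_b w) ^ K)).
  by move=> w; rewrite expnD -expnM [K * _]mulnC.
by pb.
Qed.

Let PT_words2K : PT (fun w => words 2 (K * rd_b w)).
Proof.
apply: PT_words => //; apply: (polyb_le (U := fun w => (2 ^ rd_b w) ^ K)); last by pb.
by move=> w; rewrite -expnM mulnC.
Qed.

Let PT_code : PT (rd_code K q).
Proof.
apply: PT_take => //; apply: PT_greedy => //; apply: PT_words => //; last first.
  by rewrite expn_gt0.
apply: (polyb_le (U := fun w => (2 ^ rd_b w) ^ (K * q))); last by pb.
by move=> w; rewrite -!expnM /rd_l; apply: eq_leq; congr (2 ^ _); lia.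
Qed.

Let PT_T : PT (rd_T K q).
Proof.
apply: PT_map => //; apply: PT_mask; first exact: PT_snd.
exact: PT_comp PT_code PT_fst.
Qed.

Lemma PT_rd : PT (rd K q y d0 tT tS k0 k1).
Proof.
have hl : PT (rd_l K) by [].
have hlf (A : Type) (d : Data A) : PT (fun p : word * A => rd_l K p.1).
  exact: PT_comp hl PT_fst.
apply: PT_cat.
  by apply: PT_enc_nat; apply: PT_addn => //; apply: PT_muln => //; exact: PT_cst.
apply: PT_cat; first exact: PT_enc_nat.
apply: PT_cat.
  apply: (PT_enc_seq (f := fun w => enc_vec k0 k1 tT (rd_l K w))).
    by apply: PT_enc_vec => //; exact: PT_snd.
  apply: PT_zip => //; apply: PT_flatmap => //.
  apply: PT_map; first exact: PT_comp PT_snd PT_fst.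
  exact: PT_comp PT_words2K PT_fst.
apply: (PT_enc_seq (f := fun w => enc_vec k0 k1 tS (rd_l K w))).
  by apply: PT_enc_vec => //; exact: PT_snd.
by apply: PT_zip => //; apply: PT_tuples.
Qed.

End PTRd.

(** * The greedy code *)

Lemma agreeC v w : agree v w = agree w v.
Proof. by rewrite /agree; elim: v w => [|x v IH] [|y w] //=; rewrite IH eq_sym. Qed.

Lemma agree_refl v : agree v v = size v.
Proof. by rewrite /agree; elim: v => //= x v ->; rewrite eqxx. Qed.

Lemma greedy_rcons b ws w : greedy b (rcons ws w) =
  if far b (greedy b ws) w then w :: greedy b ws else greedy b ws.
Proof. by rewrite /greedy foldl_rcons. Qed.

Lemma greedy_sub b ws : {subset greedy b ws <= ws}.
Proof.
elim/last_ind: ws => // ws w IH v; rewrite greedy_rcons mem_rcons inE.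
case: ifP => _; last by move/IH ->; rewrite orbT.
by rewrite inE => /predU1P[->|/IH ->]; rewrite ?eqxx ?orbT.
Qed.

Lemma greedy_pairwise b ws : pairwise (fun v w => agree w v < b) (greedy b ws).
Proof.
elim/last_ind: ws => // ws w IH; rewrite greedy_rcons.
by case: ifP => //= h; rewrite IH andbT.
Qed.

(** Maximality of the code: a rejected word agrees too much with a kept one, and a kept word with
    itself, which is where the bound on [size v] enters. *)
Lemma greedy_cover b ws w : (forall v, v \in ws -> b <= size v) -> w \in ws ->
  has (fun v => b <= agree v w) (greedy b ws).
Proof.
elim/last_ind: ws => // ws u IH h; rewrite mem_rcons inE greedy_rcons.
have IH' : w \in ws -> has (fun v => b <= agree v w) (greedy b ws).
  by apply: IH => v hv; apply: h; rewrite mem_rcons inE hv orbT.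
case: ifP => hf /predU1P[->|hw] /=.
- by rewrite agree_refl h // mem_rcons mem_head.
- by rewrite IH' ?orbT.
- by move/negbT: hf; rewrite -has_predC; apply: sub_has => v /=; rewrite -leqNgt.
- exact: IH'.
Qed.

Lemma size_cover (T U : eqType) (r : T -> U -> bool) (s : seq T) (ws : seq U) m :
  (forall w, w \in ws -> has (r^~ w) s) ->
  (forall v, v \in s -> count (r v) ws <= m) -> size ws <= size s * m.
Proof.
elim: s ws => [|v s IH] ws hc hm.
  by case: ws hc {hm} => // w ws /(_ w (mem_head _ _)).
rewrite -(count_predC (r v)) mulSn leq_add ?hm ?mem_head // -size_filter.
apply: IH => [w|u hu].
  by rewrite mem_filter /= => /andP[/negPf h /hc]; rewrite /= h.
apply: leq_trans (hm u _); last by rewrite inE hu orbT.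
by rewrite count_filter; apply: sub_count => w /andP[].
Qed.

Lemma sumn_if (s : seq nat) x0 A B : uniq s ->
  sumn [seq if x == x0 then A else B | x <- s] <= A + size s * B.
Proof.
elim: s => //= x s IH /andP[hx hs]; rewrite mulSn.
case: eqP => [e|_]; last by have := IH hs; lia.
suff -> : [seq if y == x0 then A else B | y <- s] = nseq (size s) B.
  by rewrite sumn_nseq mulnC; lia.
elim: s hx {IH hs} => //= y s IH; rewrite inE negb_or => /andP[hy /IH ->].
by rewrite -e eq_sym (negPf hy).
Qed.

(* The Gilbert-Varshamov estimate of the volume of a ball. *)
Lemma count_agree Q l b (g : seq nat) : 0 < Q ->
  count (fun w => b <= agree g w) (words Q l) * Q ^ b <= 2 ^ l * Q ^ l.
Proof.
move=> hQ; elim: l b g => [|l IH] b g.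
  by case: g => [|? ?]; case: b => [|b] //=; rewrite !muln1.
case: b => [|b].
  rewrite muln1 (eq_count (a2 := predT)) // count_predT size_words.
  by rewrite -[X in X <= _]mul1n leq_mul2r expn_gt0 orbT.
case: g => [|g0 g].
  rewrite (eq_count (a2 := pred0)) ?count_pred0 //.
  by move=> w; rewrite /agree; case: w.
rewrite [words _ _]/= count_flatten -map_comp.
set A := count (fun w => b <= agree g w) (words Q l).
set B := count (fun w => b.+1 <= agree g w) (words Q l).
have -> : [seq (count (fun w => b < agree (g0 :: g) w) \o (fun x => [seq x :: t | t <- words Q l])) x
    | x <- iota 0 Q] = [seq if x == g0 then A else B | x <- iota 0 Q].
  apply: eq_map => x /=; rewrite count_map; case: eqP => e; apply: eq_count => w;
    rewrite /= /agree /=; first by rewrite e eqxx.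
  by rewrite eq_sym (introF eqP e).
have := sumn_if g0 A B (iota_uniq 0 Q); rewrite size_iota.
(* A first letter equal to [g0] leaves [b] agreements to find ([A]), any other letter [b.+1] ([B]).
   The two contributions are each at most half of the bound, whence the factor 2 per letter. *)
have := IH b g; have := IH b.+1 g; rewrite -/A -/B !expnS.
set S := sumn _; set a := 2 ^ l; set c := Q ^ l; set d := Q ^ b.
move=> hB hA hS.
have h1 : S * (Q * d) <= (A + Q * B) * (Q * d) by rewrite leq_mul2r hS orbT.
have h2 : Q * (A * d) <= Q * (a * c) by rewrite leq_mul2l hA orbT.
have h3 : Q * (B * (Q * d)) <= Q * (a * c) by rewrite leq_mul2l hB orbT.
apply: leq_trans h1 _; rewrite mulnDl.
have -> : A * (Q * d) = Q * (A * d) by lia.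
have -> : Q * B * (Q * d) = Q * (B * (Q * d)) by lia.
have -> : 2 * a * (Q * c) = Q * (a * c) + Q * (a * c) by lia.
exact: leq_add.
Qed.

(** With l = K b, each codeword covers at most 2^l Q^(l - b) of the Q^l words, so there are at least
    Q^b / 2^l codewords. The choice Q = 2^(2K) makes this 2^(2Kb - Kb). *)
Lemma size_greedy K b : 0 < K -> 2 ^ (K * b) <= size (greedy b (words (2 ^ (2 * K)) (K * b))).
Proof.
move=> hK; set Q := 2 ^ (2 * K); set ws := words _ _.
have Q_gt0 : 0 < Q by rewrite expn_gt0.
have hws v : v \in ws -> size v = K * b by rewrite mem_words => /andP[/eqP].
pose m := \max_(v <- greedy b ws) count (fun w => b <= agree v w) ws.
have h1 : size ws <= size (greedy b ws) * m.
  apply: (size_cover (r := fun v w => b <= agree v w)).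
    move=> w hw; apply: greedy_cover => // v /hws ->.
    by rewrite leq_pmull.
  by move=> v hv; rewrite /m; apply: leq_bigmax_seq.
have h2 : m * Q ^ b <= 2 ^ (K * b) * Q ^ (K * b).
  rewrite /m; elim: (greedy b ws) => [|v s IH]; first by rewrite big_nil.
  by rewrite big_cons maxnMl geq_max IH count_agree.
rewrite size_words in h1.
have h3 : Q ^ (K * b) * Q ^ b <= size (greedy b ws) * 2 ^ (K * b) * Q ^ (K * b).
  apply: leq_trans (_ : size (greedy b ws) * m * Q ^ b <= _).
    by rewrite leq_mul2r h1 orbT.
  by rewrite -!mulnA leq_mul2l h2 orbT.
rewrite mulnC leq_pmul2r ?expn_gt0 ?Q_gt0 // in h3.
move: h3.
have -> : Q ^ b = 2 ^ (K * b) * 2 ^ (K * b).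
  by rewrite -expnD -expnM; congr (2 ^ _); lia.
by rewrite leq_pmul2r // expn_gt0.
Qed.

Lemma mem_tuples (n b y : nat) (c : 'I_n -> seq nat) (t : seq (seq nat)) :
  (forall i, b <= agree (c i) (c i)) ->
  t \in tuples b [seq c i | i <- enum 'I_n] y ->
  exists s : seq 'I_n, [/\ uniq s, size s = y & t = [seq c i | i <- s]].
Proof.
move=> hb; elim: y t => [|y IH] t /=.
  by rewrite inE => /eqP ->; exists [::].
case/flattenP => u /mapP[x /mapP[i _ ->] ->] /mapP[t']; rewrite mem_filter.
case/andP=> hf /IH[s [hs <- e]] ->; exists (i :: s); split => //=; last by rewrite e.
rewrite hs andbT; apply/negP => hi; move: hf; rewrite e => /allP /(_ (c i)).
by rewrite ltnNge hb map_f // => /(_ isT).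
Qed.

Lemma tuples_mem (n b : nat) (c : 'I_n -> seq nat) (s : seq 'I_n) :
  (forall i j, i != j -> agree (c i) (c j) < b) -> uniq s ->
  [seq c i | i <- s] \in tuples b [seq c i | i <- enum 'I_n] (size s).
Proof.
move=> hb; elim: s => [|i s IH] //= /andP[hi hs].
apply/flattenP; eexists.
  by apply: map_f; apply: (map_f c); rewrite mem_enum; exact: (isT : i \in 'I_n).
apply: map_f; rewrite mem_filter IH // andbT; apply/allP => v /mapP[j hj ->].
by apply: hb; apply: contraNneq hi => <-.
Qed.

Lemma size_tuples b cw y : size (tuples b cw y) <= size cw ^ y.
Proof.
elim: y => //= y IH; rewrite size_flatten /shape -map_comp expnS.
move: (tuples b cw y) (size cw ^ y) IH => T N IH.
elim: cw => //= x cw IHc; rewrite mulSn; apply: leq_add; last exact: IHc.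
by rewrite size_map size_filter; apply: leq_trans IH; apply: count_size.
Qed.

(** * Reading an instance of Johnson Coverage *)

Lemma chunks (T : Type) n (ss : seq (seq T)) : all (fun s => size s == n) ss ->
  [seq take n (drop (j * n) (flatten ss)) | j <- iota 0 (size ss)] = ss.
Proof.
elim: ss => //= s ss IH /andP[/eqP hs hss].
rewrite mul0n drop0 take_size_cat //; congr (_ :: _).
rewrite -[RHS]IH // -[X in iota X]addn0 iotaDl -map_comp; apply: eq_map => j /=.
by rewrite mulnDl mul1n addnC -drop_drop drop_size_cat.
Qed.

Section ReadJC.
Variables (z : nat) (I : jc_instance).
Hypothesis hI : jc_valid z I.
Let w := enc_jc I.

Lemma rd_nE : rd_n w = jc_n I. Proof. exact: lead_enc_nat. Qed.

Let w1E : rd_w1 w = enc_nat (jc_k I) ++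
  enc_seq (fun T : {set 'I_(jc_n I)} => [seq i \in T | i <- enum 'I_(jc_n I)]) (jc_E I).
Proof. by rewrite /rd_w1 rd_nE drop_enc_nat. Qed.

Lemma rd_kE : rd_k w = jc_k I.
Proof. by rewrite /rd_k w1E lead_enc_nat. Qed.

Let w2E : rd_w2 w =
  enc_seq (fun T : {set 'I_(jc_n I)} => [seq i \in T | i <- enum 'I_(jc_n I)]) (jc_E I).
Proof. by rewrite /rd_w2 rd_kE w1E drop_enc_nat. Qed.

Let mE : rd_m w = size (jc_E I).
Proof. by rewrite /rd_m w2E lead_enc_nat. Qed.

Lemma rd_EE : rd_E w =
  [seq [seq i \in T | i <- enum 'I_(jc_n I)] | T : {set 'I_(jc_n I)} <- jc_E I].
Proof.
rewrite /rd_E mE /rd_w3 mE w2E drop_enc_nat rd_nE.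
rewrite -[in LHS](size_map (fun T : {set 'I_(jc_n I)} => [seq i \in T | i <- enum 'I_(jc_n I)])).
apply: chunks; apply/allP => _ /mapP[T _ ->].
by rewrite size_map size_enum_ord.
Qed.

Lemma size_enc_jc : size (jc_E I) + jc_n I < size w.
Proof.
rewrite /w /enc_jc /enc_seq !(size_cat, size_enc_nat); set m := size (flatten _); lia.
Qed.

Lemma rd_b_bound : size (jc_E I) + jc_n I < 2 ^ rd_b w.
Proof. by have [h _] := lgP (size w); apply: leq_trans size_enc_jc (ltnW h). Qed.

Lemma rd_b_gt0 : 0 < rd_b w.
Proof.
case: hI => _ _; case: (jc_E I) (rd_b_bound) => // T E; case: (rd_b w) => //=.
Qed.

(** The greedy code has at least 2^(K b) words and 2^b exceeds the universe, so cutting it to one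
    word per element loses nothing. *)
Lemma rd_codeP K : 0 < K -> exists c : 'I_(jc_n I) -> seq nat,
  [/\ rd_code K (2 * K) w = [seq c i | i <- enum 'I_(jc_n I)],
      forall i, size (c i) = K * rd_b w,
      forall i, all (ltn^~ (2 ^ (2 * K))) (c i)
    & forall i j, i != j -> agree (c i) (c j) < rd_b w].
Proof.
move=> hK; set G := greedy (rd_b w) (words (2 ^ (2 * K)) (K * rd_b w)).
have hG : jc_n I <= size G.
  apply: leq_trans (size_greedy (rd_b w) hK).
  apply: leq_trans (_ : 2 ^ rd_b w <= _); first by have := rd_b_bound; lia.
  by rewrite leq_exp2l // leq_pmull.
have mem (i : 'I_(jc_n I)) : nth [::] G i \in words (2 ^ (2 * K)) (K * rd_b w).
  by apply: greedy_sub; apply: mem_nth; apply: leq_trans hG.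
exists (fun i => nth [::] G i); split.
- rewrite /rd_code -/G rd_nE -[X in take _ X](mkseq_nth [::]) /mkseq -map_take.
  have -> : take (jc_n I) (iota 0 (size G)) = iota 0 (jc_n I).
    by rewrite take_iota (minn_idPl hG).
  by rewrite -val_enum_ord -map_comp.
- by move=> i; have := mem i; rewrite mem_words => /andP[/eqP].
- by move=> i; have := mem i; rewrite mem_words => /andP[].
have hp := greedy_pairwise (rd_b w) (words (2 ^ (2 * K)) (K * rd_b w)).
have lt_case (i j : 'I_(jc_n I)) : i < j -> agree (nth [::] G i) (nth [::] G j) < rd_b w.
  move=> ij; rewrite agreeC; apply: (pairwiseP [::] hp) => //; rewrite inE.
    exact: leq_trans hG.
  exact: leq_trans hG.
move=> i j; rewrite neq_ltn => /orP[/lt_case //|/lt_case]; by rewrite agreeC.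
Qed.

Lemma rd_TE K c : rd_code K (2 * K) w = [seq c i | i <- enum 'I_(jc_n I)] ->
  rd_T K (2 * K) w = [seq [seq c i | i <- enum T] | T : {set 'I_(jc_n I)} <- jc_E I].
Proof.
move=> hc; rewrite /rd_T rd_EE -map_comp; apply: eq_map => T /=.
have -> : enum T = [seq i <- enum (ordinal (jc_n I)) | i \in T] by rewrite enumT.
by rewrite hc -map_mask filter_mask.
Qed.

End ReadJC.

Import Order.TTheory GRing.Theory Num.Theory.
Import numFieldNormedType.Exports.
Local Open Scope ring_scope.

(** * Powers of the norm *)

Section Power.
Variables (R : realType) (p : R).
Hypothesis hp : 1 <= p.

Let p_gt0 : 0 < p. Proof. exact: lt_le_trans ltr01 hp. Qed.

(** The p-th power of the norm is additive over blocks of coordinates. It obeys a triangle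
    inequality up to the factor 2^p, which suffices since only a crude bound on the diameter relies
    on it. *)
Definition pnorm (d : nat) (x : 'rV[R]_d) : R := \sum_(i < d) `|x ord0 i| `^ p.

Lemma pnorm_ge0 d (x : 'rV[R]_d) : 0 <= pnorm x.
Proof. by apply: sumr_ge0 => i _; apply: powR_ge0. Qed.

Lemma pnormN d (x : 'rV[R]_d) : pnorm (- x) = pnorm x.
Proof. by apply: eq_bigr => i _; rewrite mxE normrN. Qed.

Lemma pnorm0 d : pnorm (0 : 'rV[R]_d) = 0.
Proof.
by rewrite /pnorm big1 // => i _; rewrite mxE normr0 powR0 // gt_eqF.
Qed.

Lemma lp_norm_powR d (x : 'rV[R]_d) : lp_norm p x `^ p = pnorm x.
Proof.
by rewrite /lp_norm -powRrM mulVf ?gt_eqF // powRr1 // pnorm_ge0.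
Qed.

Lemma powR_normD (a b : R) : `|a + b| `^ p <= 2 `^ p * (`|a| `^ p + `|b| `^ p).
Proof.
wlog le_ab : a b / `|a| <= `|b|.
  move=> h; case: (lerP `|a| `|b|) => [|/ltW] /h //.
  by rewrite addrC [X in _ * X]addrC.
apply: (@le_trans _ _ ((2 * `|b|) `^ p)).
  apply: ge0_ler_powR; rewrite ?nnegrE ?mulr_ge0 //; first exact: ltW.
  by apply: le_trans (ler_normD _ _) _; lra.
by rewrite powRM // ler_wpM2l ?powR_ge0 // lerDr powR_ge0.
Qed.

Lemma pnormD d (x y : 'rV[R]_d) : pnorm (x + y) <= 2 `^ p * (pnorm x + pnorm y).
Proof.
rewrite /pnorm -big_split /= mulr_sumr; apply: ler_sum => i _.
by rewrite mxE powR_normD.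
Qed.

Lemma cvg_powR_norm (u : nat -> R) (a : R) :
  (u n @[n --> \oo] --> a -> `|u n| `^ p @[n --> \oo] --> `|a| `^ p)%classic.
Proof.
move=> hu; have [a0|a0] := eqVneq a 0; last first.
  have ha : 0 < `|a| by rewrite normr_gt0.
  have hc : {for `|a|, continuous (fun x : R => x `^ p)}.
    apply: differentiable_continuous; apply/derivable1_diffP.
    by apply: derivable_powR; rewrite in_itv /= ha.
  apply: (@cvg_comp _ _ _ (fun n => `|u n|) (fun x : R => x `^ p)) hc; exact: cvg_norm.
subst a; rewrite normr0 powR0 ?gt_eqF //.
have hn : (`|u n| @[n --> \oo] --> (0:R))%classic by rewrite -(normr0 R); apply: cvg_norm.
apply: (squeeze_cvgr _ (cvg_cst 0) hn).
have : (\forall n \near \oo, `|u n| < 1)%classic by apply: (cvgr_lt _ hn).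
apply: filterS => n h; rewrite powR_ge0 /=.
have [->|hne] := eqVneq (u n) 0; first by rewrite normr0 powR0 ?gt_eqF.
by apply: ge1r_powR => //; rewrite normr_gt0 hne ltW.
Qed.

End Power.

(** * The diameter of the Johnson graph in a gap realization *)

Lemma ex_subset (T : finType) (A : {set T}) k : (k <= #|A|)%N ->
  exists2 B : {set T}, B \subset A & #|B| = k.
Proof.
move=> hk; exists [set x in take k (enum A)].
  by apply/fintype.subsetP => x; rewrite inE => /mem_take; rewrite mem_enum.
rewrite cardsE (card_uniqP _) ?take_uniq ?enum_uniq // size_takel //.
by rewrite -cardE.
Qed.

Lemma ex_superset (T : finType) (A : {set T}) k : (#|A| <= k <= #|T|)%N ->
  exists2 B : {set T}, A \subset B & #|B| = k.
Proof.
move=> /andP[h1 h2]; have [B hB cB] : exists2 B : {set T}, B \subset ~: A & #|B| = (k - #|A|)%N.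
  by apply: ex_subset; have := cardsC A; lia.
exists (A :|: B); first exact: finset.subsetUl.
rewrite cardsU cB; suff -> : A :&: B = finset.set0 by rewrite cards0; lia.
by apply/eqP; rewrite setI_eq0 disjoint_sym finset.disjoints_subset.
Qed.

Definition mk_ksubset (Q t : nat) (S : {set 'I_Q}) (h : #|S| == t) : ksubset Q t :=
  exist (fun S : {set 'I_Q} => is_true (#|S| == t)) S h.

Section Diameter.
Variables (R : realType) (p : R) (z y Q d : nat).
Hypotheses (hp : 1 <= p) (hzy : (y < z)%N) (hQ : (z <= Q)%N).
Variable tau : ksubset Q z + ksubset Q y -> 'rV[R]_d.
Hypothesis htau : forall u v, johnson u v -> pnorm p (tau (inl u) - tau (inr v)) = 1.

(** The recurrence for one more exchange: two edges of length 1 give 2^p (1 + 1), and joining them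
    to the rest of the path costs another 2^p. *)
Definition diam_step (c : R) : R := 2 `^ p * (c + 2 `^ p * (1 + 1)).

Lemma diam_step_ge (j : nat) : 0 <= iter j diam_step 0 <= iter j.+1 diam_step 0.
Proof.
have h1 : 1 <= 2 `^ p :> R.
  by have := @ler_powR R 2 (ler1n _ 2) 0 p; rewrite powRr0; apply; apply: le_trans hp.
have hge c : 0 <= c -> c <= diam_step c.
  by move=> hc; rewrite /diam_step; nra.
elim: j => [|j /andP[h2 h3]]; first by rewrite lexx hge.
have h4 := le_trans h2 h3.
by rewrite h4 [iter j.+2 _ _]iterS hge.
Qed.

Lemma pnorm_diff_trans (a b c : 'rV[R]_d) :
  pnorm p (a - c) <= 2 `^ p * (pnorm p (a - b) + pnorm p (b - c)).
Proof. by have := pnormD hp (a - b) (b - c); rewrite addrA subrK. Qed.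

Lemma pnorm_diffC (a b : 'rV[R]_d) : pnorm p (a - b) = pnorm p (b - a).
Proof. by rewrite -pnormN opprB. Qed.

(* Exchanging one element of [u] costs two edges of the Johnson graph. *)
Lemma diameter_path (j : nat) (u u' : ksubset Q z) :
  (#|sval u :\: sval u'| <= j)%N ->
  pnorm p (tau (inl u) - tau (inl u')) <= iter j diam_step 0.
Proof.
elim: j u => [|j IH] u hj.
  suff -> : u = u' by rewrite subrr pnorm0.
  apply: val_inj; apply/eqP; rewrite eqEcard (eqP (valP u)) (eqP (valP u')) leqnn andbT.
  by rewrite -finset.setD_eq0 -cards_eq0 -leqn0.
have [->|ne] := eqVneq u u'.
  by rewrite subrr pnorm0 //; have /andP[] := diam_step_ge j.+1.
have [a ha] : exists a, a \in sval u :\: sval u'.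
  apply/finset.set0Pn; rewrite finset.setD_eq0; apply: contra ne => hs.
  by apply/eqP/val_inj/eqP; rewrite eqEcard hs (eqP (valP u)) (eqP (valP u')) /=.
have [b hb] : exists b, b \in sval u' :\: sval u.
  apply/finset.set0Pn; rewrite finset.setD_eq0; apply: contra ne => hs.
  by apply/eqP/val_inj/eqP; rewrite eq_sym eqEcard hs (eqP (valP u)) (eqP (valP u')) /=.
move: ha hb; rewrite !finset.in_setD => /andP[au' au] /andP[bu bu'].
have cz : #|sval u :\ a| = z.-1.
  by have := cardsD1 a (sval u); rewrite au (eqP (valP u)); lia.
have c1 : #|b |: (sval u :\ a)| == z.
  by rewrite cardsU1 cz !finset.inE (negPf bu) andbF /=; apply/eqP; lia.
pose u1 : ksubset Q z := mk_ksubset c1.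
have [B hB /eqP cB] : exists2 B : {set 'I_Q}, B \subset sval u :\ a & #|B| = y.
  by apply: ex_subset; rewrite cz; lia.
pose v : ksubset Q y := mk_ksubset cB.
have adj1 : johnson u v by apply: fintype.subset_trans hB _; exact: finset.subD1set.
have adj2 : johnson u1 v by apply: fintype.subset_trans hB _; exact: finset.subsetUr.
have h1 : (#|sval u1 :\: sval u'| <= j)%N.
  have e : sval u1 :\: sval u' = (sval u :\: sval u') :\ a.
    apply/setP => x; rewrite /= !finset.inE; case: (eqVneq x b) => [->|_] /=.
      by rewrite bu' (negPf bu) /= andbF.
    by rewrite andbCA.
  rewrite e; have := cardsD1 a (sval u :\: sval u').
  by rewrite finset.in_setD au au' add1n => ec; move: hj; rewrite ec ltnS.
rewrite iterS /diam_step.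
apply: le_trans (pnorm_diff_trans _ (tau (inl u1)) _) _.
rewrite ler_wpM2l ?powR_ge0 // addrC lerD //; first exact: IH.
apply: le_trans (pnorm_diff_trans _ (tau (inr v)) _) _.
by rewrite htau // pnorm_diffC htau.
Qed.

Definition diam_bound : R := 2 `^ p * (iter z diam_step 0 + 1).

(** Some z-set contains [v], and at most [z] exchanges lead to it from [u], whatever the size of the
    ground set. So the bound involves [p] and [z] only. *)
Lemma diameter_le (u : ksubset Q z) (v : ksubset Q y) :
  pnorm p (tau (inl u) - tau (inr v)) <= diam_bound.
Proof.
have [B hB /eqP cB] : exists2 B : {set 'I_Q}, sval v \subset B & #|B| = z.
  by apply: ex_superset; rewrite (eqP (valP v)) card_ord; lia.
pose u' : ksubset Q z := mk_ksubset cB.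
apply: le_trans (pnorm_diff_trans _ (tau (inl u')) _) _.
rewrite ler_wpM2l ?powR_ge0 // lerD //; last by rewrite htau.
apply: diameter_path; apply: leq_trans (eq_leq (eqP (valP u))).
by apply: subset_leq_card; exact: finset.subsetDl.
Qed.

End Diameter.

(** * Rational tables for gap realizations *)

Lemma cvg_rat_approx (R : realType) (a : R) :
  exists q : nat -> rat, (ratr (q n) @[n --> \oo] --> a)%classic.
Proof.
have ex n : exists q : rat, `|ratr q - a| <= n.+1%:R^-1 :> R.
  have e0 : 0 < n.+1%:R^-1 :> R by rewrite invr_gt0 ltr0n.
  move: (n.+1%:R^-1) e0 => e e0.
  have [q] : exists q, ratr q \in `](a - e), (a + e)[.
    by apply: rat_in_itvoo; lra.
  rewrite in_itv /= => /andP[h1 h2]; exists q.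
  by rewrite ler_norml; apply/andP; split; lra.
have [q hq] := choice ex; exists q.
apply/cvgrPdist_le => e e0.
move/cvgrPdist_le: (@cvg_harmonic R) => /(_ _ e0); apply: filterS => n.
rewrite sub0r normrN ger0_norm ?invr_ge0 // => h.
by rewrite distrC; apply: le_trans h.
Qed.

Section RatApprox.
Variables (R : realType) (p : R) (hp : 1 <= p) (W : finType) (d : nat).

(** Continuity of the p-th power handles each pair of entries; there are finitely many pairs, so one
    index of the approximating sequences serves them all. *)
Lemma rat_table_approx (t : W -> 'rV[R]_d) (eta : R) : 0 < eta ->
  exists r : W -> 'rV[rat]_d, forall u v,
    `|pnorm p (map_mx ratr (r u - r v)) - pnorm p (t u - t v)| <= eta.
Proof.
move=> eta0.
have ex (wi : W * 'I_d) := cvg_rat_approx (t wi.1 ord0 wi.2).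
have [q hq] := choice ex.
pose r n w : 'rV[rat]_d := \row_i q (w, i) n.
have hc u v : (pnorm p (map_mx ratr (r n u - r n v)) @[n --> \oo] -->
    pnorm p (t u - t v))%classic.
  apply: cvg_big => //; first exact: add_continuous.
  move=> i _; apply: cvg_powR_norm => //.
  rewrite (_ : (fun n => _) = (fun n => ratr (q (u, i) n) - ratr (q (v, i) n))); last first.
    by apply/funext => n; rewrite !mxE rmorphB.
  by rewrite !mxE; apply: cvgB; [exact: (hq (u, i)) | exact: (hq (v, i))].
have : (\forall n \near \oo, forall uv : W * W,
    `|pnorm p (map_mx ratr (r n uv.1 - r n uv.2)) - pnorm p (t uv.1 - t uv.2)| <= eta)%classic.
  apply: filter_forall => -[u v] /=; near=> n; rewrite distrC.
  by near: n; move/cvgrPdist_le: (hc u v); apply.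
move=> [n _ /(_ n (leqnn n)) h]; exists (r n) => u v; exact: (h (u, v)).
Unshelve. all: by end_near. Qed.

End RatApprox.

Section GapTable.
Variables (R : realType) (p : R) (z y Q : nat) (lam : R).
Hypotheses (hp : 1 <= p) (hzy : (y < z)%N) (hQ : (z <= Q)%N) (hlam : 1 <= lam).

Lemma pnormZ d (c : R) (x : 'rV[R]_d) : pnorm p (c *: x) = `|c| `^ p * pnorm p x.
Proof.
rewrite /pnorm mulr_sumr; apply: eq_bigr => i _.
by rewrite mxE normrM powRM.
Qed.

(** The lower bound 1 - eta holds for all pairs because [lam] is at least 1. It is stated separately
    since a collapsed column may be sent to an arbitrary pair. *)
Lemma gap_table (eta : R) : 0 < eta <= 1 ->
  (exists d (tau : ksubset Q z + ksubset Q y -> 'rV[R]_d),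
     gap_realizes p (@johnson Q z y) lam tau) ->
  exists d (r : ksubset Q z + ksubset Q y -> 'rV[rat]_d), forall u v,
    let D := pnorm p (map_mx ratr (r (inl u) - r (inr v))) in
    [/\ johnson u v -> D <= 1 + eta, 1 - eta <= D,
        ~~ johnson u v -> lam `^ p - eta <= D & D <= diam_bound p z + 1].
Proof.
move=> /andP[eta0 eta1] [d [tau [beta [beta0 htau]]]].
(* Normalizes the length of the edges to 1. *)
pose t w := beta^-1 *: tau w.
have p_gt0 : 0 < p by apply: lt_le_trans hp.
have scale (x : 'rV[R]_d) : pnorm p (beta^-1 *: x) = (lp_norm p x / beta) `^ p.
  have b0 : 0 <= beta^-1 by rewrite invr_ge0 ltW.
  have n0 : 0 <= lp_norm p x by exact: powR_ge0.
  rewrite pnormZ -(lp_norm_powR hp) (ger0_norm b0).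
  by rewrite [in RHS]mulrC (powRM _ b0 n0).
have adj u v : johnson u v -> pnorm p (t (inl u) - t (inr v)) = 1.
  move=> h; rewrite /t -scalerBr scale; have := htau u v; rewrite h => ->.
  by rewrite mulfV ?gt_eqF // powR1.
have nadj u v : ~~ johnson u v -> lam `^ p <= pnorm p (t (inl u) - t (inr v)).
  move=> h; rewrite /t -scalerBr scale; have := htau u v; rewrite (negPf h) => h1.
  have n0 : 0 <= lp_norm p (tau (inl u) - tau (inr v)) / beta.
    by rewrite divr_ge0 ?powR_ge0 // ltW.
  have l0 : 0 <= lam := le_trans ler01 hlam.
  by apply: (ge0_ler_powR (ltW p_gt0)); rewrite ?nnegrE // ler_pdivlMr.
have lam1 : 1 <= lam `^ p.
  by have := @le1r_powR R lam p hlam hp; exact: le_trans.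
have [r hr] := rat_table_approx hp t eta0.
exists d, r => u v D; have := hr (inl u) (inr v); rewrite -/D ler_norml => /andP[h1 h2].
have h3 := diameter_le hp hzy hQ adj u v.
split; try lra.
- by move=> h; move: h1 h2; rewrite adj // => h1 h2; lra.
- case: (boolP (johnson u v)) => h; first by move: h1; rewrite adj //; lra.
  by have := nadj _ _ h; lra.
- by move=> h; have := nadj _ _ h; lra.
Qed.

End GapTable.

Lemma gap_realizes_le (R : realType) (p : R) (A B : finType) (adj : A -> B -> bool)
    (lam lam' : R) d (tau : A + B -> 'rV[R]_d) :
  lam <= lam' -> gap_realizes p adj lam' tau -> gap_realizes p adj lam tau.
Proof.
move=> hl [beta [b0 h]]; exists beta; split => // u v; have := h u v.
by case: ifP => // _; apply: le_trans; rewrite ler_pM2r.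
Qed.

Lemma gap_realizes1 (R : realType) (p : R) (A B : finType) (adj : A -> B -> bool) :
  exists d (tau : A + B -> 'rV[R]_d), gap_realizes p adj 1 tau.
Proof.
exists 1%N, (fun w => if w is inl _ then 0 else const_mx 1); exists 1; split => // u v.
have e : lp_norm p (0 - const_mx 1 : 'rV[R]_1) = 1.
  by rewrite /lp_norm big_ord1 !mxE sub0r normrN1 !powR1.
by rewrite /= e mul1r lexx; case: ifP.
Qed.

Lemma zeta1_realizable (R : realType) (p alpha : R) (z y : nat) (eps : R) :
  (1 <= y)%N -> (y < z)%N -> 0 <= alpha -> alpha < 1 -> 0 < eps ->
  exists lam : R, [/\ 1 <= lam,
    zeta1 p (z - y) alpha - eps <= alpha + (1 - alpha) * lam
    & forall Q, (z <= Q)%N -> exists d (tau : ksubset Q z + ksubset Q y -> 'rV[R]_d),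
        gap_realizes p (@johnson Q z y) lam tau].
Proof.
move=> hy hyz a0 a1 e0; rewrite /zeta1; set g := gamma_gap _ _.
(* If [fine g] is at most 1, which includes infinite [g] since [fine] is then 0, the target does not
   exceed 1 and constant maps do. Otherwise [g] is finite. *)
have [hg|hg] := lerP (fine g) 1.
  exists 1; split => // [|Q _]; last exact: gap_realizes1.
  have : (1 - alpha) * (fine g - 1) <= 0 by apply: mulr_ge0_le0; lra.
  by lra.
have gE : g = (fine g)%:E.
  have gt1_fine (h : \bar R) : 1 < fine h -> h = (fine h)%:E.
    by case: h => [r||] //=; rewrite ltr10.
  exact: gt1_fine.
(* Strictly below [g], hence below the gap number for every [Q]; so some member of the set whose
   supremum it is exceeds [lam]. *)
pose lam := Num.max 1 (fine g - eps).
exists lam; split; first by rewrite le_max lexx.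
  have : fine g - eps <= lam by rewrite le_max lexx orbT.
  by move=> h; nra.
move=> Q hQ; have hlt : (lam%:E < gap_number p (@johnson Q z y))%E.
  apply: (@lt_le_trans _ _ g).
    by rewrite gE lte_fin /lam gt_max hg /= ltrBlDr ltrDl.
  apply: ereal_inf_lbound; exists Q, z; split; [by []|lia|].
  by rewrite subKn // ltnW.
have [_ [lam' [_ [d [tau [_ _ h]]]] <-]] := ereal_sup_gt hlt.
rewrite lte_fin => hl; exists d, tau; apply: gap_realizes_le h; exact: ltW.
Qed.

(** * Distances between points and centers *)

Section Symbols.
Variables (Q z : nat).

Definition symbol_set (s : seq nat) : {set 'I_Q} := [set i : 'I_Q | (i : nat) \in s]%SET.

(** An upper bound for the code size of a list of at most [z] letters below [Q]. *)
Definition symbol_bound : nat := (z * (2 * Q + 2) + 1)%N.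

(* The bound on [sz s] makes this a finite table; [u0] is the value on
   collapsing or malformed columns. *)
Definition symbol_ksubset (t : nat) (u0 : ksubset Q t) (s : seq nat) : ksubset Q t :=
  if (sz s <= symbol_bound)%N then insubd u0 (symbol_set s) else u0.

Lemma card_symbol_set s : uniq s -> all (ltn^~ Q) s -> #|symbol_set s| = size s.
Proof.
move=> hu ha; rewrite cardE -(size_map val); apply/perm_size/uniq_perm => //.
  by rewrite map_inj_uniq ?enum_uniq //; exact: val_inj.
move=> x; apply/mapP/idP.
  by move=> [i]; rewrite mem_enum finset.inE => hi ->.
move=> hx; have hQ : (x < Q)%N := allP ha _ hx.
by exists (Ordinal hQ); rewrite // mem_enum finset.inE.
Qed.

Lemma sval_symbol_ksubset t (u0 : ksubset Q t) s : (t <= z)%N -> uniq s ->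
  all (ltn^~ Q) s -> size s = t -> sval (symbol_ksubset u0 s) = symbol_set s.
Proof.
move=> ht hu ha hs; rewrite /symbol_ksubset.
have h : (sz s <= size s * (2 * Q + 2) + 1)%N.
  elim: s ha {hu hs} => //= x s IH /andP[hx hs]; rewrite sz_cons sz_nat mulSn.
  by have := IH hs; lia.
have le : (size s * (2 * Q + 2) <= z * (2 * Q + 2))%N by rewrite leq_mul2r hs ht orbT.
rewrite (leq_trans h) /symbol_bound ?leq_add2r //.
apply: (@insubdK _ _ (ksubset Q t)).
by rewrite unfold_in card_symbol_set // hs.
Qed.

Lemma symbol_set_sub s s' : all (ltn^~ Q) s' ->
  (symbol_set s' \subset symbol_set s) = all (mem s) s'.
Proof.
move=> ha; apply/fintype.subsetP/allP => h x.
  move=> hx; have hQ : (x < Q)%N := allP ha _ hx.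
  by have := h (Ordinal hQ); rewrite !finset.inE /=; apply.
by rewrite !finset.inE; apply: h.
Qed.

End Symbols.

Lemma PT_symbol_table (Q z t : nat) (u0 : ksubset Q t) (f : ksubset Q t -> word) :
  PT (fun s => f (symbol_ksubset z u0 s)).
Proof.
pose proof (PT_table (fun s => f (insubd u0 (symbol_set Q s))) (symbol_bound Q z) (f u0)
  wt_seqnat_inj) as h.
by apply: wcpt_eq h => // s; rewrite /symbol_ksubset; case: ifP.
Qed.

Section Dsum.
Variables (R : realType) (p : R).

(** The counterpart of [pnorm] for differences of coordinate lists, on which concatenation needs no
    casts between dimensions. *)
Definition dsum (s s' : seq rat) : R :=
  \sum_(x <- zip s s') `|ratr (x.1 - x.2)| `^ p.

Lemma dsum_cat s1 s2 t1 t2 : size s1 = size t1 ->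
  dsum (s1 ++ s2) (t1 ++ t2) = dsum s1 t1 + dsum s2 t2.
Proof. by move=> h; rewrite /dsum zip_cat // big_cat. Qed.

Lemma dsum_flatten (I : Type) (r : seq I) (f g : I -> seq rat) :
  (forall i, size (f i) = size (g i)) ->
  dsum (flatten [seq f i | i <- r]) (flatten [seq g i | i <- r]) =
  \sum_(i <- r) dsum (f i) (g i).
Proof.
move=> h; elim: r => [|i r IH] /=; first by rewrite /dsum !big_nil.
by rewrite dsum_cat // big_cons IH.
Qed.

Definition row_seq d (v : 'rV[rat]_d) : seq rat := [seq v ord0 i | i <- enum 'I_d].

Definition seq_row d (s : seq rat) : 'rV[rat]_d := \row_i nth 0 s i.

Lemma size_row_seq d (v : 'rV[rat]_d) : size (row_seq v) = d.
Proof. by rewrite size_map size_enum_ord. Qed.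

Lemma seq_rowK d s : size s = d -> row_seq (seq_row d s) = s.
Proof.
move=> hs; apply: (@eq_from_nth _ 0); rewrite size_row_seq // => i hi.
by rewrite (nth_map (Ordinal hi)) ?size_enum_ord // mxE nth_enum_ord.
Qed.

Lemma dsum_row_seq d (v w : 'rV[rat]_d) :
  dsum (row_seq v) (row_seq w) = pnorm p (map_mx ratr (v - w)).
Proof.
rewrite /dsum /row_seq zip_map big_map big_enum /=.
by apply: eq_bigr => i _; rewrite !mxE.
Qed.

Lemma enc_point_row d (v : 'rV[rat]_d) :
  enc_point v = flatten [seq enc_rat x | x <- row_seq v].
Proof. by rewrite /row_seq -map_comp. Qed.

End Dsum.

Lemma agreeE v w l : size v = l -> size w = l ->
  agree v w = count (fun i => nth 0 v i == nth 0 w i)%N (iota 0 l).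
Proof.
move=> <-; rewrite /agree; elim: v w => [|x v IH] [|y w] //= [/IH ->].
by rewrite -[in RHS]add1n iotaDl count_map.
Qed.

Lemma count_has_le (I T : Type) (P : I -> T -> bool) (s : seq T) (r : seq I) :
  (count (fun i => has (P i) s) r <= \sum_(x <- s) count (P^~ x) r)%N.
Proof.
elim: s => [|x s IH]; first by rewrite big_nil /= count_pred0.
rewrite big_cons /=; apply: leq_trans (leq_add (leqnn _) IH).
by rewrite -(count_predUI (P^~ x)) leq_addr.
Qed.

(** * Columns on which distinct codewords share a letter *)

Section Collisions.
Variables (n l b : nat) (c : 'I_n -> seq nat).
Hypotheses (hsize : forall i, size (c i) = l)
  (hagree : forall i j, i != j -> (agree (c i) (c j) < b)%N).

(** It will be applied to [sT ++ sS], where common elements of the two sets occur twice and agree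
    everywhere; [x != y] keeps them from counting. *)
Definition collision (s : seq 'I_n) (i : nat) : bool :=
  has (fun x => has (fun y => (x != y) && (nth 0 (c x) i == nth 0 (c y) i)%N) s) s.

Lemma count_collision s : (count (collision s) (iota 0 l) <= size s * (size s * b))%N.
Proof.
apply: leq_trans (count_has_le _ _ _) _.
have sum_le (T : Type) (r : seq T) (F : T -> nat) m : (forall x, (F x <= m)%N) ->
    (\sum_(x <- r) F x <= size r * m)%N.
  move=> h; elim: r => [|x r IH]; first by rewrite big_nil.
  by rewrite big_cons mulSn leq_add.
apply: (sum_le) => x; apply: leq_trans (count_has_le _ _ _) _; apply: sum_le => y.
have [->|ne] := eqVneq x y; first by rewrite (eq_count (a2 := pred0)) ?count_pred0.
rewrite (eq_count (a2 := fun i => nth 0 (c x) i == nth 0 (c y) i)%N) //.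
by rewrite -(agreeE (hsize x) (hsize y)) ltnW // hagree.
Qed.

Lemma collision_inj s i : ~~ collision s i ->
  {in s &, injective (fun x => nth 0 (c x) i)}.
Proof.
move=> /hasPn h x y hx hy e; apply/eqP/negPn/negP => ne.
by have /hasPn/(_ y hy) := h x hx; rewrite ne e eqxx.
Qed.

End Collisions.

Lemma column_map n (c : 'I_n -> seq nat) s i :
  column [seq c x | x <- s] i = [seq nth 0%N (c x) i | x <- s].
Proof. by rewrite /column -map_comp. Qed.

Section Distances.
Variables (R : realType) (p : R) (z y Q d0 : nat).
Variables (r : ksubset Q z + ksubset Q y -> 'rV[rat]_d0) (lam eta B : R).
Hypotheses (hp : 1 <= p) (hzy : (y < z)%N) (hlam : 1 <= lam) (heta : 0 < eta <= 1).
Hypothesis (hr : forall u v,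
    let D := pnorm p (map_mx ratr (r (inl u) - r (inr v))) in
    [/\ johnson u v -> D <= 1 + eta, 1 - eta <= D,
        ~~ johnson u v -> lam `^ p - eta <= D & D <= B]).
Variables (u0 : ksubset Q z) (v0 : ksubset Q y).

Definition tabT (s : seq nat) : 'rV[rat]_d0 := r (inl (symbol_ksubset z u0 s)).
Definition tabS (s : seq nat) : 'rV[rat]_d0 := r (inr (symbol_ksubset z v0 s)).

Variables (n l b L : nat) (c : 'I_n -> seq nat) (kappa : rat).
Hypotheses (hsize : forall i, size (c i) = l) (hQ : forall i, all (ltn^~ Q) (c i))
  (hagree : forall i j, i != j -> (agree (c i) (c j) < b)%N) (kappa_ge0 : 0 <= kappa).

Definition coords (t : seq nat -> 'rV[rat]_d0) (u : seq (seq nat) * seq nat) : seq rat :=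
  flatten [seq row_seq (t (column u.1 i)) | i <- iota 0 l] ++
  [seq if b0 == 0%N then 0 else kappa | b0 <- u.2].

Lemma size_coords t u : size (coords t u) = (l * d0 + size u.2)%N.
Proof.
rewrite size_cat size_map; congr (_ + _)%N; rewrite size_flatten /shape -map_comp.
rewrite -[in RHS](size_iota 0 l); elim: (iota 0 l) => //= i s ->.
by rewrite size_row_seq mulSn.
Qed.

Definition vec t u : 'rV[rat]_(l * d0 + L) := seq_row _ (coords t u).

Lemma row_seq_vec t u : size u.2 = L -> row_seq (vec t u) = coords t u.
Proof. by move=> h; rewrite seq_rowK // size_coords h. Qed.

Lemma pnorm_vec t t' u u' : size u.2 = L -> size u'.2 = L ->
  pnorm p (map_mx ratr (vec t u - vec t' u')) =
  \sum_(i <- iota 0 l) pnorm p (map_mx ratr (t (column u.1 i) - t' (column u'.1 i))) +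
  dsum p [seq if b0 == 0%N then 0 else kappa | b0 <- u.2]
         [seq if b0 == 0%N then 0 else kappa | b0 <- u'.2].
Proof.
move=> h h'; rewrite -dsum_row_seq !row_seq_vec // dsum_cat; last first.
  rewrite !size_flatten /shape -!map_comp; congr sumn; apply: eq_map => i /=.
  by rewrite !size_row_seq.
rewrite dsum_flatten; last by move=> i; rewrite !size_row_seq.
by congr (_ + _); apply: eq_bigr => i _; rewrite dsum_row_seq.
Qed.

Lemma dsum_ge0 s s' : 0 <= dsum p s s' :> R.
Proof. by apply: sumr_ge0 => x _; apply: powR_ge0. Qed.

Lemma dsum_ids (s s' : seq nat) : size s = L ->
  dsum p [seq if b0 == 0%N then 0 else kappa | b0 <- s]
         [seq if b0 == 0%N then 0 else kappa | b0 <- s'] <= L%:R * (ratr kappa) `^ p.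
Proof.
move=> <-; rewrite /dsum.
have h x x' : `|ratr ((if x == 0%N then 0 else kappa) -
    (if x' == 0%N then 0 else kappa))| `^ p <= (ratr kappa : R) `^ p.
  have k0 : 0 <= ratr kappa :> R by rewrite ler0q.
  apply: ge0_ler_powR; rewrite ?nnegrE //; first exact: le_trans hp.
  by case: eqP => _; case: eqP => _; rewrite ?subrr ?sub0r ?subr0 ?raddfN ?rmorph0
    ?normrN ?normr0 ?ger0_norm.
elim: s s' => [|x s IH] [|x' s'] /=; rewrite ?big_nil ?mul0r ?mulr_ge0 ?powR_ge0 //.
rewrite big_cons -natr1 mulrDl mul1r [leRHS]addrC; apply: lerD; [exact: h | exact: IH].
Qed.

Variables (sT sS : seq 'I_n).
Hypotheses (uT : uniq sT) (uS : uniq sS) (cT : size sT = z) (cS : size sS = y).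

Let F i := pnorm p (map_mx ratr
  (tabT (column [seq c x | x <- sT] i) - tabS (column [seq c x | x <- sS] i))).

Let colQ s i : (i < l)%N -> all (ltn^~ Q) (column [seq c x | x <- s] i).
Proof.
move=> hi; rewrite column_map; apply/allP => _ /mapP[x _ ->].
by apply: (allP (hQ x)); apply: mem_nth; rewrite hsize.
Qed.

Let col_uniq s i : {subset s <= sT ++ sS} -> ~~ collision c (sT ++ sS) i -> uniq s ->
  uniq (column [seq c x | x <- s] i).
Proof.
move=> hs hc hu; rewrite column_map map_inj_in_uniq // => x x' hx hx'.
by apply: (collision_inj hc); apply: hs.
Qed.

(** Without a collision, taking the i-th letter is injective on the union of the two sets, and an
    injective map both preserves and reflects inclusion. *)
Let johnson_column i : (i < l)%N -> ~~ collision c (sT ++ sS) i ->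
  johnson (symbol_ksubset z u0 (column [seq c x | x <- sT] i))
          (symbol_ksubset z v0 (column [seq c x | x <- sS] i)) = all (mem sT) sS.
Proof.
move=> hi hc; have hT : {subset sT <= sT ++ sS} by move=> x; rewrite mem_cat => ->.
have hS : {subset sS <= sT ++ sS} by move=> x; rewrite mem_cat orbC => ->.
rewrite /johnson !sval_symbol_ksubset ?symbol_set_sub ?colQ ?col_uniq //;
  try by rewrite column_map size_map.
- rewrite !column_map all_map; apply: eq_in_all => x hx /=.
  apply/mapP/idP => [[x' hx' e]|]; last by exists x.
  by rewrite (collision_inj hc (hS _ hx) (hT _ hx') e).
- exact: ltnW.
Qed.

Let hr_column i := hr (symbol_ksubset z u0 (column [seq c x | x <- sT] i))
  (symbol_ksubset z v0 (column [seq c x | x <- sS] i)).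

Let sum_upper (I : seq nat) (bad : pred nat) (G M : R) : 0 <= G -> 0 <= M ->
  (forall i, i \in I -> ~~ bad i -> F i <= G) -> (forall i, F i <= M) ->
  \sum_(i <- I) F i <= (size I)%:R * G + (count bad I)%:R * M.
Proof.
move=> G0 M0; elim: I => [|i I IH] h1 h2; first by rewrite big_nil !mul0r addr0.
rewrite big_cons /= natrD -natr1 !mulrDl.
have IH' := IH (fun j hj => h1 j (@mem_behead _ (i :: I) j hj)) h2.
move: (IH'); move: ((size I)%:R * G) ((count bad I)%:R * M) => a1 a2 IH2.
case: (boolP (bad i)) => hb; rewrite /= !mul1r.
  by have := h2 i; lra.
by have := h1 i (mem_head _ _) hb; rewrite mul0r; lra.
Qed.

Let sum_lower (I : seq nat) (bad : pred nat) (G : R) : 0 <= G ->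
  (forall i, i \in I -> ~~ bad i -> G <= F i) ->
  ((size I)%:R - (count bad I)%:R) * G <= \sum_(i <- I) F i.
Proof.
move=> G0; elim: I => [|i I IH] h1; first by rewrite big_nil subrr mul0r.
rewrite big_cons /= natrD -natr1.
have IH' := IH (fun j hj => h1 j (@mem_behead _ (i :: I) j hj)).
have F0 : 0 <= F i := pnorm_ge0 _ _.
move: (IH'); move: ((size I)%:R : R) ((count bad I)%:R : R) => a1 a2 IH2.
case: (boolP (bad i)) => hb; rewrite /=.
  rewrite (_ : _ * G = (a1 - a2) * G); last by ring.
  by lra.
rewrite (_ : _ * G = (a1 - a2) * G + G); last by ring.
by have := h1 i (mem_head _ _) hb; lra.
Qed.

Let collisions : nat := ((z + y) * ((z + y) * b))%N.

Let count_bad : (count (collision c (sT ++ sS)) (iota 0 l) <= collisions)%N.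
Proof.
have := count_collision hsize hagree (sT ++ sS).
by rewrite size_cat cT cS.
Qed.

Variables (idT idS : seq nat).
Hypotheses (hidT : size idT = L) (hidS : size idS = L).

Let D := pnorm p (map_mx ratr
  (vec tabT ([seq c x | x <- sT], idT) - vec tabS ([seq c x | x <- sS], idS))).

Lemma dist_upper : 0 <= B -> all (mem sT) sS ->
  D <= l%:R * (1 + eta) + collisions%:R * B + L%:R * (ratr kappa) `^ p.
Proof.
move=> B0 hs; rewrite /D pnorm_vec // lerD ?dsum_ids //.
apply: le_trans (@sum_upper _ (collision c (sT ++ sS)) (1 + eta) B _ _ _ _) _ => //.
- by move/andP: heta => [h _]; lra.
- move=> i; rewrite mem_iota => /andP[_ hi] hb.
  by have [h _ _ _] := hr_column i; apply: h; rewrite johnson_column.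
- by move=> i; have [_ _ _ h] := hr_column i; exact: h.
by rewrite size_iota lerD2l ler_wpM2r // ler_nat.
Qed.

Lemma dist_lower : l%:R * (1 - eta) <= D.
Proof.
rewrite /D pnorm_vec // -[X in X <= _]addr0 lerD ?dsum_ge0 //.
(* No column is declared bad here: the bound 1 - eta is available for every pair in the table,
   collapsed columns included. *)
have := @sum_lower (iota 0 l) pred0 (1 - eta) _ _.
rewrite count_pred0 size_iota subr0; apply.
  by move/andP: heta => [_ h]; lra.
by move=> i _ _; have [_ h _ _] := hr_column i; exact: h.
Qed.

Lemma dist_lower_far : ~~ all (mem sT) sS ->
  (l%:R - collisions%:R) * (lam `^ p - eta) <= D.
Proof.
have lam1 : 1 <= lam `^ p by have := @le1r_powR R lam p hlam hp; exact: le_trans.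
have G0 : 0 <= lam `^ p - eta by move/andP: heta => [_ h]; lra.
move=> hs; rewrite /D pnorm_vec // -[X in X <= _]addr0 lerD ?dsum_ge0 //.
apply: le_trans (@sum_lower (iota 0 l) (collision c (sT ++ sS)) (lam `^ p - eta) G0 _).
  by rewrite size_iota ler_wpM2r // lerB // ler_nat.
move=> i; rewrite mem_iota => /andP[_ hi] hb.
by have [_ _ h _] := hr_column i; apply: h; rewrite johnson_column.
Qed.

End Distances.

(** * The k-median instance *)

Lemma flatten_map_flatten (A B : Type) (f : A -> seq B) (ss : seq (seq A)) :
  flatten [seq f x | x <- flatten ss] = flatten [seq flatten [seq f x | x <- s] | s <- ss].
Proof. by elim: ss => //= s ss <-; rewrite map_cat flatten_cat. Qed.

Lemma zip_mem (A B : eqType) (s : seq A) (t : seq B) x :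
  x \in zip s t -> (x.1 \in s) && (x.2 \in t).
Proof.
elim: s t => [|a s IH] [|b t] //=; rewrite !inE => /predU1P[->|/IH/andP[h1 h2]] /=.
  by rewrite !eqxx.
by rewrite h1 h2 !orbT.
Qed.

Lemma zip_map_l (A B C : Type) (f : A -> C) (s : seq A) (t : seq B) :
  zip [seq f x | x <- s] t = [seq (f x.1, x.2) | x <- zip s t].
Proof. by elim: s t => [|a s IH] [|b t] //=; rewrite IH. Qed.

Lemma unzip2_zip_take (A B : Type) (s : seq A) (t : seq B) :
  unzip2 (zip s t) = take (size s) t.
Proof. by elim: s t => [|a s IH] [|b t] //=; rewrite IH. Qed.

Section Tagged.
Variables (d0 l L : nat) (kappa : rat) (t : seq nat -> 'rV[rat]_d0).
Hypothesis kappa_neq0 : kappa != 0.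

Lemma size_zip_words (T : eqType) (X : seq T) u : u \in zip X (words 2 L) -> size u.2 = L.
Proof. by move/zip_mem => /andP[_]; rewrite mem_words => /andP[/eqP]. Qed.

(** The tag can be read back from the last [L] coordinates, as 0 and [kappa] differ, and the tags
    are distinct words. So repeated points become distinct. *)
Lemma uniq_vec (X : seq (seq (seq nat))) :
  uniq [seq vec l L kappa t u | u <- zip X (words 2 L)].
Proof.
pose h (v : 'rV[rat]_(l * d0 + L)) : seq nat :=
  [seq if x == 0 then 0%N else 1%N | x <- drop (l * d0) (row_seq v)].
have key u : u \in zip X (words 2 L) -> h (vec l L kappa t u) = u.2.
  move=> hu; have hs := size_zip_words hu.
  rewrite /h row_seq_vec // /coords drop_cat.
  have sz1 : size (flatten [seq row_seq (t (column u.1 i)) | i <- iota 0 l]) = (l * d0)%N.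
    by have := size_coords l kappa t u; rewrite /coords size_cat size_map => /addIn.
  rewrite sz1 ltnn subnn drop0 -map_comp.
  have : all (ltn^~ 2) u.2 by move/zip_mem: hu => /andP[_]; rewrite mem_words => /andP[].
  elim: (u.2) => //= b s IH /andP[hb /IH ->]; congr (_ :: _).
  by case: b hb => [|[|b]] //= _; rewrite ?eqxx // (negPf kappa_neq0).
apply: (@map_uniq _ _ h); rewrite -map_comp.
have -> : [seq (h \o vec l L kappa t) u | u <- zip X (words 2 L)] = unzip2 (zip X (words 2 L)).
  by apply/eq_in_map => u hu; exact: key.
by rewrite unzip2_zip_take; exact: take_uniq (words_uniq _ _).
Qed.
End Tagged.

Definition rd_kmed (K y d0 : nat) (tT tS : seq nat -> 'rV[rat]_d0) (kappa : rat)
    (w : word) : kmed_instance :=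
  KMedInstance [seq vec (rd_l K w) (rd_L K w) kappa tT u | u <- rd_P K (2 * K) w]
               [seq vec (rd_l K w) (rd_L K w) kappa tS u | u <- rd_C K (2 * K) y w]
               (rd_k w).

Lemma enc_seq_map (A B : Type) (e : B -> word) (f : A -> B) (s : seq A) :
  enc_seq e [seq f x | x <- s] = enc_seq (fun x => e (f x)) s.
Proof. by rewrite /enc_seq size_map -map_comp. Qed.

Lemma enc_seq_eq (A : eqType) (e e' : A -> word) (s : seq A) :
  {in s, e =1 e'} -> enc_seq e s = enc_seq e' s.
Proof. by move=> h; rewrite /enc_seq; congr (_ ++ flatten _); apply/eq_in_map. Qed.

Lemma enc_point_vec d0 l L kappa (t : seq nat -> 'rV[rat]_d0) u : size u.2 = L ->
  enc_point (vec l L kappa t u) =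
  enc_vec (enc_rat 0) (enc_rat kappa) (fun s => enc_point (t s)) l u.
Proof.
move=> h; rewrite enc_point_row row_seq_vec // /coords map_cat flatten_cat.
congr (_ ++ _).
  rewrite flatten_map_flatten -map_comp; congr flatten; apply: eq_map => i /=.
  by rewrite enc_point_row.
rewrite -map_comp; congr flatten; apply: eq_map => x /=.
by case: eqP.
Qed.

Lemma rd_enc K y d0 (tT tS : seq nat -> 'rV[rat]_d0) kappa w :
  rd K (2 * K) y d0 (fun s => enc_point (tT s)) (fun s => enc_point (tS s))
    (enc_rat 0) (enc_rat kappa) w = enc_kmed (rd_kmed K y tT tS kappa w).
Proof.
rewrite /rd /enc_kmed /=; congr (_ ++ (_ ++ (_ ++ _))); rewrite enc_seq_map.
  by apply: enc_seq_eq => u hu; rewrite enc_point_vec // (size_zip_words hu).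
by apply: enc_seq_eq => u hu; rewrite enc_point_vec // (size_zip_words hu).
Qed.

Lemma sum_le_const (R : numDomainType) (T : eqType) (s : seq T) (F : T -> R) U :
  (forall x, x \in s -> F x <= U) -> \sum_(x <- s) F x <= (size s)%:R * U.
Proof.
elim: s => [|x s IH] h; first by rewrite big_nil mul0r.
rewrite big_cons /= -natr1 mulrDl mul1r addrC lerD ?h ?mem_head //.
by apply: IH => y hy; rewrite h // inE hy orbT.
Qed.

Lemma sum_nseq (R : pzRingType) (T : Type) (m : nat) (x : T) (F : T -> R) :
  \sum_(a <- nseq m x) F a = m%:R * F x.
Proof.
elim: m => [|m IH]; first by rewrite big_nil mul0r.
by rewrite /= big_cons IH -natr1 mulrDl mul1r addrC.
Qed.

Lemma sum_if (R : comPzRingType) (T : Type) (s : seq T) (P : pred T) (x y : R) :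
  \sum_(a <- s) (if P a then x else y) =
  (count P s)%:R * x + ((size s)%:R - (count P s)%:R) * y.
Proof.
elim: s => [|a s IH]; first by rewrite big_nil subrr !mul0r addr0.
by rewrite big_cons IH /= natrD -natr1; case: (P a) => /=; ring.
Qed.

Section Instance.
Variables (R : realType) (p : R) (z y K d0 : nat) (I : jc_instance).
Variables (tT tS : seq nat -> 'rV[rat]_d0) (kappa : rat).
Hypotheses (hK : (0 < K)%N) (hyK : (y <= K)%N) (hyz : (y < z)%N)
  (hI : jc_valid z I) (hkappa : kappa != 0).
Let w := enc_jc I.
Let b := rd_b w.
Let l := rd_l K w.
Let L := rd_L K w.
Variable c : 'I_(jc_n I) -> seq nat.
Hypotheses (hcode : rd_code K (2 * K) w = [seq c i | i <- enum 'I_(jc_n I)])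
  (hsize : forall i, size (c i) = l)
  (hagree : forall i j, i != j -> (agree (c i) (c j) < b)%N).

Let km := rd_kmed K y tT tS kappa w.

Let copies : seq {set 'I_(jc_n I)} :=
  flatten [seq nseq (2 ^ (K * b)) T | T : {set 'I_(jc_n I)} <- jc_E I].

Let code (T : {set 'I_(jc_n I)}) : seq (seq nat) := [seq c i | i <- enum T].

Let rd_PE : rd_P K (2 * K) w = [seq (code q.1, q.2) | q <- zip copies (words 2 L)].
Proof.
rewrite /rd_P (rd_TE hcode) -zip_map_l; congr zip; rewrite map_flatten -!map_comp.
congr flatten; apply: eq_map => T /=.
rewrite map_nseq -(size_words 2 (K * b)); elim: (words _ _) => //= x s ->.
by [].
Qed.

Let size_copies : size copies = (size (jc_E I) * 2 ^ (K * b))%N.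
Proof.
rewrite size_flatten /shape -map_comp; elim: (jc_E I) => //= T E ->.
by rewrite size_nseq mulSn.
Qed.

(** There are enough tags: [zip] drops no copy of a point, because the number of sets is below 2^b
    and [L] is [b + K * b]. *)
Let size_copies_le : (size copies <= size (words 2 L))%N.
Proof.
rewrite size_copies size_words /L /rd_L expnD leq_mul2r; apply/orP; right.
by have := rd_b_bound I; rewrite -/w -/b; lia.
Qed.

Lemma size_km_P : size (km_P km) = (size (jc_E I) * 2 ^ (K * b))%N.
Proof.
by rewrite /= size_map rd_PE size_map size_zip (minn_idPl size_copies_le) size_copies.
Qed.

(** The number of tuples is at most n^y <= 2^(b y), and y <= K. This bounds the number of centers
    and shows that no center is lost for want of a tag. *)
Let size_tuples_le : (size (tuples b (rd_code K (2 * K) w) y) <= 2 ^ (K * b))%N.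
Proof.
apply: leq_trans (size_tuples _ _ _) _.
rewrite hcode size_map size_enum_ord.
apply: (@leq_trans ((2 ^ b) ^ y)).
  by apply: leq_expr; have := rd_b_bound I; rewrite -/w -/b; lia.
by rewrite -expnM leq_exp2l // mulnC leq_mul2r hyK orbT.
Qed.

Lemma size_km_C : (size (km_C km) <= 2 ^ (K * b))%N.
Proof.
rewrite /= size_map size_zip; apply: leq_trans (geq_minl _ _) _.
exact: size_tuples_le.
Qed.

Let mem_centers ws : ws \in tuples b (rd_code K (2 * K) w) y ->
  exists2 u, u \in rd_C K (2 * K) y w & u.1 = ws.
Proof.
move=> hw; have : ws \in unzip1 (rd_C K (2 * K) y w).
  rewrite unzip1_zip //; apply: leq_trans size_tuples_le _.
  by rewrite size_words leq_exp2l // /L /rd_L leq_addl.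
by case/mapP => u hu ->; exists u.
Qed.

Lemma km_uniq : uniq (km_P km) && uniq (km_C km).
Proof. by apply/andP; split; apply: uniq_vec. Qed.

Let b_le i : (b <= agree (c i) (c i))%N.
Proof. by rewrite agree_refl hsize leq_pmull. Qed.

Let dist (T : {set 'I_(jc_n I)}) idT sS idS : R := lp_norm p (map_mx ratr
  (vec l L kappa tT (code T, idT) - vec l L kappa tS ([seq c i | i <- sS], idS))).

Lemma km_completeness (U : R) :
  (forall (T : {set 'I_(jc_n I)}) (idT : seq nat) (sS : seq 'I_(jc_n I)) (idS : seq nat),
     #|T| = z -> size idT = L -> size idS = L -> uniq sS -> size sS = y ->
     all (mem (enum T)) sS -> dist T idT sS idS <= U) ->
  jc_completeness y I -> exists (C' : (km_k km).-tuple 'rV[rat]_(km_d km)) sigma,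
    kmed_solution C' sigma /\ kmed_cost p sigma <= (size (km_P km))%:R * U.
Proof.
move=> hU [S [hS hcov]].
(* A y-set has many centers, one for each order of its elements; the one listing them as [enum] does
   is selected. *)
have ex (S' : {set 'I_(jc_n I)}) : exists x, #|S'| = y ->
    exists2 u, u \in rd_C K (2 * K) y w & u.1 = code S' /\ x = vec l L kappa tS u.
  case: (eqVneq #|S'| y) => [hy|ne]; last by exists 0 => e; rewrite e eqxx in ne.
  have : code S' \in tuples b (rd_code K (2 * K) w) y.
    rewrite hcode -hy cardE; apply: tuples_mem => //; exact: enum_uniq.
  by move=> /mem_centers[u hu e]; exists (vec l L kappa tS u) => _; exists u.
have [f hf] := choice ex.
have hk : size [seq f x | x <- S] == km_k km.
  by rewrite size_map size_tuple /= rd_kE.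
pose C' : (km_k km).-tuple 'rV[rat]_(km_d km) := Tuple hk.
have exs a : exists x, a \in km_P km -> x \in C' /\ lp_norm p (map_mx ratr (a - x)) <= U.
  case: (boolP (a \in km_P km)) => [|_]; last by exists 0.
  rewrite /= rd_PE -map_comp => /mapP[[T id] hq ->] /=.
  have /andP[/= hT _] := zip_mem hq; have hid := size_zip_words hq.
  have hTE : T \in jc_E I.
    by case/flattenP: hT => s /mapP[T' hT' ->] /nseqP[-> _].
  have /hasP[S' hS' sub] := allP hcov _ hTE.
  have cS' : #|S'| = y by apply/eqP; exact: (allP hS).
  have [u hu [e1 e2]] := hf S' cS'.
  exists (f S') => _; split; first exact: map_f.
  rewrite e2; have -> : u = ([seq c i | i <- enum S'], u.2).
    by rewrite [LHS]surjective_pairing e1.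
  apply: hU => //.
  - by case: hI => _ /allP/(_ _ hTE)/eqP.
  - exact: size_zip_words hu.
  - exact: enum_uniq.
  - by rewrite -cardE.
  - by apply/allP => i; rewrite /= !mem_enum; apply: (fintype.subsetP sub).
have [sigma hs] := choice exs.
exists C', sigma; split.
  split; last by move=> a /hs[].
  move=> x /mapP[S' hS' ->]; have cS' : #|S'| = y by apply/eqP; exact: (allP hS).
  by have [u hu [_ ->]] := hf S' cS'; apply: map_f.
by apply: sum_le_const => a /hs[].
Qed.

(** Each chosen center names a y-set, and these k sets cover at most a fraction alpha of the
    collection. All the sets have equally many copies, so at least a fraction 1 - alpha of the
    points pay [g2] and the others at least [g1]; as g1 <= g2, covering exactly alpha is the worst
    case. *)
Lemma km_soundness (alpha g1 g2 : R) : g1 <= g2 ->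
  (forall (T : {set 'I_(jc_n I)}) (idT : seq nat) (sS : seq 'I_(jc_n I)) (idS : seq nat),
     #|T| = z -> size idT = L -> size idS = L -> uniq sS -> size sS = y ->
     g1 <= dist T idT sS idS /\ (~~ all (mem (enum T)) sS -> g2 <= dist T idT sS idS)) ->
  jc_soundness alpha y I -> forall (C' : (km_k km).-tuple 'rV[rat]_(km_d km)) sigma,
    kmed_solution C' sigma ->
    (size (km_P km))%:R * (alpha * g1 + (1 - alpha) * g2) <= kmed_cost p sigma.
Proof.
move=> g12 hg hsound C' sigma [hC' hsigma].
have ex x : exists S' : {set 'I_(jc_n I)}, x \in km_C km -> exists sS idS,
    [/\ uniq sS, size sS = y, size idS = L, x = vec l L kappa tS ([seq c i | i <- sS], idS)
      & S' = [set i in sS]%SET].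
  case: (boolP (x \in km_C km)) => [|_]; last by exists finset.set0.
  move=> /mapP[u hu ->]; have /andP[hu1 _] := zip_mem hu.
  move: hu1; rewrite hcode => /(mem_tuples b_le)[sS [h1 h2 h3]].
  exists [set i in sS]%SET => _; exists sS, u.2; split => //.
    exact: size_zip_words hu.
  by rewrite -h3 -surjective_pairing.
have [g hgx] := choice ex.
have hk : size [seq g x | x <- C'] == jc_k I.
  by rewrite size_map size_tuple /= rd_kE.
pose S : (jc_k I).-tuple {set 'I_(jc_n I)} := Tuple hk.
have cardS : all (fun S' : {set 'I_(jc_n I)} => #|S'| == y) S.
  apply/allP => S' /mapP[x hx ->]; have [sS [idS [h1 h2 _ _ ->]]] := hgx x (hC' _ hx).
  by rewrite cardsE (card_uniqP h1) h2.
have {}hsound := hsound S cardS.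
pose h T := if covered S T then g1 else g2.
have hcopies T : T \in copies -> T \in jc_E I.
  by case/flattenP => s /mapP[T' hT' ->] /nseqP[-> _].
have e1 : \sum_(q <- zip copies (words 2 L)) h q.1 =
    (2 ^ (K * b))%:R * \sum_(T <- jc_E I) h T.
  rewrite -(big_map (fun q => q.1) xpredT h) -/(unzip1 _) unzip1_zip ?size_copies_le //.
  rewrite big_flatten big_map mulr_sumr; apply: eq_bigr => T _.
  exact: sum_nseq.
have e2 : \sum_(q <- zip copies (words 2 L)) h q.1 <= kmed_cost p sigma.
  rewrite /kmed_cost /= rd_PE -map_comp big_map.
  rewrite [leLHS]big_seq [leRHS]big_seq; apply: ler_sum => -[T id] hq /=.
  have /andP[/= hT _] := zip_mem hq; have hid := size_zip_words hq.
  have cT : #|T| = z by case: hI => _ /allP/(_ _ (hcopies _ hT))/eqP.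
  have ha : vec l L kappa tT (code T, id) \in km_P km.
    rewrite /= rd_PE -map_comp; apply/mapP; exists (T, id) => //.
  have hs := hsigma _ ha.
  have [sS [idS [h1 h2 h3 h4 h5]]] := hgx _ (hC' _ hs).
  have [d1 d2] := hg T id sS idS cT hid h3 h1 h2.
  rewrite /dist -h4 in d1 d2.
  rewrite /h; case: ifP => // hcov; apply: d2; apply/negP => hsub.
  move/negP: hcov; apply; apply/hasP; exists (g (sigma (vec l L kappa tT (code T, id)))).
    exact: map_f.
  rewrite h5; apply/fintype.subsetP => i; rewrite finset.inE => hi.
  by have := allP hsub _ hi; rewrite /= mem_enum.
apply: le_trans e2; rewrite e1 size_km_P natrM -mulrA mulrCA ler_wpM2l ?ler0n //.
rewrite /h sum_if.
move: hsound; set a := (count _ _)%:R; set m := (size _)%:R => hsound.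
nra.
Qed.

End Instance.

(** * Comparison with the scale given by the logarithm of the number of points *)

Section Scales.
Variables (R : realType) (p theta l lnn : R).
Hypotheses (hp : 1 <= p) (theta0 : 0 < theta) (theta1 : theta <= 10^-1) (l0 : 0 <= l).
Hypotheses (lnn_ge : l * ln 2 <= lnn).

Let ln2_gt0 : 0 < ln 2 :> R. Proof. by rewrite ln_gt0 ?ltr1n. Qed.
Let ip0 : 0 <= p^-1. Proof. by rewrite invr_ge0; exact: le_trans hp. Qed.
Let lnn0 : 0 <= lnn. Proof. by apply: le_trans lnn_ge; rewrite mulr_ge0 // ltW. Qed.
Let c0 : 0 <= (1 + 3 * theta) / ln 2.
Proof. by apply: divr_ge0; [have := theta0; lra | exact: ltW]. Qed.

Lemma scale_upper : (l * (1 + 3 * theta)) `^ p^-1 <=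
  ((1 + 3 * theta) / ln 2) `^ p^-1 * lnn `^ p^-1.
Proof.
have th0 := theta0.
have h1 : 0 <= l * (1 + 3 * theta) by rewrite mulr_ge0 //; lra.
rewrite -powRM //; apply: (ge0_ler_powR ip0); rewrite ?nnegrE //; first exact: mulr_ge0.
rewrite mulrAC ler_pdivlMr //.
have h2 : 0 <= 1 + 3 * theta by lra.
by have := ler_wpM2l h2 lnn_ge; rewrite [in X in X -> _]mulrA [_ * l]mulrC.
Qed.

Lemma scale_lower (Z Z' e : R) : lnn <= l * (1 + theta) * ln 2 -> 1 <= Z -> 0 < e ->
  10 * theta * Z <= e -> Z' <= Z - e ->
  Z' * (((1 + 3 * theta) / ln 2) `^ p^-1 * lnn `^ p^-1) <=
  (l * (1 - theta) ^+ 2) `^ p^-1 * Z.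
Proof.
move=> lnn_le Z1 e0 he hZ'; have th0 := theta0; have th1 := theta1.
set g := (l * (1 - theta) ^+ 2) `^ p^-1.
have g0 : 0 <= g by exact: powR_ge0.
have th2 : 0 <= (1 - theta) ^+ 2 by exact: sqr_ge0.
have h0 : 0 <= l * (1 - theta) ^+ 2 by exact: mulr_ge0.
have r1 : 1 <= 1 + 10 * theta by lra.
have r0 : 0 <= 1 + 10 * theta by lra.
(* For theta <= 1/10, (1 + 3 theta)(1 + theta) <= (1 - theta)^2 (1 + 10 theta). The root of the last
   factor is at most the factor itself, since it is at least 1 and p >= 1. *)
have key : ((1 + 3 * theta) / ln 2) `^ p^-1 * lnn `^ p^-1 <= g * (1 + 10 * theta).
  apply: (@le_trans _ _ (g * (1 + 10 * theta) `^ p^-1)); last first.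
    by rewrite ler_wpM2l // ler1_powR // invf_le1 //; exact: lt_le_trans hp.
  rewrite -!powRM //; apply: (ge0_ler_powR ip0); rewrite ?nnegrE //; [exact: mulr_ge0|exact: mulr_ge0|].
  apply: (@le_trans _ _ ((1 + 3 * theta) / ln 2 * (l * (1 + theta) * ln 2))).
    exact: ler_wpM2l.
  rewrite (_ : _ * (l * _ * _) = l * ((1 + 3 * theta) * (1 + theta))); last first.
    by field; rewrite gt_eqF.
  rewrite -mulrA ler_wpM2l //; nra.
(* A large epsilon can make the factor [Z'] negative; multiplying [key] by it would then reverse the
   inequality. *)
have [hneg|hpos] := lerP Z' 0.
  apply: (@le_trans _ _ 0); first by rewrite mulr_le0_ge0 // mulr_ge0 ?powR_ge0.
  by rewrite mulr_ge0 //; lra.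
apply: le_trans (ler_wpM2l (ltW hpos) key) _.
rewrite mulrCA ler_wpM2l //.
apply: (@le_trans _ _ ((Z - e) * (1 + 10 * theta))); first by rewrite ler_wpM2r.
nra.
Qed.

End Scales.

Lemma diam_bound_ge0 (R : realType) (p : R) z : 1 <= p -> 0 <= diam_bound p z.
Proof.
move=> hp; have /andP[h _] := diam_step_ge hp z.
by rewrite /diam_bound mulr_ge0 ?powR_ge0 // addr_ge0.
Qed.

Lemma lp_norm_le (R : realType) (p u : R) d (x : 'rV[R]_d) : 1 <= p ->
  pnorm p x <= u -> lp_norm p x <= u `^ p^-1.
Proof.
move=> hp h; apply: ge0_ler_powR; rewrite ?nnegrE ?pnorm_ge0 //.
  by rewrite invr_ge0; exact: le_trans hp.
by apply: le_trans h; exact: pnorm_ge0.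
Qed.

Lemma lp_norm_ge (R : realType) (p u : R) d (x : 'rV[R]_d) : 1 <= p -> 0 <= u ->
  u <= pnorm p x -> u `^ p^-1 <= lp_norm p x.
Proof.
move=> hp h0 h; apply: ge0_ler_powR; rewrite ?nnegrE ?pnorm_ge0 //.
by rewrite invr_ge0; exact: le_trans hp.
Qed.

Section Correct.
Variables (R : realType) (p : R) (z y K d0 : nat).
Let Q := (2 ^ (2 * K))%N.
Variables (r : ksubset Q z + ksubset Q y -> 'rV[rat]_d0) (lam theta B : R) (kappa : rat).
Variables (u0 : ksubset Q z) (v0 : ksubset Q y).
Hypotheses (hp : 1 <= p) (hzy : (y < z)%N) (hlam : 1 <= lam).
Hypotheses (theta0 : 0 < theta) (theta1 : theta <= 10^-1) (B0 : 0 <= B).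
Hypotheses (hr : forall u v,
    let D := pnorm p (map_mx ratr (r (inl u) - r (inr v))) in
    [/\ johnson u v -> D <= 1 + theta, 1 - theta <= D,
        ~~ johnson u v -> lam `^ p - theta <= D & D <= B]).
Hypotheses (hyK : (y <= K)%N) (hK0 : (0 < K)%N).
Hypothesis hK : ((z + y) * (z + y))%:R * (1 + B) + 1 <= K%:R * theta.
Hypotheses (kappa0 : 0 < kappa) (hkappa : (ratr kappa) `^ p <= theta / 2 :> R).
Variables (I : jc_instance) (hI : jc_valid z I).

Let w := enc_jc I.
Let km := rd_kmed K y (tabT r u0) (tabS r v0) kappa w.
Let b := rd_b w.
Let l := rd_l K w.
Let L := rd_L K w.

Let lE : l%:R = K%:R * b%:R :> R. Proof. exact: natrM. Qed.
Let l0 : 0 <= l%:R :> R. Proof. exact: ler0n. Qed.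
Let b_gt0 : (0 < b)%N. Proof. exact: (rd_b_gt0 hI). Qed.
Let ln2_gt0 : 0 < ln 2 :> R. Proof. by rewrite ln_gt0 ?ltr1n. Qed.
(** [hK] packs three demands on [K], each asking for a fraction at most [theta]: 1/K, the error on
    the logarithm; (z + y)^2 B / K, the cost of bad columns ([coll_K]); and (z + y)^2 / K, their
    proportion ([coll1_K]). *)
Let one_K : 1 <= K%:R * theta.
Proof.
apply: le_trans hK; rewrite lerDr mulr_ge0 ?ler0n //.
by have := B0; lra.
Qed.
Let coll_K : ((z + y) * (z + y))%:R * B <= K%:R * theta.
Proof.
have c0 : 0 <= ((z + y) * (z + y))%:R :> R by exact: ler0n.
by apply: le_trans hK; nra.
Qed.
Let coll1_K : ((z + y) * (z + y))%:R <= K%:R * theta.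
Proof.
have c0 : 0 <= ((z + y) * (z + y))%:R :> R by exact: ler0n.
by have B0' := B0; apply: le_trans hK; nra.
Qed.

Let LE : L%:R <= 2 * l%:R :> R.
Proof.
by rewrite -natrM ler_nat /L /rd_L /l /rd_l mul2n -addnn leq_add2r leq_pmull.
Qed.

Let n := size (km_P km).

Let nE : n = (size (jc_E I) * 2 ^ (K * b))%N.
Proof.
have kn0 : kappa != 0 by rewrite gt_eqF.
have [c [hc _ _ _]] := rd_codeP I hK0.
exact: (size_km_P (tabT r u0) (tabS r v0) hK0 hyK hzy kn0 hc).
Qed.

Let E_gt0 : (0 < size (jc_E I))%N.
Proof. by case: hI => _ _; case: (jc_E I). Qed.

Let n_ge : (2 ^ (K * b) <= n)%N.
Proof. by rewrite nE leq_pmull. Qed.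

Let n_gt1 : (1 < n)%N.
Proof.
apply: leq_trans n_ge; rewrite -[2%N]expn1 leq_exp2l // muln_gt0.
by rewrite hK0 b_gt0.
Qed.

Let ln_n_ge : l%:R * ln 2 <= ln n%:R :> R.
Proof.
rewrite mulr_natl -lnXn // -natrX ler_ln ?posrE ?ltr0n ?expn_gt0 //; last exact: ltnW.
by rewrite ler_nat.
Qed.

(** The number of points is 2^(K b) times the size of the collection, which is below 2^b. So the
    logarithm exceeds [l * ln 2] by at most [b * ln 2], a fraction 1/K of it. *)
Let ln_n_le : ln n%:R <= l%:R * (1 + theta) * ln 2 :> R.
Proof.
apply: (@le_trans _ _ (L%:R * ln 2)).
  rewrite mulr_natl -lnXn // -natrX ler_ln ?posrE ?ltr0n ?expn_gt0 //; last exact: ltnW.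
  rewrite ler_nat nE /L /rd_L expnD leq_mul2r; apply/orP; right.
  by apply: leq_trans (ltnW (rd_b_bound I)); exact: leq_addr.
apply: ler_wpM2r; first exact: ltW.
have -> : L%:R = b%:R + l%:R :> R by rewrite -natrD.
rewrite mulrDr mulr1 addrC lerD2l lE.
have b0 : 0 <= b%:R :> R by exact: ler0n.
by have := ler_wpM2r b0 one_K; rewrite mul1r mulrAC.
Qed.

(** The dimension [l * d0 + L] is at most [(d0 + 2) * l], and [l * ln 2] is at most the logarithm of
    the number of points. The centers are at most 2^(K b), hence no more than the points, which
    allows M = 1. *)
Lemma kmed_validP D : (d0 + 2)%:R / ln 2 <= D%:R :> R -> kmed_valid R D 1 km.
Proof.
move=> hD; have kn0 : kappa != 0 by rewrite gt_eqF.
have /andP[uP uC] := km_uniq y K I (tabT r u0) (tabS r v0) kn0.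
split => //.
- apply: (@le_trans _ _ ((d0 + 2)%:R * l%:R)).
    rewrite -natrM ler_nat mulnDl mulnC leq_add2l.
    by have := LE; rewrite -natrM ler_nat.
  have -> : (d0 + 2)%:R * l%:R = (d0 + 2)%:R / ln 2 * (l%:R * ln 2) :> R.
    by field; rewrite gt_eqF.
  apply: ler_pM => //; first by rewrite divr_ge0 ?ler0n // ltW.
  by rewrite mulr_ge0 // ltW.
- have [c [hc _ _ _]] := rd_codeP I hK0.
  apply: (leq_trans (size_km_C (tabT r u0) (tabS r v0) hK0 hyK hzy kn0 hc)).
  by rewrite /poly_bound mul1n expn1; apply: leq_trans n_ge (leq_addr _ _).
Qed.

Let heta : 0 < theta <= 1.
Proof. by rewrite theta0 /=; have := theta1; lra. Qed.

Let kappa_ge0 : 0 <= kappa. Proof. exact: ltW. Qed.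

(** The constant rho. The three [theta] stand for the error of the table, the bad columns and the
    tags; [ln 2] converts the block length into a natural logarithm. *)
Definition yes_scale : R := ((1 + 3 * theta) / ln 2) `^ p^-1.

Lemma kmed_yesP : jc_completeness y I ->
  exists (C' : (km_k km).-tuple 'rV[rat]_(km_d km)) sigma,
    kmed_solution C' sigma /\ kmed_cost p sigma <= yes_scale * kmed_scale p km.
Proof.
move=> hcomp; have kn0 : kappa != 0 by rewrite gt_eqF.
have [c [hc hsize hQ hagree]] := rd_codeP I hK0.
have [|C' [sigma [hs hcost]]] := @km_completeness R p z y K d0 I (tabT r u0) (tabS r v0)
    kappa hK0 hyK hzy hI kn0 c hc hagree ((l%:R * (1 + 3 * theta)) `^ p^-1) _ hcomp.
  move=> T idT sS idS cT hidT hidS uS cS sub; apply: lp_norm_le => //.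
  have cT' : size (enum T) = z by rewrite -cardE.
  apply: le_trans (dist_upper hp hzy heta hr u0 v0 hsize hQ hagree kappa_ge0
    (enum_uniq _) uS cT' cS hidT hidS B0 sub) _.
  have b0 : 0 <= b%:R :> R by exact: ler0n.
  have e1 : ((z + y) * ((z + y) * b))%:R * B <= l%:R * theta.
    rewrite mulnA natrM mulrAC lE [leRHS]mulrAC.
    by apply: ler_wpM2r.
  have e2 : L%:R * (ratr kappa) `^ p <= l%:R * theta.
    apply: (@le_trans _ _ (2 * l%:R * (theta / 2))).
      by apply: ler_pM => //; exact: powR_ge0.
    rewrite (_ : 2 * l%:R * (theta / 2) = l%:R * theta) //.
    by field.
  rewrite -/L in e2; rewrite -/b -/l; move: e1 e2.
  move: (_ * B) (_ * _ `^ p) => a1 a2 e1 e2.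
  rewrite (_ : l%:R * (1 + 3 * theta) = l%:R * (1 + theta) + l%:R * theta + l%:R * theta).
    by rewrite !lerD.
  by ring.
exists C', sigma; split => //; apply: le_trans hcost _.
rewrite /kmed_scale mulrCA ler_wpM2l ?ler0n //.
exact: scale_upper.
Qed.

Lemma kmed_noP (alpha Z' e : R) : 0 <= alpha -> alpha <= 1 -> 0 < e ->
  10 * theta * (alpha + (1 - alpha) * lam) <= e -> Z' <= alpha + (1 - alpha) * lam - e ->
  jc_soundness alpha y I ->
  forall (C' : (km_k km).-tuple 'rV[rat]_(km_d km)) sigma, kmed_solution C' sigma ->
    Z' * (yes_scale * kmed_scale p km) <= kmed_cost p sigma.
Proof.
move=> a0 a1 e0 he hZ' hsound C' sigma hs.
have kn0 : kappa != 0 by rewrite gt_eqF.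
have [c [hc hsize hQ hagree]] := rd_codeP I hK0.
have lam0 : 0 <= lam := le_trans ler01 hlam.
have th2 : 0 <= l%:R * (1 - theta) ^+ 2 by rewrite mulr_ge0 // sqr_ge0.
have th0 := theta0; have th1 := theta1; have hl1 := hlam.
pose g := (l%:R * (1 - theta) ^+ 2) `^ p^-1.
have g0 : 0 <= g by exact: powR_ge0.
have g12 : g <= g * lam by rewrite ler_peMr.
have p0 : 0 < p := lt_le_trans ltr01 hp.
have gE : g * lam = (l%:R * (1 - theta) ^+ 2 * lam `^ p) `^ p^-1.
  by rewrite [in RHS]powRM ?powR_ge0 // -powRrM mulfV ?gt_eqF // powRr1.
have hcost := @km_soundness R p z y K d0 I (tabT r u0) (tabS r v0)
  kappa hK0 hyK hzy hI kn0 c hc hsize alpha g (g * lam) g12 _ hsound C' sigma hs.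
apply: le_trans _ (hcost _); last first.
  move=> T idT sS idS cT hidT hidS uS cS.
  have cT' : size (enum T) = z by rewrite -cardE.
  split.
    apply: lp_norm_ge => //; apply: le_trans _ (dist_lower heta hr u0 v0 l c kappa (enum T) sS hidT hidS).
    by rewrite -/b -/l ler_wpM2l //; nra.
  move=> nsub; rewrite gE; apply: lp_norm_ge => //; first by rewrite mulr_ge0 ?powR_ge0.
  apply: le_trans _ (dist_lower_far hp hzy hlam heta hr u0 v0
      kappa hsize hQ hagree (enum_uniq _) uS cT' cS hidT hidS nsub).
  have b0 : 0 <= b%:R :> R by exact: ler0n.
  have e1 : ((z + y) * ((z + y) * b))%:R <= l%:R * theta.
    by rewrite mulnA natrM lE [leRHS]mulrAC; apply: ler_wpM2r.
  have lamp1 : 1 <= lam `^ p by have := @le1r_powR R lam p hlam hp; exact: le_trans.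
  (* One factor 1 - theta pays for the bad columns, the other for the error of the table, because
     lam^p - theta >= (1 - theta) lam^p when lam >= 1. *)
  rewrite expr2 mulrA -mulrA; apply: ler_pM.
  - by rewrite mulr_ge0 //; lra.
  - by rewrite mulr_ge0 ?powR_ge0 //; lra.
  - rewrite -/b -/l mulrBr mulr1 lerB //.
  - by rewrite mulrBl mul1r lerB // ler_peMr // ltW.
have -> : alpha * g + (1 - alpha) * (g * lam) = g * (alpha + (1 - alpha) * lam) by ring.
rewrite /kmed_scale; set x := _ `^ p^-1.
rewrite (_ : Z' * (yes_scale * (_ * x)) =
  (size (km_P km))%:R * (Z' * (yes_scale * x))); last by ring.
rewrite ler_wpM2l ?ler0n //; apply: scale_lower hZ' => //.
have : (1 - alpha) * 1 <= (1 - alpha) * lam by rewrite ler_wpM2l //; lra.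
by lra.
Qed.

End Correct.

Lemma ksubset_inhabited Q t : (t <= Q)%N -> exists u : ksubset Q t, True.
Proof.
move=> h; have [B _ /eqP cB] : exists2 B : {set 'I_Q}, B \subset [set: 'I_Q] & #|B| = t.
  by apply: ex_subset; rewrite cardsT card_ord.
by exists (mk_ksubset cB).
Qed.

Lemma exists_small_rat (R : realType) (p x : R) : 1 <= p -> 0 < x -> x <= 1 ->
  exists2 q : rat, 0 < q & ratr q `^ p <= x.
Proof.
move=> hp x0 x1; have [q] := rat_in_itvoo x0; rewrite in_itv /= => /andP[h1 h2].
exists q; first by rewrite -(ltr0q R).
apply: le_trans (ltW h2); apply: ge1r_powR => //.
by rewrite h1 ltW // (lt_le_trans h2).
Qed.

Lemma johnson_to_kmedian (R : realType) (p : R) (z y : nat) (alpha eps : R) :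
  1 <= p -> (1 <= y)%N -> (y < z)%N -> 0 <= alpha -> alpha < 1 -> 0 < eps ->
  exists2 rho : R, 0 < rho & exists D M (g : word -> word), PT g /\ forall w,
    (jc_yes z y w -> kmed_yes p rho D M (g w)) /\
    (jc_no alpha z y w -> kmed_no p (zeta1 p (z - y) alpha - eps) rho D M (g w)).
Proof.
move=> hp hy hzy a0 a1 eps0; have e0 : 0 < eps / 2 by rewrite divr_gt0.
have [lam [lam1 hlam hreal]] := zeta1_realizable p hy hzy a0 a1 e0.
set e := eps / 2 in e0 hlam; set Z := alpha + (1 - alpha) * lam in hlam.
have Z1 : 1 <= Z.
  have h : (1 - alpha) * 1 <= (1 - alpha) * lam by apply: ler_wpM2l; lra.
  by rewrite /Z; lra.
have Z0 : 0 < Z by lra.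
(* The last condition makes the total relative loss 10 theta cost at most [e], the second half of
   [eps]; the second one is needed for the estimate of [scale_lower]. *)
have [theta [theta0 theta1 hth]] : exists theta,
    [/\ 0 < theta, theta <= 10^-1 & 10 * theta * Z <= e].
  exists (Num.min 10^-1 (e / (10 * Z))); split.
  - by rewrite lt_min invr_gt0 ltr0n /= divr_gt0 // mulr_gt0.
  - by rewrite ge_min lexx.
  - apply: (@le_trans _ _ (10 * (e / (10 * Z)) * Z)).
      by rewrite ler_pM2r // ler_pM2l // ge_min lexx orbT.
    rewrite (_ : 10 * (e / (10 * Z)) * Z = e) //.
    by field; rewrite gt_eqF.
(* The summand 1 covers the error of the rational table. [B] is independent of [K], so there is no
   circularity in what follows. *)
pose B := diam_bound p z + 1.
have B0 : 0 <= B by rewrite addr_ge0 // diam_bound_ge0.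
pose c2 : R := ((z + y) * (z + y))%:R * (1 + B) + 1.
have c20 : 0 <= c2 / theta.
  rewrite divr_ge0 ?(ltW theta0) // addr_ge0 // mulr_ge0 ?ler0n //; lra.
(* The summand [z] makes the alphabet large enough to have z-subsets, and gives y <= K. *)
pose K := (z + Num.bound (c2 / theta))%N.
have hzK : (z <= K)%N by exact: leq_addr.
have hyK : (y <= K)%N by exact: leq_trans (ltnW hzy) hzK.
have hK0 : (0 < K)%N by exact: leq_trans hy hyK.
have hK : c2 <= K%:R * theta.
  rewrite -ler_pdivrMr //; apply: le_trans (ltW (archi_boundP c20)) _.
  by rewrite ler_nat leq_addl.
have hQ : (z <= 2 ^ (2 * K))%N.
  apply: leq_trans hzK (leq_trans _ (ltnW (ltn_expl (2 * K) (ltnSn 1)))).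
  by rewrite leq_pmull.
have heta : 0 < theta <= 1 by rewrite theta0 /=; lra.
have [d0 [r hr]] := gap_table hp hzy hQ lam1 heta (hreal _ hQ).
have [u0 _] := ksubset_inhabited hQ.
have [v0 _] := ksubset_inhabited (leq_trans (ltnW hzy) hQ).
(* There are L <= 2 l tag coordinates, so theta / 2 for each of them keeps the tags within
   [l * theta]. *)
have [kappa kappa0 hkappa] : exists2 q : rat, 0 < q & ratr q `^ p <= theta / 2 :> R.
  by apply: exists_small_rat => //; lra.
have ln2 : 0 < ln 2 :> R by rewrite ln_gt0 ?ltr1n.
have D0 : 0 <= (d0 + 2)%:R / ln 2 :> R by rewrite divr_ge0 ?ler0n // ltW.
exists (yes_scale p theta).
  by apply: powR_gt0; apply: divr_gt0 => //; lra.
exists (Num.bound ((d0 + 2)%:R / ln 2 : R)), 1%N.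
exists (rd K (2 * K) y d0 (fun s => enc_point (tabT r u0 s))
  (fun s => enc_point (tabS r v0 s)) (enc_rat 0) (enc_rat kappa)); split.
  apply: PT_rd.
    exact: (PT_symbol_table z u0 (fun u => enc_point (r (inl u)))).
  exact: (PT_symbol_table z v0 (fun u => enc_point (r (inr u)))).
have hD := ltW (archi_boundP D0).
move=> w; rewrite rd_enc; split=> -[I [-> hI h]].
  exists (rd_kmed K y (tabT r u0) (tabS r v0) kappa (enc_jc I)); split=> //.
    exact: (kmed_validP r u0 v0 hzy hyK hK0 kappa0 hI hD).
  exact: (kmed_yesP u0 v0 hp hzy theta0 theta1 B0 hr hyK hK0 hK kappa0 hkappa hI h).
exists (rd_kmed K y (tabT r u0) (tabS r v0) kappa (enc_jc I)); split=> //.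
  exact: (kmed_validP r u0 v0 hzy hyK hK0 kappa0 hI hD).
apply: (kmed_noP hp hzy lam1 theta0 theta1 B0 hr hyK hK0 hK kappa0 hI a0 (ltW a1) e0) => //.
by move: hlam; rewrite -/Z /e; lra.
Qed.

Theorem theorem3p13 (R : realType) (p : R) (hp : 1 <= p)
    (z y : nat) (hy : (1 <= y)%N) (hzy : (y < z)%N)
    (alpha : R) (halpha0 : 0 <= alpha) (halpha1 : alpha < 1)
    (hJC : johnson_coverage_NP_hard alpha z y) :
  forall eps : R, 0 < eps ->
    exists rho : R, 0 < rho /\
      exists D M : nat,
        NP_hard (kmed_yes p rho D M)
                (kmed_no p (zeta1 p (z - y)%N alpha - eps) rho D M).
Proof.
move=> eps heps.
have [rho rho0 [D [M [g [hg hred]]]]] :=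
  johnson_to_kmedian hp hy hzy halpha0 halpha1 heps.
exists rho; split=> //; exists D, M => L hL.
have [f [hf hyn]] := hJC L hL.
exists (fun xs => g (f xs)); split; first exact: poly_time_PT.
move=> x; have [h1 h2] := hyn x; have [h3 h4] := hred (f [tuple x]).
by split=> [/h1/h3|/h2/h4].
Qed.
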